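(* Let $\mathbb L\in\{\mathbb R,\mathbb C\}$, $r\in\mathbb N_0\cup\{\infty,\omega\}$, $\mathbb K\in\{\mathbb R,\mathbb L\}$, $k\in\mathbb N$, $E_1,\ldots,E_k$ and $F$ be locally convex $\mathbb L$-vector spaces, $X$ be a locally convex $\mathbb K$-vector space, and $U\subseteq X$ be an open subset. For a map $f$ from $U$ to the space of continuous $k$-linear maps $E_1\times\cdots\times E_k\to F$ write $$f^\wedge\colon U\times E_1\times\cdots\times E_k\to F,\quad (x,y_1,\ldots,y_k)\mapsto f(x)(y_1,\ldots,y_k).$$ Then the following holds. (a) If $(X\times E_1\times\cdots\times E_k)\times(X\times E_1\times\cdots\times E_k)$ is a $k_{\mathbb R}$-space, or $r=0$ and $X\times E_1\times\cdots\times E_k$ is a $k_{\mathbb R}$-space, or $(r,\mathbb K)=(\infty,\mathbb C)$ and $X\times E_1\times\cdots\times E_k$ is a $k_{\mathbb R}$-space, or all of the vector spaces $E_1,\ldots,E_k$ are finite dimensional, then $f^\wedge$ is $C^r_{\mathbb K}$ for each $C^r_{\mathbb K}$-map $f\colon U\to L^k_{\mathbb L}(E_1,\ldots,E_k,F)_c$. (b) If $E:=E_1=E_2=\cdots=E_k$ holds and, moreover, $(X\times E)\times(X\times E)$ is a $k_{\mathbb R}$-space, or $r=0$ and $X\times E$ is a $k_{\mathbb R}$-space, or $(r,\mathbb K)=(\infty,\mathbb C)$ and $X\times E$ is a $k_{\mathbb R}$-space, then $f^\wedge\colon U\times E^k\to F$ is $C^r_{\mathbb K}$ for each $C^r_{\mathbb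 K}$-map $f\colon U\to L^k_{\mathbb L}(E,F)_c$ such that $f(x)$ is a symmetric $k$-linear map for each $x\in U$. (c) If $X$ is finite dimensional, $k=1$, and $E:=E_1$ is barrelled, then $f^\wedge\colon U\times E\to F$, $(x,y)\mapsto f(x)(y)$ is $C^r_{\mathbb K}$ for each $C^r_{\mathbb K}$-map $f\colon U\to L_{\mathbb L}(E,F)_c$. (d) If all of the spaces $E_1,\ldots,E_k$ are normable, then $f^\wedge\colon U\times E_1\times\cdots\times E_k\to F$ is $C^r_{\mathbb K}$ for each $C^r_{\mathbb K}$-map $f\colon U\to L^k_{\mathbb L}(E_1,\ldots,E_k,F)_b$.
   Context: All locally convex spaces are Hausdorff. $\mathbb N=\{1,2,\ldots\}$, $\mathbb N_0=\mathbb N\cup\{0\}$. Complex locally convex spaces are regarded as real ones when $\mathbb K=\mathbb R$. A topological space $Y$ is a $k_{\mathbb R}$-space if it is Hausdorff and every function $g\colon Y\to\mathbb R$ whose restriction to each compact subset of $Y$ is continuous is continuous. Differential calculus (Keller's $C^r_c$-theory): Let $E,F$ be locally convex $\mathbb K$-vector spaces, $U\subseteq E$ open. For $r\in\mathbb N_0\cup\{\infty\}$, a map $f\colon U\to F$ is $C^r_{\mathbb K}$ if it is continuous and, for all $j\in\mathbb N$ with $j\le r$, the iterated directional derivatives $d^jf(x,y_1,\ldots,y_j):=(D_{y_j}\cdots D_{y_1}f)(x)$ exist for all $(x,y_1,\ldots,y_j)\in U\times E^j$ and $d^jf\colon U\times E^j\to F$ is continuous; here $(D_yf)(x)=\lim_{t\to0}\frac{f(x+ty)-f(x)}{t}$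 with $t\in\mathbb K\setminus\{0\}$. A map $f$ is $C^\omega_{\mathbb C}$ (complex analytic) if it is continuous and for each $x\in U$ there is a $0$-neighbourhood $Y\subseteq E$ with $x+Y\subseteq U$ and $f(x+y)=\sum_{n=0}^\infty\beta_n(y)$ pointwise for $y\in Y$, with continuous complex homogeneous polynomials $\beta_n\colon E\to F$ of degree $n$ (equivalent to $C^\infty_{\mathbb C}$). A map $f$ is $C^\omega_{\mathbb R}$ if it extends to a complex analytic map to $F_{\mathbb C}$ on an open neighbourhood of $U$ in the complexification $E_{\mathbb C}$. $L^k_{\mathbb L}(E_1,\ldots,E_k,F)$ is the space of continuous $k$-linear (over $\mathbb L$) maps $E_1\times\cdots\times E_k\to F$, $L^k_{\mathbb L}(E,F):=L^k_{\mathbb L}(E,\ldots,E,F)$, $L_{\mathbb L}(E,F):=L^1_{\mathbb L}(E,F)$; the subscript $c$ (resp. $b$) denotes the topology of uniform convergence on compact (resp. bounded) subsets of the domain. A locally convex space is barrelled if every closed, absolutely convex, absorbing subset is a $0$-neighbourhood. *)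

(* Defs.v *)
From HB Require Import structures.
From mathcomp Require Import all_boot all_order all_algebra perm finmap.
From mathcomp Require Import interval_inference complex.
From mathcomp Require Import all_classical all_reals.
From mathcomp Require Import topology normedtype sequences convex.

Set Implicit Arguments.
Unset Strict Implicit.
Unset Printing Implicit Defensive.

Import Order.TTheory GRing.Theory Num.Theory.
Import numFieldNormedType.Exports.

Local Open Scope classical_set_scope.
Local Open Scope ring_scope.

Section tvs_helpers.
Context {K : numFieldType}.

Lemma convex_setE (E : lmodType K) (A : set (convex_lmodType E)) :
  convex_set A <-> forall (x y : E) (p : {i01 K}), A x -> A y ->
    A (p%:num *: x + (1 - p%:num) *: y).
Proof.
split=> [cA x y p Ax Ay|cA x y p /set_mem Ax /set_mem Ay].
  by apply/set_mem; apply: cA; exact/mem_set.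
by apply/mem_set; exact: cA.
Qed.

Lemma convex_basis (E : preTopologicalLmodType K) :
  (forall (x : E) (A : set E), nbhs x A -> exists B : set E,
     [/\ open B, convex_set (B : set (convex_lmodType E)), B x & B `<=` A]) ->
  exists2 B : set_system E,
    (forall b, b \in B -> convex_set (b : set (convex_lmodType E))) & basis B.
Proof.
move=> h.
exists [set B : set E | open B /\ convex_set (B : set (convex_lmodType E))].
  by move=> b /set_mem [].
split=> [b []//|x A /h[B [oB cB Bx BA]]].
by exists B.
Qed.

Lemma tvs_convex_nbhs (E : tvsType K) (x : E) (A : set E) : nbhs x A ->
  exists B : set E,
     [/\ open B, convex_set (B : set (convex_lmodType E)), B x & B `<=` A].
Proof.
have [B cB [oB hB]] := @locally_convex K E.
move=> /hB [C /= [BC Cx] CA]; exists C; split=> //; first exact: oB.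
exact/cB/mem_set.
Qed.

Section continuous_tvs.
Context {T : topologicalType}.

Lemma tvs_continuousD (E : tvsType K) (f g : T -> E) :
  continuous f -> continuous g -> continuous (fun t => f t + g t).
Proof.
move=> cf cg x.
exact: (cvg_comp2 (cf x) (cg x) (@add_continuous E (f x, g x))).
Qed.

Lemma tvs_continuousZ (E : tvsType K) (f : T -> K^o) (g : T -> E) :
  continuous f -> continuous g -> continuous (fun t => f t *: g t).
Proof.
move=> cf cg x.
exact: (cvg_comp2 (cf x) (cg x) (@scale_continuous K E (f x, g x))).
Qed.

End continuous_tvs.

End tvs_helpers.

Section lcprod.
Context {K : numFieldType} {I : choiceType}.

Definition lcprod (E : I -> tvsType K) : Type := prod_topology E.

Variable E : I -> tvsType K.
Local Notation P := (lcprod E).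

HB.instance Definition _ := Topological.copy P (prod_topology E).

Lemma lcprod_ext (f g : P) : (forall i, f i = g i) -> f = g.
Proof. exact: functional_extensionality_dep. Qed.

Let add (f g : P) : P := fun i => f i + g i.
Let opp (f : P) : P := fun i => - f i.
Let zero : P := fun i => 0.
Let scale (a : K) (f : P) : P := fun i => a *: f i.

Let addA : associative add.
Proof. by move=> f g h; apply: lcprod_ext => i; exact: addrA. Qed.
Let addC : commutative add.
Proof. by move=> f g; apply: lcprod_ext => i; exact: addrC. Qed.
Let add0 : left_id zero add.
Proof. by move=> f; apply: lcprod_ext => i; exact: add0r. Qed.
Let addN : left_inverse zero opp add.
Proof. by move=> f; apply: lcprod_ext => i; exact: addNr. Qed.

HB.instance Definition _ := GRing.isZmodule.Build P addA addC add0 addN.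

Let scaleA a b f : scale a (scale b f) = scale (a * b) f.
Proof. by apply: lcprod_ext => i; exact: scalerA. Qed.
Let scale1 : left_id 1 scale.
Proof. by move=> f; apply: lcprod_ext => i; exact: scale1r. Qed.
Let scaleDr : right_distributive scale +%R.
Proof. by move=> a f g; apply: lcprod_ext => i; exact: scalerDr. Qed.
Let scaleDl f : {morph scale^~ f : a b / a + b}.
Proof. by move=> a b; apply: lcprod_ext => i; exact: scalerDl. Qed.

HB.instance Definition _ :=
  GRing.Zmodule_isLmodule.Build K P scaleA scale1 scaleDr scaleDl.

Lemma lcprod_proj_continuous i : continuous (fun f : P => f i).
Proof. exact: (@proj_continuous I (fun i => E i : topologicalType)). Qed.

Lemma lcprod_cvg (F : set_system P) (f : P) : Filter F ->
  (forall i, (fun g : P => g i) @ F --> f i) -> F --> f.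
Proof.
move=> FF h.
apply/cvg_sup => i A.
rewrite /nbhs/= => -[B [[C oC <-] Cf] BA].
apply: filterS BA _; apply: (h i); exact: open_nbhs_nbhs.
Qed.

Lemma lcprod_continuous (T : topologicalType) (h : T -> P) :
  (forall i, continuous (fun t => h t i)) -> continuous h.
Proof. by move=> ch t; apply: lcprod_cvg => i; exact: (ch i t). Qed.

Let add_cont : continuous (fun x : P * P => x.1 + x.2).
Proof.
apply: lcprod_continuous => i.
apply: (@tvs_continuousD _ _ (E i) (fun x : P * P => x.1 i) (fun x => x.2 i)).
  move=> x; apply: (@continuous_comp _ _ _ fst (fun f : P => f i)).
    exact: cvg_fst.
  exact: lcprod_proj_continuous.
move=> x; apply: (@continuous_comp _ _ _ snd (fun f : P => f i)).
  exact: cvg_snd.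
exact: lcprod_proj_continuous.
Qed.

Let scale_cont : continuous (fun z : K^o * P => z.1 *: z.2).
Proof.
apply: lcprod_continuous => i.
apply: (@tvs_continuousZ _ _ (E i) (fun x : K^o * P => x.1) (fun x => x.2 i)).
  by move=> x; exact: cvg_fst.
move=> x; apply: (@continuous_comp _ _ _ snd (fun f : P => f i)).
  exact: cvg_snd.
exact: lcprod_proj_continuous.
Qed.

Let lc : exists2 B : set_system P,
  (forall b, b \in B -> convex_set (b : set (convex_lmodType P))) & basis B.
Proof.
apply: convex_basis => f A fA.
pose D := [set U : set P |
  [/\ open U, convex_set (U : set (convex_lmodType P)) & U f]].
suff : filter_from D id A.
  by case=> B [? ? ?] BA; exists B.
have FD : Filter (filter_from D id).
  apply: filter_from_filter.
    by exists setT; split=> //; exact: openT.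
  move=> U V [oU cU Uf] [oV cV Vf]; exists (U `&` V) => //; split=> //.
    exact: openI.
  move/convex_setE in cU; move/convex_setE in cV.
  by apply/convex_setE => x y p [Ux Vx] [Uy Vy]; split; [exact: cU|exact: cV].
suff : filter_from D id --> f by apply.
apply: lcprod_cvg => i B /tvs_convex_nbhs[C [oC cC Cf CB]].
exists ((fun g : P => g i) @^-1` C); last by move=> g /CB.
split=> //.
  by apply: open_comp => // g _; exact: lcprod_proj_continuous.
apply/convex_setE => x y p /= Cx Cy.
by move/convex_setE : cC; apply.
Qed.

(* despite its name, this factory only builds the uniform structure *)
HB.instance Definition _ := PreTopologicalLmod_isTvs.Build K P
  add_cont scale_cont lc.
HB.instance Definition _ :=
  PreTopologicalNmodule_isTopologicalNmodule.Build P add_cont.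
HB.instance Definition _ :=
  TopologicalNmodule_isTopologicalLmodule.Build K P scale_cont.
HB.instance Definition _ := Uniform_isTvs.Build K P lc.

End lcprod.

Variant ground := Reals | Complexes.

Definition fld (R : realType) (K : ground) : numFieldType :=
  match K with Reals => R | Complexes => R[i] end.

(* [subground K L] : the field K is one of the real numbers or L *)
Variant subground : ground -> ground -> Type :=
| SubReals L : subground Reals L
| SubSelf L : subground L L.

Definition emb (R : realType) (K L : ground) (s : subground K L) :
    fld R K -> fld R L :=
  match s in subground K L return fld R K -> fld R L with
  | SubReals Reals => id
  | SubReals Complexes => fun x : R => x%:C%C
  | SubSelf _ => id
  end.

Section emb_theory.
Context {R : realType} {K L : ground} (s : subground K L).

Lemma emb_norm (x : fld R K) : `|emb s x| = emb s `|x|.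
Proof.
case: s x => // -[]//= x.
by rewrite normc_def/= expr0n/= addr0 sqrtr_sqr.
Qed.

Lemma emb1 : emb s (1 : fld R K) = 1. Proof. by case: s => // -[]. Qed.

Lemma embD : {morph @emb R K L s : x y / x + y}.
Proof. by case: s => // -[]//= x y; exact: (rmorphD (real_complex R)). Qed.

Lemma embN : {morph @emb R K L s : x / - x}.
Proof. by case: s => // -[]//= x; exact: (rmorphN (real_complex R)). Qed.

Lemma embM : {morph @emb R K L s : x y / x * y}.
Proof. by case: s => // -[]//= x y; exact: (rmorphM (real_complex R)). Qed.

Lemma emb_lt : {mono @emb R K L s : x y / x < y}.
Proof. by case: s => // -[]//= x y; rewrite ltcR. Qed.

Lemma emb_le : {mono @emb R K L s : x y / x <= y}.
Proof. by case: s => // -[]//= x y; rewrite lecR. Qed.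

Lemma emb_small (e : fld R L) : 0 < e ->
  exists2 d : fld R K, 0 < d & emb s d = e.
Proof.
case: s e => [[]|[]]/= e e0; try by exists e.
case: e e0 => a b; rewrite ltcE/= => /andP[/eqP -> a0].
by exists a.
Qed.

Lemma emb_continuous : continuous (@emb R K L s : (fld R K)^o -> (fld R L)^o).
Proof.
move=> x A /(@nbhs_ballP _ (fld R L)^o)[e /= e0 eA].
have [d d0 de] := emb_small e0.
apply/(@nbhs_ballP _ (fld R K)^o); exists d => //= y.
rewrite -ball_normE/= => xy; apply: eA; rewrite -ball_normE/= -de.
by rewrite -embN -embD emb_norm emb_lt.
Qed.

End emb_theory.

(* the locally convex L-space E, regarded as a K-space *)
Definition restr (R : realType) (K L : ground) (s : subground K L)
  (E : tvsType (fld R L)) : Type := E.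

Section restr.
Context {R : realType} {K L : ground} (s : subground K L).

Variable E : tvsType (fld R L).
Local Notation P := (restr s E).

HB.instance Definition _ := Topological.copy P E.
HB.instance Definition _ := GRing.Zmodule.copy P E.

Let scale (a : fld R K) (x : P) : P := emb s a *: (x : E).

Let scaleA a b f : scale a (scale b f) = scale (a * b) f.
Proof. by rewrite /scale embM scalerA. Qed.
Let scale1 : left_id 1 scale.
Proof. by move=> f; rewrite /scale emb1 scale1r. Qed.
Let scaleDr : right_distributive scale +%R.
Proof. by move=> a f g; exact: scalerDr. Qed.
Let scaleDl f : {morph scale^~ f : a b / a + b}.
Proof. by move=> a b; rewrite /scale embD scalerDl. Qed.

HB.instance Definition _ :=
  GRing.Zmodule_isLmodule.Build (fld R K) P scaleA scale1 scaleDr scaleDl.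

Let add_cont : continuous (fun x : P * P => x.1 + x.2).
Proof. exact: (@add_continuous E). Qed.

Let scale_cont : continuous (fun z : (fld R K)^o * P => z.1 *: z.2).
Proof.
apply: (@tvs_continuousZ _ _ E (fun z : (fld R K)^o * P => emb s z.1) snd).
  move=> x; apply: (@continuous_comp _ _ _ fst (@emb R K L s : (fld R K)^o -> (fld R L)^o)).
    exact: cvg_fst.
  exact: emb_continuous.
by move=> x; exact: cvg_snd.
Qed.

Let lc : exists2 B : set_system P,
  (forall b, b \in B -> convex_set (b : set (convex_lmodType P))) & basis B.
Proof.
apply: convex_basis => x A xA.
have [B [oB /convex_setE cB Bx BA]] := @tvs_convex_nbhs _ E x A xA.
exists B; split=> //; apply/convex_setE => y z p By Bz.
have p0 : 0 <= emb s p%:num.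
  by have := emb_le s 0 p%:num; rewrite ge0 -{1}[0]subr0 embD embN subrr.
have p1 : emb s p%:num <= 1.
  by have := emb_le s p%:num 1; rewrite emb1 le1.
have := cB y z (Itv01 p0 p1) By Bz.
rewrite /=. congr B; congr (_ + _).
by rewrite -[RHS]/(emb s (1 - p%:num) *: (z : E)) embD embN emb1.
Qed.

(* despite its name, this factory only builds the uniform structure *)
HB.instance Definition _ := PreTopologicalLmod_isTvs.Build (fld R K) P
  add_cont scale_cont lc.
HB.instance Definition _ :=
  PreTopologicalNmodule_isTopologicalNmodule.Build P add_cont.
HB.instance Definition _ :=
  TopologicalNmodule_isTopologicalLmodule.Build (fld R K) P scale_cont.
HB.instance Definition _ := Uniform_isTvs.Build (fld R K) P lc.

End restr.

Section bounded.
Context {K : numFieldType} (E : tvsType K).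

Definition absorbs (V B : set E) : Prop :=
  exists2 r : K, 0 < r & forall a : K, r <= `|a| -> B `<=` [set a *: v | v in V].

Definition tvs_bounded (B : set E) : Prop :=
  forall V : set E, nbhs (0 : E) V -> absorbs V B.

Lemma tvs_boundedU (A B : set E) :
  tvs_bounded A -> tvs_bounded B -> tvs_bounded (A `|` B).
Proof.
move=> bA bB V V0; have [r r0 Ar] := bA V V0; have [t t0 Bt] := bB V V0.
exists (r + t) => [|a rta x [Ax|Bx]]; first exact: addr_gt0.
  by apply: (Ar a) => //; apply: le_trans rta; rewrite lerDl ltW.
by apply: (Bt a) => //; apply: le_trans rta; rewrite lerDr ltW.
Qed.

Lemma tvs_bounded0 : tvs_bounded set0.
Proof. by move=> V _; exists 1 => // a _ x []. Qed.

Lemma small_absorbs (V B : set E) :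
  (\forall a \near (0 : K^o), forall x, B x -> V (a *: x)) -> absorbs V B.
Proof.
move=> /(@nbhs_ballP _ K^o)[e /= e0 eV].
exists (2 / e) => [|a ea x Bx]; first by rewrite divr_gt0.
have a0 : a != 0 by rewrite -normr_gt0 (lt_le_trans _ ea)// divr_gt0.
exists (a^-1 *: x); last by rewrite scalerA divff// scale1r.
apply: eV Bx; rewrite -ball_normE/= sub0r normrN normfV.
rewrite invf_plt ?posrE ?normr_gt0//; apply: lt_le_trans ea.
by rewrite -[ltLHS]mul1r ltr_pM2r ?invr_gt0// ltr1n.
Qed.

Lemma compact_tvs_bounded (B : set E) : compact B -> tvs_bounded B.
Proof.
move=> /compact_near_coveringP cB V V0; apply: small_absorbs.
apply: (cB K^o (nbhs (0 : K^o)) (fun a x => V (a *: x))) => x Bx.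
have := @scale_continuous K E (0, x) V; rewrite /= scale0r => /(_ V0).
move=> [[/= P Q] [P0 Qx] PQ]; exists (Q, P) => //= -[y a]/= [Qy Pa].
exact: (PQ (a, y)).
Qed.

Lemma tvs_nbhs0_half (V : set E) : nbhs (0 : E) V ->
  exists2 W, nbhs (0 : E) W & forall u v, W u -> W v -> V (u + v).
Proof.
move=> V0; have := @add_continuous E (0, 0) V; rewrite /= addr0 => /(_ V0).
move=> [[/= P Q] [P0 Q0] PQ]; exists (P `&` Q); first exact: filterI.
by move=> u v [Pu _] [_ Qv]; exact: (PQ (u, v)).
Qed.

End bounded.

Lemma conv_shift (K : pzRingType) (V : lmodType K) (a : K) (u v w f : V) :
  a *: (u + (w - (a *: u + (1 - a) *: v)) - f) +
  (1 - a) *: (v + (w - (a *: u + (1 - a) *: v)) - f) = w - f.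
Proof.
set t := w - _; rewrite -!addrA (scalerDr a) (scalerDr (1 - a)) addrACA.
rewrite -scalerDl [a + _]addrC subrK scale1r /t.
by move: (a *: u + _) => x; rewrite addrCA addNKr.
Qed.

Section multilinear.
Context {K : numFieldType} {k : nat} (E : 'I_k -> tvsType K) (F : tvsType K).

Definition multilinear (b : lcprod E -> F) : Prop :=
  forall (i : 'I_k) (x : lcprod E), linear (fun u : E i => b (dfwith x i u)).

Lemma multilinear_scale (b : lcprod E -> F) (c : K) (y : lcprod E) :
  multilinear b -> b (c *: y) = c ^+ k *: b y.
Proof.
move=> lb; pose ys (s : seq 'I_k) : lcprod E :=
  fun i => if i \in s then c *: y i else y i.
have step i (x : lcprod E) u : b (dfwith x i (c *: u)) = c *: b (dfwith x i u).
  have b0 : b (dfwith x i 0) = 0.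
    by have := lb i x (-1) 0 0; rewrite scaler0 addr0 scaleN1r addNr.
  by have := lb i x c u 0; rewrite !addr0 b0 addr0.
have ysE s : uniq s -> b (ys s) = c ^+ size s *: b y.
  elim: s => [|i s IH] /=; first by rewrite expr0 scale1r.
  move=> /andP[is_ us]; rewrite exprS -scalerA -IH//.
  have -> : ys s = dfwith (ys s) i (ys s i).
    by apply: lcprod_ext => j; case: dfwithP.
  rewrite -step; congr b; apply: lcprod_ext => j.
  case: dfwithP => [|j' ij]; first by rewrite /ys mem_head (negbTE is_).
  by rewrite /ys inE eq_sym (negbTE ij).
have := ysE (enum 'I_k) (enum_uniq _); rewrite size_enum_ord => <-.
by congr b; apply: lcprod_ext => i; rewrite /ys mem_enum.
Qed.

Lemma multilinear_bounded (b : lcprod E -> F) (B : set (lcprod E)) :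
  multilinear b -> continuous b -> tvs_bounded B ->
  forall V, nbhs (0 : F) V ->
  \forall a \near (0 : K^o), forall y, B y -> V (a *: b y).
Proof.
move=> lb cb bB V V0.
have [k0|k0] := posnP k.
  have := @scale_continuous K F (0, b 0) V; rewrite /= scale0r => /(_ V0).
  move=> [[/= P Q] [P0 Qb] PQ]; apply: filterS P0 => a Pa y _.
  have -> : y = 0 by apply: lcprod_ext => -[i ik]; exfalso; rewrite k0 in ik.
  by apply: (PQ (a, b 0)); split => //; exact: nbhs_singleton.
have b0 : b 0 = 0.
  by rewrite -[X in b X](scale0r 0) multilinear_scale// expr0n gtn_eqF// scale0r.
have := @scale_continuous K F (0, 0) V; rewrite /= scale0r => /(_ V0).
move=> [[/= P Q] [P0 Q0] PQ].
have N0 : nbhs (0 : lcprod E) (b @^-1` Q) by apply: cb; rewrite b0.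
have [r r0 Br] := bB _ N0.
have cP : continuous (fun a : K^o => a * r ^+ k : K^o).
  apply: (@tvs_continuousZ _ _ K^o id (fun=> r ^+ k)) => a.
    exact: cvg_id.
  exact: cst_continuous.
have : nbhs (0 : K^o) ((fun a : K^o => a * r ^+ k) @^-1` P).
  by apply: cP; rewrite mul0r.
apply: filterS => a Pa y /(Br r)[]; first by rewrite gtr0_norm.
move=> x Qx <-; rewrite multilinear_scale// scalerA.
exact: (PQ (a * r ^+ k, b x)).
Qed.

End multilinear.

Variant unif_kind := OnCompacts | OnBounded.

Section mlin.
Context {K : numFieldType} {k : nat}.

Record mlin (S : unif_kind) (E : 'I_k -> tvsType K) (F : tvsType K) : Type :=
  Mlin { mlin_fun :> lcprod E -> F;
         mlin_multilinear : multilinear mlin_fun;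
         mlin_continuous : continuous mlin_fun }.

Variables (S : unif_kind) (E : 'I_k -> tvsType K) (F : tvsType K).
Local Notation M := (mlin S E F).

HB.instance Definition _ := gen_eqMixin M.
HB.instance Definition _ := gen_choiceMixin M.

Lemma mlin_ext (f g : M) : (forall y, f y = g y) -> f = g.
Proof.
case: f g => [f lf cf] [g lg cg] /= /funext fg; rewrite fg in lf cf *.
by congr Mlin; exact: Prop_irrelevance.
Qed.

Let zero_lin : multilinear (fun _ : lcprod E => 0 : F).
Proof. by move=> i x a u v; rewrite scaler0 addr0. Qed.
Let zero_cont : continuous (fun _ : lcprod E => 0 : F).
Proof. by exact: cst_continuous. Qed.
Let zero : M := Mlin S zero_lin zero_cont.

Let opp_lin (f : M) : multilinear (fun y => - f y).
Proof.
by move=> i x a u v /=; rewrite mlin_multilinear opprD scalerN.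
Qed.
Let opp_cont (f : M) : continuous (fun y => - f y).
Proof.
move=> x; apply: (@continuous_comp _ _ _ f -%R).
  exact: mlin_continuous.
exact: opp_continuous.
Qed.
Let opp (f : M) : M := Mlin S (opp_lin f) (@opp_cont f).

Let add_lin (f g : M) : multilinear (fun y => f y + g y).
Proof.
by move=> i x a u v /=; rewrite !mlin_multilinear scalerDr addrACA.
Qed.
Let add_cont0 (f g : M) : continuous (fun y => f y + g y).
Proof. by apply: tvs_continuousD; exact: mlin_continuous. Qed.
Let add (f g : M) : M := Mlin S (add_lin f g) (@add_cont0 f g).

Let scale_lin (c : K) (f : M) : multilinear (fun y => c *: f y).
Proof.
move=> i x a u v /=.
by rewrite mlin_multilinear scalerDr !scalerA [c * a]mulrC.
Qed.
Let scale_cont0 (c : K) (f : M) : continuous (fun y => c *: f y).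
Proof.
apply: (@tvs_continuousZ _ _ F (fun _ => c : K^o) f).
  by exact: cst_continuous.
exact: mlin_continuous.
Qed.
Let scale (c : K) (f : M) : M := Mlin S (scale_lin c f) (@scale_cont0 c f).

Let addA : associative add.
Proof. by move=> f g h; apply: mlin_ext => y; exact: addrA. Qed.
Let addC : commutative add.
Proof. by move=> f g; apply: mlin_ext => y; exact: addrC. Qed.
Let add0 : left_id zero add.
Proof. by move=> f; apply: mlin_ext => y; exact: add0r. Qed.
Let addN : left_inverse zero opp add.
Proof. by move=> f; apply: mlin_ext => y; exact: addNr. Qed.

HB.instance Definition _ := GRing.isZmodule.Build M addA addC add0 addN.

Let scaleA a b f : scale a (scale b f) = scale (a * b) f.
Proof. by apply: mlin_ext => y; exact: scalerA. Qed.
Let scale1 : left_id 1 scale.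
Proof. by move=> f; apply: mlin_ext => y; exact: scale1r. Qed.
Let scaleDr : right_distributive scale +%R.
Proof. by move=> a f g; apply: mlin_ext => y; exact: scalerDr. Qed.
Let scaleDl f : {morph scale^~ f : a b / a + b}.
Proof. by move=> a b; apply: mlin_ext => y; exact: scalerDl. Qed.

HB.instance Definition _ :=
  GRing.Zmodule_isLmodule.Build K M scaleA scale1 scaleDr scaleDl.

(* the topology of uniform convergence on the sets in [unif_sets]: the
   neighbourhoods of f contain all g such that g - f maps B into V, for some
   0-neighbourhood V of F; the uniformity of the library on F is not used, as
   it is not required to be the one given by the vector space structure *)
Definition unif_sets : set_system (lcprod E) :=
  match S with OnCompacts => compact | OnBounded => @tvs_bounded K (lcprod E) end.

Definition mlin_nbhs (f : M) : set_system M := [set A |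
  exists B V, [/\ unif_sets B, nbhs (0 : F) V &
    [set g : M | forall y, B y -> V (g y - f y)] `<=` A]].

Lemma unif_setsU (A B : set (lcprod E)) :
  unif_sets A -> unif_sets B -> unif_sets (A `|` B).
Proof. by rewrite /unif_sets; case: S; [exact: compactU|exact: tvs_boundedU]. Qed.

Lemma unif_sets0 : unif_sets set0.
Proof. by rewrite /unif_sets; case: S; [exact: compact0|exact: tvs_bounded0]. Qed.

Lemma unif_sets_bounded (A : set (lcprod E)) : unif_sets A -> tvs_bounded A.
Proof. by rewrite /unif_sets; case: S => //; exact: compact_tvs_bounded. Qed.

Let nbhs_pf (f : M) : ProperFilter (mlin_nbhs f).
Proof.
split.
  move=> [B [V [_ V0]]] /(_ f); apply => y _.
  by rewrite subrr; exact: nbhs_singleton.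
split.
- by exists set0, setT; split=> //; [exact: unif_sets0|exact: filterT].
- move=> P Q [B [V [SB V0 BV]]] [C [W [SC W0 CW]]].
  exists (B `|` C), (V `&` W); split.
  + exact: unif_setsU.
  + exact: filterI.
  + move=> g h; split.
      by apply: BV => y By; have [] := h y (or_introl By).
    by apply: CW => y Cy; have [] := h y (or_intror Cy).
- move=> P Q PQ [B [V [SB V0 BV]]]; exists B, V; split=> //.
  exact: subset_trans PQ.
Qed.

Let nbhs_sing (f : M) (A : set M) : mlin_nbhs f A -> A f.
Proof.
move=> [B [V [_ V0]]]; apply => y _.
by rewrite subrr; exact: nbhs_singleton.
Qed.

Let nbhs_nb (f : M) (A : set M) :
  mlin_nbhs f A -> mlin_nbhs f (mlin_nbhs^~ A).
Proof.
move=> [B [V [SB V0 BV]]]; have [W W0 WV] := tvs_nbhs0_half V0.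
exists B, W; split=> // g gW; exists B, W; split=> // h hW.
apply: BV => y By; rewrite -(subrK (g y) (h y)) -addrA.
by apply: WV; [exact: hW|exact: gW].
Qed.

HB.instance Definition _ := hasNbhs.Build M mlin_nbhs.
HB.instance Definition _ := Nbhs_isNbhsTopological.Build M nbhs_pf nbhs_sing nbhs_nb.

Lemma nbhs_mlin (f : M) B V : unif_sets B -> nbhs (0 : F) V ->
  nbhs f [set g : M | forall y, B y -> V (g y - f y)].
Proof. by move=> SB V0; exists B, V; split. Qed.

Let add_cont : continuous (fun x : M * M => x.1 + x.2).
Proof.
move=> -[f g] A [B [V [SB V0 BV]]]; have [W W0 WV] := tvs_nbhs0_half V0.
pose N (f : M) := [set h : M | forall y, B y -> W (h y - f y)].
exists (N f, N g) => /=; first by split; exact: nbhs_mlin.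
move=> [f' g'] /= [Nf Ng]; apply: BV => y By.
rewrite -[(f' + g') y]/(f' y + g' y) -[(f + g) y]/(f y + g y).
by rewrite opprD addrACA; apply: WV; [exact: Nf|exact: Ng].
Qed.

Let scale_cont : continuous (fun z : K^o * M => z.1 *: z.2).
Proof.
move=> -[a f] A [B [V [SB V0 BV]]]; have [W W0 WV] := tvs_nbhs0_half V0.
have aW := @scale_continuous K F (a, 0) W; rewrite /= scaler0 in aW.
have [[/= P Q] [Pa Q0] PQ] := aW W0.
have fB := multilinear_bounded (@mlin_multilinear _ _ _ f)
  (@mlin_continuous _ _ _ f) (unif_sets_bounded SB) W0.
pose N := [set h : M | forall y, B y -> Q (h y - f y)].
exists (P `&` [set c | forall y, B y -> W ((c - a) *: f y)], N) => /=.
  split; last exact: nbhs_mlin.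
  apply: filterI => //.
  have : (fun c : K^o => c - a) @ nbhs a --> (0 : K^o).
    rewrite -(subrr a); apply: (@tvs_continuousD _ _ K^o id (fun=> - a)) => c.
      exact: cvg_id.
    exact: cst_continuous.
  by move=> /(_ _ fB).
move=> [c h] /= [[Pc cW] Nh]; apply: BV => y By.
rewrite -[(c *: h) y]/(c *: h y) -[(a *: f) y]/(a *: f y).
rewrite -(subrK (c *: f y) (c *: h y)) -addrA -scalerBr -scalerBl.
apply: WV; last exact: cW.
by apply: (PQ (c, h y - f y)); split => //; exact: Nh.
Qed.

Let lc : exists2 B : set_system M,
  (forall b, b \in B -> convex_set (b : set (convex_lmodType M))) & basis B.
Proof.
apply: convex_basis => f A [B [V [SB /tvs_convex_nbhs[C [oC cC C0 CV]] BV]]].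
move/convex_setE in cC.
pose D := [set g : M | forall y, B y -> C (g y - f y)].
exists D^°; split.
- exact: open_interior.
- apply/convex_setE => g h p [B1 [V1 [SB1 V10 BV1]]] [B2 [V2 [SB2 V20 BV2]]].
  exists (B1 `|` B2), (V1 `&` V2); split; [exact: unif_setsU|exact: filterI|].
  move=> l lq y By; set q := p%:num *: g + (1 - p%:num) *: h in lq.
  have qE : q y = p%:num *: g y + (1 - p%:num) *: h y by [].
  pose d : M := l - q.
  have dE z : d z = l z - q z by [].
  have gd : C ((g + d) y - f y).
    apply: BV1 => // z Bz; rewrite -[(g + d) z]/(g z + d z) addrAC subrr add0r.
    by have [] := lq z (or_introl Bz).
  have hd : C ((h + d) y - f y).
    apply: BV2 => // z Bz; rewrite -[(h + d) z]/(h z + d z) addrAC subrr add0r.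
    by have [] := lq z (or_intror Bz).
  have := cC _ _ p gd hd.
  by rewrite -[(g + d) y]/(g y + d y) -[(h + d) y]/(h y + d y) dE qE conv_shift.
- by apply: nbhs_mlin => //; exact: open_nbhs_nbhs.
- move=> g /interior_subset Dg; apply: BV => y By.
  by apply: CV; exact: Dg.
Qed.

(* despite its name, this factory only builds the uniform structure *)
HB.instance Definition _ := PreTopologicalLmod_isTvs.Build K M
  add_cont scale_cont lc.
HB.instance Definition _ :=
  PreTopologicalNmodule_isTopologicalNmodule.Build M add_cont.
HB.instance Definition _ :=
  TopologicalNmodule_isTopologicalLmodule.Build K M scale_cont.
HB.instance Definition _ := Uniform_isTvs.Build K M lc.

End mlin.

Section complexification.
Context {R : realType}.
Local Notation RR := (fld R Reals).
Local Notation re := (@complex.Re R).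
Local Notation im := (@complex.Im R).
Local Notation CC := (fld R Complexes).

Lemma continuous_ReIm :
  continuous (@complex.Re R : CC^o -> RR^o) /\ continuous (@complex.Im R : CC^o -> RR^o).
Proof.
have h (f : CC -> RR) : (forall x y : CC, f (x - y) = f x - f y) ->
    (forall x : CC, (`|f x|%:C%C : CC) <= `|x|) ->
    continuous (f : CC^o -> RR^o).
  move=> fB fn x A /(@nbhs_ballP _ RR^o)[e /= e0 eA].
  apply/(@nbhs_ballP _ CC^o); exists (e%:C%C : CC) => /=.
    by rewrite ltcR.
  move=> y; rewrite -ball_normE/= => xy; apply: eA; rewrite -ball_normE/=.
  by rewrite -ltcR -fB; apply: le_lt_trans xy; exact: fn.
split; apply: h; try by move=> [? ?] [? ?].
  by move=> [a b]; rewrite normc_def lecR/= -sqrtr_sqr ler_wsqrtr// lerDl sqr_ge0.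
by move=> [a b]; rewrite normc_def lecR/= -sqrtr_sqr ler_wsqrtr// lerDr sqr_ge0.
Qed.

(* the pair (x, y) stands for x + i y *)
Definition cplx (E : tvsType RR) : Type := (E * E)%type.

Variable E : tvsType RR.
Local Notation P := (cplx E).

HB.instance Definition _ := Topological.copy P (E * E)%type.
HB.instance Definition _ := GRing.Zmodule.copy P (E * E)%type.

Let scale (c : CC) (z : P) : P :=
  (re c *: z.1 - im c *: z.2, re c *: z.2 + im c *: z.1).

Let scaleA a b f : scale a (scale b f) = scale (a * b) f.
Proof.
case: a b f => [a a'] [b b'] [x y]; apply: injective_projections => /=.
  rewrite scalerBr scalerDr !scalerA scalerBl scalerDl.
  rewrite opprD.
  by rewrite -!addrA; congr (_ + _); rewrite opprD addrA addrC.
rewrite scalerBr scalerDr !scalerA scalerBl scalerDl -!addrA; congr (_ + _).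
by rewrite addrA addrC.
Qed.
Let scale1 : left_id 1 scale.
Proof.
by move=> [x y]; rewrite /scale/= !scale1r !scale0r subr0 addr0.
Qed.
Let scaleDr : right_distributive scale +%R.
Proof.
move=> [a b] [x y] [x' y']; apply: injective_projections => /=.
  by rewrite !scalerDr opprD addrACA.
by rewrite !scalerDr addrACA.
Qed.
Let scaleDl f : {morph scale^~ f : a b / a + b}.
Proof.
move=> [a b] [a' b']; apply: injective_projections => /=.
  by rewrite !scalerDl opprD addrACA.
by rewrite !scalerDl addrACA.
Qed.

HB.instance Definition _ :=
  GRing.Zmodule_isLmodule.Build CC P scaleA scale1 scaleDr scaleDl.

Let add_cont : continuous (fun x : P * P => x.1 + x.2).
Proof. exact: (@add_continuous (E * E)%type). Qed.

Let scale_cont : continuous (fun z : CC^o * P => z.1 *: z.2).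
Proof.
have [cRe cIm] := continuous_ReIm.
have c1 (f : CC^o -> RR^o) : continuous f ->
    continuous (fun z : CC^o * P => f z.1).
  move=> cf z; apply: (@continuous_comp _ _ _ fst f); first exact: cvg_fst.
  exact: cf.
have c2 : continuous (fun z : CC^o * P => z.2.1).
  move=> z; apply: (@continuous_comp _ _ _ snd (fst : E * E -> E)).
    exact: cvg_snd.
  exact: cvg_fst.
have c3 : continuous (fun z : CC^o * P => z.2.2).
  move=> z; apply: (@continuous_comp _ _ _ snd (snd : E * E -> E)).
    exact: cvg_snd.
  exact: cvg_snd.
have cN : continuous (fun x : CC^o => - im x : RR^o).
  move=> x; apply: (@continuous_comp _ _ _ (im : CC^o -> RR^o) -%R).
    exact: cIm.
  exact: opp_continuous.
have c4 : continuous (fun z : CC^o * P => re z.1 *: z.2.1 - im z.1 *: z.2.2).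
  rewrite [X in continuous X](_ : _ = (fun z : CC^o * P =>
      re z.1 *: z.2.1 + (- im z.1) *: z.2.2)); last first.
    by apply/funext => z; rewrite scaleNr.
  exact: (tvs_continuousD (tvs_continuousZ (c1 _ cRe) c2)
                          (tvs_continuousZ (c1 _ cN) c3)).
have c5 : continuous (fun z : CC^o * P => re z.1 *: z.2.2 + im z.1 *: z.2.1).
  exact: (tvs_continuousD (tvs_continuousZ (c1 _ cRe) c3)
                          (tvs_continuousZ (c1 _ cIm) c2)).
by move=> z; apply: cvg_pair; [exact: c4|exact: c5].
Qed.

Let lc : exists2 B : set_system P,
  (forall b, b \in B -> convex_set (b : set (convex_lmodType P))) & basis B.
Proof.
apply: convex_basis => x A xA.
have [B [oB /convex_setE cB Bx BA]] := @tvs_convex_nbhs _ (E * E)%type x A xA.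
exists B; split=> //; apply/convex_setE => y z p By Bz.
have : (0 : R[i]) <= p%:num  by exact: ge0.
rewrite lecE/= => /andP[/eqP p_im p_ge0].
have : (p%:num : R[i]) <= 1  by exact: le1.
rewrite lecE/= => /andP[_ p_le1].
have := cB y z (Itv01 p_ge0 p_le1) By Bz; congr B.
have reB : re (1 - p%:num) = 1 - re p%:num by case: (p%:num).
have imB : im (1 - p%:num) = 0 by rewrite -[RHS]oppr0 -p_im -sub0r; case: (p%:num).
case: y z {By Bz} => [y y'] [z z']; apply: injective_projections => /=.
  by rewrite reB imB p_im !scale0r !subr0.
by rewrite reB imB p_im !scale0r !addr0.
Qed.

(* despite its name, this factory only builds the uniform structure *)
HB.instance Definition _ := PreTopologicalLmod_isTvs.Build CC P
  add_cont scale_cont lc.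
HB.instance Definition _ :=
  PreTopologicalNmodule_isTopologicalNmodule.Build P add_cont.
HB.instance Definition _ :=
  TopologicalNmodule_isTopologicalLmodule.Build CC P scale_cont.
HB.instance Definition _ := Uniform_isTvs.Build CC P lc.

End complexification.

Section lcs_properties.
Context {K : numFieldType} (E : tvsType K).

Definition finite_dimensional : Prop :=
  exists (n : nat) (e : 'I_n -> E), forall x : E,
    exists c : 'I_n -> K, x = \sum_(i < n) c i *: e i.

(* the values of the norm p are in K, hence nonnegative real numbers by the
   first condition, also when K is the field of complex numbers *)
Definition normable : Prop :=
  exists p : E -> K,
    [/\ forall x, 0 <= p x,
        forall x, p x = 0 -> x = 0,
        forall x y, p (x + y) <= p x + p y,
        forall a x, p (a *: x) = `|a| * p x &
        forall (x : E) (A : set E), nbhs x A <->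
          exists2 r : K, 0 < r & [set y | p (y - x) < r] `<=` A].

Definition absolutely_convex (D : set E) : Prop :=
  forall (a b : K) (x y : E), `|a| + `|b| <= 1 -> D x -> D y ->
    D (a *: x + b *: y).

Definition absorbing (D : set E) : Prop := forall x : E, absorbs D [set x].

Definition barrelled : Prop := forall D : set E,
  closed D -> absolutely_convex D -> absorbing D -> nbhs (0 : E) D.

End lcs_properties.

Definition kR_space (R : realType) (Y : topologicalType) : Prop :=
  hausdorff_space Y /\
  forall g : Y -> R,
    (forall A : set Y, compact A -> {within A, continuous g}) -> continuous g.

Section directional_derivatives.
Context {K : numFieldType} {E F : tvsType K}.

Definition diff_quotient (f : E -> F) (x y : E) (t : K) : F :=
  t^-1 *: (f (x + t *: y) - f x).

Definition has_dir_derive (f : E -> F) (x y : E) : Prop :=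
  exists l : F, diff_quotient f x y t @[t --> 0^'] --> l.

(* the value is 0 where the limit does not exist; [C_upto] requires existence *)
Definition dir_derive (y : E) (f : E -> F) : E -> F :=
  fun x => xget 0 [set l : F | diff_quotient f x y t @[t --> 0^'] --> l].

Definition iter_dir_derive (f : E -> F) (ys : seq E) : E -> F :=
  foldl (fun g y => dir_derive y g) f ys.

(* d^j f : (x, y_1, ..., y_j) |-> (D_{y_j} ... D_{y_1} f)(x) *)
Definition dn (f : E -> F) (j : nat) (p : E * lcprod (fun _ : 'I_j => E)) : F :=
  iter_dir_derive f [seq p.2 i | i <- enum 'I_j] p.1.

(* [leq_r j] stands for j <= r; f is only relevant on U, which is meant to be
   open *)
Definition C_upto (leq_r : nat -> Prop) (U : set E) (f : E -> F) : Prop :=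
  {within U, continuous f} /\
  forall j, leq_r j.+1 ->
    (forall (x : E) (ys : seq E) (y : E), U x -> size ys = j ->
       has_dir_derive (iter_dir_derive f ys) x y) /\
    {within U `*` setT, continuous (@dn f j.+1)}.

Definition homogeneous_poly (n : nat) (p : E -> F) : Prop :=
  exists2 b : lcprod (fun _ : 'I_n => E) -> F,
    multilinear b & forall y, p y = b (fun _ => y).

End directional_derivatives.

Definition complex_analytic (R : realType) (E F : tvsType (fld R Complexes))
    (U : set E) (f : E -> F) : Prop :=
  {within U, continuous f} /\
  forall x, U x -> exists Y : set E,
    [/\ nbhs (0 : E) Y,
        forall y, Y y -> U (x + y) &
        exists beta : nat -> E -> F,
          (forall n, homogeneous_poly n (beta n) /\ continuous (beta n)) /\
          forall y, Y y -> series (fun n => beta n y) @ \oo --> f (x + y)].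

Definition real_analytic (R : realType) (E F : tvsType (fld R Reals))
    (U : set E) (f : E -> F) : Prop :=
  exists (W : set (cplx E)) (g : cplx E -> cplx F),
    [/\ open W, complex_analytic W g &
        forall x, U x -> W (x, 0) /\ g (x, 0) = (f x, 0)].

Variant smoothness := Cfinite of nat | Cinfty | Comega.

Definition Cr (R : realType) (K : ground) :
    forall (E F : tvsType (fld R K)), smoothness -> set E -> (E -> F) -> Prop :=
  match K with
  | Reals => fun E F r U f =>
      match r with
      | Cfinite n => C_upto (fun j => (j <= n)%N) U f
      | Cinfty => C_upto (fun=> True) U f
      | Comega => real_analytic U f
      end
  | Complexes => fun E F r U f =>
      match r with
      | Cfinite n => C_upto (fun j => (j <= n)%N) U f
      | Cinfty => C_upto (fun=> True) U f
      | Comega => complex_analytic U f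
      end
  end.

Definition symmetric_map (K : numFieldType) (k : nat) (E F : tvsType K)
    (b : lcprod (fun _ : 'I_k => E) -> F) : Prop :=
  forall (s : 'S_k) (y : lcprod (fun _ : 'I_k => E)), b (fun i => y (s i)) = b y.

(* Main.v *)
(* Write [f^] for [(x, y) |-> f x y].  Everything reduces to an exponential law
   [exp_law Z]: if [g] is a continuous map from an open subset of [Z] to the
   space of multilinear maps, then [(z, y) |-> g z y] is continuous.  The j-th
   derivative of [f^] is a finite sum of terms [(d^i f (x, u_1, .., u_i)) y'],
   where [y'] is [y] with some arguments replaced by directions.  By polarization
   the symmetric multilinear [d^i f (x, .)] is determined by
   [u |-> d^i f (x, u, .., u)], so the exponential law for [X * X] gives the
   continuity of all terms.  Over C and for r = oo the law for [X] suffices: the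
   continuity of a derivative follows from that of the function by a Cauchy
   estimate.  For r = omega one expands each homogeneous polynomial
   [v |-> beta_n v (y + w)] multilinearly, after complexification if the
   scalars are real.

   The exponential law holds on kR-spaces (a cutoff function localizes the
   problem), when the second factor has a basis of compact, resp. bounded,
   neighbourhoods, and on a locally compact [Z] if the second factor is barrelled
   (Banach--Steinhaus).  For (b), symmetric maps are written by polarization
   through the values [m (y, .., y)], so that only [X * E] is involved. *)

Require Import Defs.
From HB Require Import structures.
From mathcomp Require Import all_boot all_order all_algebra perm finmap.
From mathcomp Require Import interval_inference complex.
From mathcomp Require Import all_classical all_reals.
From mathcomp Require Import topology normedtype sequences convex.
From mathcomp Require Import ring lra.
Set Implicit Arguments.
Unset Strict Implicit.
Unset Printing Implicit Defensive.

Import Order.TTheory GRing.Theory Num.Theory.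
Import numFieldNormedType.Exports.

Local Open Scope classical_set_scope.
Local Open Scope ring_scope.

(** * Limits in topological vector spaces *)

(** What shapes the argument is that the hypotheses control few copies of [X]: a kR-space
    [(X * G) * (X * G)] retracts onto [X * G] and onto [(X * X) * G], while the j-th derivative of
    [f] lives on j + 1 copies of [X]. Polarization brings every order down to two copies. A complex
    derivative is recovered from nearby values of the function itself, so that one copy is enough
    there; and [cplx X] is [X * X] as a topological space, which is why the real analytic case asks
    for the same law as the differentiable one. The chain rule is proved for an abstract
    [ev : M -> lcprod E -> F], linear and continuous in the first argument and multilinear in the
    second, so that plain and symmetrized evaluation share it. [F] may be neither complete nor
    normed, which puts integrals out of reach: mean values come from a supremum argument in convex
    sets, Cauchy's formula from finite averages. *)

Section tvs_limits.
Context {K : numFieldType} {T : Type} {Flt : set_system T} {FF : Filter Flt}.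

Lemma tvs_cvgD (E : tvsType K) (f g : T -> E) a b :
  f @ Flt --> a -> g @ Flt --> b -> (fun t => f t + g t) @ Flt --> a + b.
Proof. by move=> fa gb; exact: (cvg_comp2 fa gb (@add_continuous E (a, b))). Qed.

Lemma tvs_cvgZ (E : tvsType K) (c : T -> K) (f : T -> E) (r : K) a :
  (c : T -> K^o) @ Flt --> (r : K^o) -> f @ Flt --> a ->
  (fun t => c t *: f t) @ Flt --> r *: a.
Proof. by move=> cr fa; exact: (cvg_comp2 cr fa (@scale_continuous K E (r, a))). Qed.

Lemma tvs_cvgZr (E : tvsType K) (c : K) (f : T -> E) a :
  f @ Flt --> a -> (fun t => c *: f t) @ Flt --> c *: a.
Proof. by move=> fa; apply: (@tvs_cvgZ E (fun=> c)) => //; exact: cvg_cst. Qed.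

Lemma tvs_cvgN (E : tvsType K) (f : T -> E) a :
  f @ Flt --> a -> (fun t => - f t) @ Flt --> - a.
Proof.
move=> fa; rewrite -scaleN1r; under eq_fun do rewrite -scaleN1r.
exact: tvs_cvgZr.
Qed.

Lemma tvs_cvgB (E : tvsType K) (f g : T -> E) a b :
  f @ Flt --> a -> g @ Flt --> b -> (fun t => f t - g t) @ Flt --> a - b.
Proof. by move=> fa gb; apply: tvs_cvgD => //; exact: tvs_cvgN. Qed.

Lemma tvs_cvg_sum (E : tvsType K) (I : Type) (r : seq I) (P : pred I)
    (f : I -> T -> E) (a : I -> E) :
  (forall i, P i -> f i @ Flt --> a i) ->
  (fun t => \sum_(i <- r | P i) f i t) @ Flt --> \sum_(i <- r | P i) a i.
Proof.
move=> fa; elim: r => [|i r IH].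
  by rewrite big_nil; under eq_fun do rewrite big_nil; exact: cvg_cst.
rewrite big_cons; under eq_fun do rewrite big_cons.
by case: ifP => // Pi; apply: tvs_cvgD => //; exact: fa.
Qed.

Lemma tvs_cvg_sum_seq (E : tvsType K) (I : eqType) (r : seq I)
    (f : I -> T -> E) (a : I -> E) :
  (forall i, i \in r -> f i @ Flt --> a i) ->
  (fun t => \sum_(i <- r) f i t) @ Flt --> \sum_(i <- r) a i.
Proof.
move=> fa; rewrite big_seq; under eq_fun do rewrite big_seq.
by apply: tvs_cvg_sum => i; exact: fa.
Qed.

Lemma lcprod_map_cvg (I : choiceType) (E : I -> tvsType K) (f : T -> lcprod E)
    (a : lcprod E) :
  (forall i, (fun t => f t i) @ Flt --> a i) -> f @ Flt --> a.
Proof. by move=> fa; apply: lcprod_cvg => i; exact: fa. Qed.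

End tvs_limits.

Lemma cvg_proj (K : numFieldType) (I : choiceType) (E : I -> tvsType K) (T : Type)
    (Flt : set_system T) {FF : Filter Flt} (f : T -> lcprod E) (a : lcprod E) i :
  f @ Flt --> a -> (fun t => f t i) @ Flt --> a i.
Proof. by move=> fa A aA; exact: (fa _ (@lcprod_proj_continuous _ _ E i a A aA)). Qed.

Lemma cvg_fst_comp (S T : topologicalType) (Z : Type) (Flt : set_system Z)
    {FF : Filter Flt} (f : Z -> S * T) (a : S * T) : f @ Flt --> a ->
  (fun t => (f t).1) @ Flt --> a.1.
Proof.
by move=> fa A aA; exact: (fa _ (@cvg_fst _ _ (nbhs a.1) (nbhs a.2) _ A aA)).
Qed.

Lemma cvg_snd_comp (S T : topologicalType) (Z : Type) (Flt : set_system Z)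
    {FF : Filter Flt} (f : Z -> S * T) (a : S * T) : f @ Flt --> a ->
  (fun t => (f t).2) @ Flt --> a.2.
Proof.
by move=> fa A aA; exact: (fa _ (@cvg_snd _ _ (nbhs a.1) (nbhs a.2) _ A aA)).
Qed.

Lemma cvg_eqfun (Z : Type) (T : topologicalType) (Flt : set_system Z)
    (f g : Z -> T) (l : T) : (forall z, f z = g z) -> f @ Flt --> l -> g @ Flt --> l.
Proof. by move=> /funext ->. Qed.

Lemma cvg_then (Z : Type) (S T : topologicalType) (Flt : set_system Z)
    {FF : Filter Flt} (h : Z -> S) (a : S) (g : S -> T) (l : T) :
  h @ Flt --> a -> g @ a --> l -> (fun z => g (h z)) @ Flt --> l.
Proof. by move=> ha ga A /ga/ha. Qed.

Lemma cvg_prod (Z : Type) (S T : topologicalType) (Flt : set_system Z)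
    {FF : Filter Flt} (f : Z -> S) (g : Z -> T) (a : S) (b : T) :
  f @ Flt --> a -> g @ Flt --> b -> (fun z => (f z, g z)) @ Flt --> (a, b).
Proof. exact: cvg_pair. Qed.

Lemma within_openP (S T : topologicalType) (U : set S) (f : S -> T) : open U ->
  {within U, continuous f} <-> forall x, U x -> f @ x --> f x.
Proof.
move=> oU; rewrite continuous_open_subspace//; split=> h x; first by
  move=> Ux; apply: h; rewrite inE.
by rewrite inE; exact: h.
Qed.

Section tvs_nbhs.
Context {K : numFieldType} (E : tvsType K).

Lemma cvg_add0 (x : E) (A : set E) : nbhs x A <-> nbhs (0 : E) [set v | A (x + v)].
Proof.
have h (y z : E) B : nbhs (y + z) B -> nbhs z [set v | B (y + v)].
  move=> yB; have : (fun v => y + v) @ z --> y + z.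
    by apply: tvs_cvgD; [exact: cvg_cst|exact: cvg_id].
  by move=> /(_ _ yB).
split=> [xA|A0]; first by apply: h; rewrite addr0.
have : nbhs x [set v | [set w | A (x + w)] (- x + v)] by apply: h; rewrite addNr.
by apply: filterS => v /=; rewrite addrA subrr add0r.
Qed.

End tvs_nbhs.

(** * Multilinear maps and polarization *)

Section dfwith_lcprod.
Context {K : numFieldType} {I : choiceType} {E : I -> tvsType K}.

Lemma dfw_in (w : lcprod E) i (u : E i) : dfwith w i u i = u.
Proof. exact: dfwith_in. Qed.

Lemma dfw_out (w : lcprod E) i (u : E i) j : j != i -> dfwith w i u j = w j.
Proof. by move=> ji; apply: dfwith_out; rewrite eq_sym. Qed.

End dfwith_lcprod.

Section multilinear_expansion.
Context {K : numFieldType} {k : nat} {E : 'I_k -> tvsType K} {F : tvsType K}.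
Variable b : lcprod E -> F.
Hypothesis lb : multilinear b.

Lemma multilinearD i (x : lcprod E) (u v : E i) :
  b (dfwith x i (u + v)) = b (dfwith x i u) + b (dfwith x i v).
Proof. by have := @lb i x 1 u v; rewrite !scale1r. Qed.

Lemma multilinear0 i (x : lcprod E) : b (dfwith x i 0) = 0.
Proof. by have := @lb i x (-1) 0 0; rewrite scaler0 addr0 scaleN1r addNr. Qed.

Lemma multilinearZ i (x : lcprod E) a (u : E i) :
  b (dfwith x i (a *: u)) = a *: b (dfwith x i u).
Proof. by have := @lb i x a u 0; rewrite !addr0 multilinear0 addr0. Qed.

Lemma multilinear_sum i (x : lcprod E) (J : Type) (r : seq J) (P : pred J)
    (u : J -> E i) :
  b (dfwith x i (\sum_(j <- r | P j) u j)) =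
  \sum_(j <- r | P j) b (dfwith x i (u j)).
Proof.
elim: r => [|j r IH]; first by rewrite !big_nil multilinear0.
by rewrite !big_cons; case: ifP => // _; rewrite multilinearD IH.
Qed.

Lemma multilinear_eq0 i (x : lcprod E) : x i = 0 -> b x = 0.
Proof.
move=> xi; rewrite (_ : x = dfwith x i 0) ?multilinear0//.
by apply: lcprod_ext => j; case: dfwithP.
Qed.

Lemma multilinear_expand (J : finType) (z : forall i, J -> E i) :
  b (fun i => \sum_j z i j) = \sum_(f : {ffun 'I_k -> J}) b (fun i => z i (f i)).
Proof.
pose fIJ := {ffun 'I_k -> J}.
(* With no index in [J], either k = 0 and the only function gives back the empty family, or the sum
   is empty and [b] has a vanishing argument. *)
have [j0 _|J0] := pickP J; last first.
  have [f0|f0] := pickP (fun _ : fIJ => true).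
    case: (posnP k) => [k0|k0] _; last by have := J0 (f0 (Ordinal k0)).
    rewrite (big_pred1 f0) => [|f]; last first.
      by symmetry; apply/eqP/ffunP => i; have := J0 (f i).
    congr b; apply: lcprod_ext => i; exfalso; rewrite k0 in i *.
    by case: i.
  rewrite [RHS]big_pred0 => [|f]; last by have := f0 f.
  have [k0|k0] := posnP k.
    by have := f0 [ffun i : 'I_k =>
      match cast_ord k0 i with Ordinal m p => match notF p with end end].
  apply: (@multilinear_eq0 (Ordinal k0)).
  by rewrite big_pred0.
(* [Pf r] holds the functions equal to [j0] off [r]: they index the expansion of the arguments
   listed in [r], which grows by one argument at a time. *)
pose Pf (r : seq 'I_k) := pfamily j0 (mem r) (fun _ : 'I_k => predT : pred J).
have key r (x : lcprod E) : uniq r ->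
    b (fun i => if i \in r then \sum_j z i j else x i) =
    \sum_(f : fIJ | f \in Pf r) b (fun i => if i \in r then z i (f i) else x i).
  elim: r x => [|i r IH] x.
    move=> _; rewrite (big_pred1 [ffun=> j0])// => f.
    apply/familyP/eqP => /= [Df|->{f} i]; last by rewrite ffunE !inE.
    by apply/ffunP => i; rewrite ffunE; apply/eqP/Df.
  move=> /= /andP[/negbTE nri ur].
  rewrite (_ : (fun _ => _) = dfwith (fun l => if l \in r then \sum_j z l j else x l)
    i (\sum_j z i j)); last first.
    apply: lcprod_ext => l; case: dfwithP => [|l' il]; first by rewrite inE eqxx.
    by rewrite inE eq_sym (negbTE il).
  rewrite multilinear_sum.
  rewrite (partition_big (fun f : fIJ => f i) predT)//=.
  apply: eq_bigr => j _.
  rewrite (_ : dfwith _ i _ = (fun l => if l \in r then \sum_j z l j else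
    (dfwith x i (z i j) : lcprod E) l)); last first.
    apply: lcprod_ext => l; case: dfwithP => [|l' il].
      by rewrite nri dfw_in.
    by rewrite dfw_out// eq_sym.
  rewrite IH//.
  pose seti j (f : fIJ) := [ffun l => if l == i then j else f l].
  rewrite [RHS](reindex_onto (seti j) (seti j0)); last first.
    move=> f /andP[_ /eqP fi].
    by apply/ffunP => l; rewrite !ffunE; case: eqP => // ->.
  apply: eq_big => [f|f eq_f].
    rewrite !ffunE !eqxx andbT; symmetry.
    apply/andP/familyP => /= [[Pjf fij0] l|Pff].
      have /[!(ffunE, inE)] := familyP Pjf l; case: eqP => // -> _.
      by rewrite nri -(eqP fij0) !ffunE !inE !eqxx.
    (split; [apply/familyP|apply/eqP/ffunP]) => l; have /[!(ffunE, inE)] := Pff l.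
      by case: eqP.
    by case: eqP => // ->; rewrite nri /= => /eqP.
  congr b; apply: lcprod_ext => l; rewrite inE ffunE.
  case: (eqVneq l i) => [->|li] /=; first by rewrite nri dfw_in.
  by rewrite dfw_out.
have := key (enum 'I_k) 0 (enum_uniq _).
rewrite (_ : (fun i : 'I_k => if _ then _ else _) = (fun i => \sum_j z i j)); last first.
  by apply: lcprod_ext => i; rewrite mem_enum.
move=> ->; apply: eq_big => [f|f _].
  by apply/familyP => i /=; rewrite mem_enum inE.
by congr b; apply: lcprod_ext => i; rewrite mem_enum.
Qed.

Definition mix (A : {set 'I_k}) (v w : lcprod E) : lcprod E :=
  fun i => if i \in A then v i else w i.

Lemma multilinear_addE (w v : lcprod E) :
  b (w + v) = \sum_(A : {set 'I_k}) b (mix A v w).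
Proof.
have -> : w + v = fun i => \sum_(c : bool) (if c then v i else w i).
  by apply: lcprod_ext => i; rewrite big_bool addrC.
rewrite (multilinear_expand (fun i (c : bool) => if c then v i else w i)).
rewrite (reindex (fun A : {set 'I_k} => [ffun i => i \in A])); last first.
  exists (fun f : {ffun 'I_k -> bool} => [set i | f i]%SET) => [A _|f _].
    by apply/setP => i; rewrite inE ffunE.
  by apply/ffunP => i; rewrite ffunE inE.
by apply: eq_bigr => A _; congr b; apply: lcprod_ext => i; rewrite ffunE.
Qed.

Lemma multilinear_mixZ (A : {set 'I_k}) (t : K) (v w : lcprod E) :
  b (mix A (t *: v) w) = t ^+ #|A| *: b (mix A v w).
Proof.
have key r : uniq r -> b (mix [set i in r]%SET (t *: v) w) =
    t ^+ size r *: b (mix [set i in r]%SET v w).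
  elim: r w => [|i r IH] w' /=.
    move=> _; rewrite expr0 scale1r; congr b; apply: lcprod_ext => i.
    by rewrite /mix !inE.
  move=> /andP[/negbTE ir ur].
  have mixE (x y : lcprod E) : mix [set j in i :: r]%SET x y =
      mix [set j in r]%SET x (dfwith y i (x i)).
    apply: lcprod_ext => j; rewrite /mix !inE.
    by case: (eqVneq j i) => [->|ji] /=; rewrite ?ir ?dfw_in// dfw_out.
  rewrite !mixE IH// exprSr -scalerA; congr (_ *: _).
  have mixE2 (u : E i) : mix [set j in r]%SET v (dfwith w' i u) =
      dfwith (mix [set j in r]%SET v w') i u.
    apply: lcprod_ext => j; rewrite /mix inE.
    by case: (eqVneq j i) => [->|ji] /=; rewrite ?ir ?dfw_in// !dfw_out// inE.
  by rewrite !mixE2 multilinearZ.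
have := key (enum A) (enum_uniq _); rewrite -cardE.
by rewrite (_ : [set i in enum A]%SET = A)//; apply/setP => i; rewrite inE mem_enum.
Qed.

End multilinear_expansion.

Section subsets.
Context {V : nmodType} {k : nat}.

(** Used twice: in [polarization] the paired terms cancel, and in [complexified_ev_multilinear] they
    are the real and the imaginary part of one argument. *)
Lemma sum_subsets_split (j : 'I_k) (f : {set 'I_k} -> V) :
  \sum_(A : {set 'I_k}) f A =
  \sum_(A : {set 'I_k} | j \notin A) (f A + f (j |: A)).
Proof.
rewrite (bigID (fun A : {set 'I_k} => j \in A)) /= addrC big_split /=.
congr (_ + _).
rewrite (reindex_onto (fun A => j |: A) (fun A => A :\ j)) /=; last first.
  by move=> A jA; rewrite finset.setD1K.
apply: eq_bigl => A; rewrite finset.setU11 /=; apply/eqP/idP => [<-|jA].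
  by rewrite !inE eqxx.
by rewrite finset.setU1K.
Qed.

End subsets.

Section polarization.
Context {K : numFieldType} {k : nat} {E F : tvsType K}.
Local Notation P := (lcprod (fun _ : 'I_k => E)).

(** Expanding every argument gives a sum over the functions f from indices to indices. If f misses
    some j, the terms of S and [j |: S] are opposite. The other f are permutations, and for them
    only the full set S leaves a nonzero term. For general [b] the right side is the symmetrization
    on which [sym_ev] rests. *)
Lemma polarization (b : P -> F) (y : P) : multilinear b ->
  \sum_(S : {set 'I_k}) (-1) ^+ #|~: S| *: b (fun _ => \sum_(i in S) y i) =
  \sum_(s : 'S_k) b (fun i => y (s i)).
Proof.
move=> lb.
pose z (S : {set 'I_k}) (i j : 'I_k) : E := if j \in S then y j else 0.
transitivity (\sum_(f : {ffun 'I_k -> 'I_k})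
    \sum_(S : {set 'I_k}) (-1) ^+ #|~: S| *: b (fun i => z S i (f i))).
  rewrite exchange_big /=; apply: eq_bigr => S _; rewrite -scaler_sumr.
  rewrite -(multilinear_expand lb (z S)); congr (_ *: b _).
  by apply: lcprod_ext => i; rewrite big_mkcond.
rewrite (bigID (fun f : {ffun 'I_k -> 'I_k} => injectiveb f)) /=.
rewrite [X in _ + X]big1 ?addr0 => [|f fN].
  rewrite (reindex (@pval _)) /=; last first.
    pose in_Sn := insubd (1%g : 'S_k).
    by exists in_Sn => /= f Uf; first apply: val_inj; apply: insubdK.
  apply: eq_big => /= [s|s _]; first exact: (valP s).
  rewrite (bigD1 ([set: 'I_k]%SET))//= finset.setCT cards0 expr0 scale1r.
  rewrite [X in _ + X]big1 ?addr0 => [|S ST].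
    by congr b; apply: lcprod_ext => i; rewrite /z inE pvalE.
  have [j jS] : exists j, j \notin S.
    apply/existsP; rewrite -negb_forall; apply: contra ST => /forallP h.
    by apply/eqP/setP => j; rewrite inE h.
  rewrite (multilinear_eq0 lb (i := (s^-1)%g j)) ?scaler0//.
  by rewrite /z pvalE permKV (negbTE jS).
have [j jf] : exists j, forall i, f i != j.
  apply: contrapT => nj; move/injectiveP: fN; apply.
  have sf j : j \in codom f.
    apply: contrapT => /negP jN; apply: nj.
    by exists j => i; apply: contra jN => /eqP <-; exact: codom_f.
  (* A surjective f has an injective section; by finiteness this section is bijective, so f would be
     injective. *)
  have /(inj_card_bij (f := fun j => iinv (sf j))) : injective (fun j => iinv (sf j)).
    by move=> i j /(congr1 f); rewrite !f_iinv.
  move=> /(_ (leqnn _))[g _ gK].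
  have fg i : f i = g i by rewrite -{1}(gK i) f_iinv.
  by move=> i j; rewrite !fg => gij; rewrite -(gK i) -(gK j) gij.
rewrite (sum_subsets_split j) big1// => S jS.
rewrite (_ : (fun i => z (j |: S) i (f i)) = (fun i => z S i (f i))); last first.
  by apply: lcprod_ext => i; rewrite /z !inE (negbTE (jf i)).
rewrite -scalerDl (_ : #|~: S| = #|~: (j |: S)|.+1) ?exprS ?mulN1r ?addNr ?scale0r//.
rewrite [LHS](cardsD1 j) finset.in_setC jS add1n; congr _.+1.
by apply: eq_card => i; rewrite !finset.in_setD1 !finset.in_setC finset.in_setU1 negb_or.
Qed.

End polarization.

(** * Directional derivatives and the mean value estimate *)

Section mean_value.
Context {R : realType} {F : tvsType R}.

(* The set [S] of all [s] such that [h s - h 0] lies in [s *: D] contains 0, and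
   its supremum is 1; this avoids Hahn--Banach. *)
Lemma mean_value_convex (D : set F) (h l : R -> F) :
  (forall x y (p : R), 0 <= p <= 1 -> D x -> D y -> D (p *: x + (1 - p) *: y)) ->
  (forall t : R, 0 <= t <= 1 -> nbhs (l t) D) ->
  (forall t : R, 0 <= t <= 1 -> e^-1 *: (h (t + e) - h t) @[e --> 0^'] --> l t) ->
  D (h 1 - h 0).
Proof.
move=> cD Dl hl.
pose P s := exists2 d, D d & h s - h 0 = s *: d.
(* The slope from 0 to b is a convex combination of the slopes from 0 to a and from a to b, with
   weights a / b and 1 - a / b. *)
have step (a b : R) q : 0 <= a -> a < b -> P a -> D q -> h b - h a = (b - a) *: q -> P b.
  move=> a0 ab [d Dd ad] Dq abq; have b0 : 0 < b by exact: le_lt_trans ab.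
  exists ((a / b) *: d + (1 - a / b) *: q).
    apply: cD => //; rewrite divr_ge0 ?(ltW b0)//=.
    by rewrite ler_pdivrMr// mul1r ltW.
  rewrite scalerDr !scalerA mulrBr mulr1 [b * _]mulrC divfK ?gt_eqF//.
  by rewrite -ad -abq [RHS]addrC subrKA.
have strad (t : R) : 0 <= t <= 1 -> exists2 e : R, 0 < e &
    forall d, 0 < `|d| < e -> D (d^-1 *: (h (t + d) - h t)).
  move=> t01; have /(_ _ (Dl t t01)) := hl t t01.
  move=> /(@nbhs_ballP _ R^o)[e /= e0 he]; exists e => // d /andP[d0 de].
  apply: he; last by rewrite -normr_gt0.
  by rewrite -ball_normE/= sub0r normrN.
pose S := [set s : R | 0 <= s <= 1 /\ P s].
have S0 : S 0.
  have t0 : 0 <= (0 : R) <= 1 by rewrite lexx ler01.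
  have [d Dd] : exists d, D d by exists (l 0); exact: nbhs_singleton (Dl _ t0).
  by split; [|exists d => //; rewrite subrr scale0r].
have supS : has_sup S by split; [exists 0|exists 1 => s [/andP[]]].
set c := sup S.
have c0 : 0 <= c by apply: ub_le_sup => //; case: supS.
have c1 : c <= 1 by apply: ge_sup; [exists 0|move=> s [/andP[]]].
(* The limit at [c] is two-sided: the same [e] serves to reach [c] from a point of [S] below it and
   then to step beyond [c]. *)
have [e e0 he] := strad c (introT andP (conj c0 c1)).
have Pc : P c.
  have [s [/andP[s0 s1] Ps]] := sup_adherent e0 supS; rewrite -/c => cs.
  have sc : s <= c by apply: ub_le_sup; [case: supS|split=> //; rewrite s0].
  move: sc; rewrite le_eqVlt => /orP[/eqP <-//|sc].
  apply: (step s c ((s - c)^-1 *: (h (c + (s - c)) - h c))) => //.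
    apply: he; rewrite normr_gt0 subr_eq0 lt_eqF//= ltr0_norm ?subr_lt0//.
    by rewrite opprB ltrBlDl -ltrBlDr.
  rewrite subrKC scalerA -[s - c]opprB invrN mulrN divff ?subr_eq0 ?gt_eqF//.
  by rewrite scaleN1r opprB.
have [c_eq1|c_neq1] := eqVneq c 1.
  by case: Pc => d Dd; rewrite c_eq1 scale1r => ->.
have {c_neq1}c1 : c < 1 by rewrite lt_neqAle c_neq1.
pose d := Num.min (e / 2) (1 - c).
have d0 : 0 < d by rewrite /d lt_min divr_gt0//= subr_gt0.
have de : d < e by rewrite /d gt_min ltr_pdivrMr// mulr2n mulrDr mulr1 ltrDl e0.
have d1 : c + d <= 1 by rewrite -lerBrDl /d ge_min lexx orbT.
suff : S (c + d).
  move=> Scd; have : c + d <= c by apply: ub_le_sup => //; case: supS.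
  by rewrite gerDl leNgt d0.
split; first by rewrite d1 addr_ge0// ltW.
apply: (step c (c + d) (d^-1 *: (h (c + d) - h c))) => //.
- by rewrite ltrDl.
- by apply: he; rewrite gtr0_norm// d0.
- by rewrite [c + d - c]addrC addKr scalerA divff ?gt_eqF// scale1r.
Qed.
End mean_value.

Section punctured_limits.
Context {K : numFieldType}.

Lemma near_dnbhs0 (P : K -> Prop) : (\forall t \near 0^', P t) <->
  exists2 e : K, 0 < e & forall t, 0 < `|t| < e -> P t.
Proof.
split.
  move=> /(@nbhs_ballP _ K^o)[e /= e0 he]; exists e => // d /andP[d0 de].
  by apply: he; [rewrite -ball_normE/= sub0r normrN|rewrite -normr_gt0].
move=> [e e0 he]; apply/(@nbhs_ballP _ K^o); exists e => //= t.
rewrite -ball_normE/= sub0r normrN => te t0.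
by apply: he; rewrite normr_gt0 t0.
Qed.

Lemma cvg_dnbhs_comp (V : topologicalType) (a : K) (h : K -> V) (l : V) : a != 0 ->
  h t @[t --> 0^'] --> l -> h (a * t) @[t --> 0^'] --> l.
Proof.
move=> a0 hl A /hl /near_dnbhs0[e e0 he]; apply/near_dnbhs0.
exists (e / `|a|); first by rewrite divr_gt0 ?normr_gt0.
move=> t /andP[t0 te]; apply: he.
have na : 0 < `|a| by rewrite normr_gt0.
by rewrite normrM (mulr_gt0 na t0)/= mulrC -ltr_pdivlMr.
Qed.

Lemma dnbhs0_cvg : (id : K -> K^o) @ 0^' --> (0 : K^o).
Proof. by move=> A A0; exact: (@cvg_within K^o). Qed.

Context {E F : tvsType K}.

Lemma diff_quotientZ (f : E -> F) x y a (l : F) :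
  diff_quotient f x y t @[t --> 0^'] --> l ->
  diff_quotient f x (a *: y) t @[t --> 0^'] --> a *: l.
Proof.
move=> fl; have [->|a0] := eqVneq a 0.
  rewrite !scale0r; under eq_fun do
    rewrite /diff_quotient scaler0 addr0 subrr scaler0.
  exact: cvg_cst.
have := tvs_cvgZr (c := a) (cvg_dnbhs_comp a0 fl).
have e t : a *: diff_quotient f x y (a * t) = diff_quotient f x (a *: y) t.
  rewrite /diff_quotient !scalerA invfM mulrA divff// mul1r.
  by rewrite [t * a]mulrC.
by under eq_fun do rewrite e; move=> h; exact: h.
Qed.

Lemma cvg_dnbhs0Z (g : K -> F) (l : F) :
  g t @[t --> 0^'] --> l -> t *: g t @[t --> 0^'] --> (0 : F).
Proof.
move=> gl; have h : t *: g t @[t --> 0^'] --> 0 *: l.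
  by apply: tvs_cvgZ => //; exact: dnbhs0_cvg.
by rewrite scale0r in h.
Qed.

Lemma diff_quotient_cvg (f : E -> F) x y (l : F) :
  diff_quotient f x y t @[t --> 0^'] --> l ->
  f (x + t *: y) @[t --> 0^'] --> f x.
Proof.
move=> fl; have h : f x + t *: diff_quotient f x y t @[t --> 0^'] --> f x + 0 *: l.
  by apply: tvs_cvgD; [exact: cvg_cst|apply: tvs_cvgZ => //; exact: dnbhs0_cvg].
rewrite scale0r addr0 in h.
move=> A /h /near_dnbhs0[e e0 he]; apply/near_dnbhs0; exists e => // t te.
have := he t te; rewrite /= /diff_quotient scalerA divff ?scale1r ?subrKC//.
by rewrite -normr_gt0; case/andP: te.
Qed.

Lemma segments_near (x u v : E) (N : set E) : nbhs x N ->
  exists2 e : K, 0 < e & forall a b : K, `|a| < e -> `|b| < e ->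
    N (x + a *: u + b *: v).
Proof.
move=> xN; have c : (fun p : K^o * K^o => x + p.1 *: u + p.2 *: v) @ (0, 0) --> x.
  rewrite -[X in _ --> X]addr0 -[X in _ --> X + _]addr0.
  rewrite -{1}(scale0r u) -(scale0r v).
  apply: tvs_cvgD; last by apply: tvs_cvgZ; [exact: cvg_snd|exact: cvg_cst].
  apply: tvs_cvgD; first exact: cvg_cst.
  by apply: tvs_cvgZ; [exact: cvg_fst|exact: cvg_cst].
have [[/= P Q] [P0 Q0] PQ] := c _ xN.
move/(@nbhs_ballP _ K^o) : P0 => [e /= e0 eP].
move/(@nbhs_ballP _ K^o) : Q0 => [d /= d0 dQ].
have ed0 : 0 < e + d by rewrite addr_gt0.
(* A number below both [e] and [d]; it stands in for their minimum, as the order of [K] may be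
   partial. *)
exists (e * d / (e + d)); first by rewrite divr_gt0// mulr_gt0.
have ed (a : K) : `|a| < e * d / (e + d) -> `|a| < e /\ `|a| < d.
  move=> ah; split; apply: lt_trans ah _; rewrite ltr_pdivrMr//.
    by rewrite ltr_pM2l// ltrDr.
  by rewrite mulrC ltr_pM2l// ltrDl.
move=> a b /ed[ae _] /ed[_ bd]; apply: (PQ (a, b)); split => /=.
  by apply: eP; rewrite -ball_normE/= sub0r normrN.
by apply: dQ; rewrite -ball_normE/= sub0r normrN.
Qed.

Lemma dir_derive_cvg (f : E -> F) x y : has_dir_derive f x y ->
  diff_quotient f x y t @[t --> 0^'] --> dir_derive y f x.
Proof. by move=> [l fl]; rewrite /dir_derive; case: xgetP => [z -> //|/(_ l)]. Qed.

Lemma dir_deriveE (f : E -> F) x y (l : F) : hausdorff_space F ->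
  diff_quotient f x y t @[t --> 0^'] --> l -> dir_derive y f x = l.
Proof.
move=> hF fl; apply: (cvg_unique hF) (fl); apply: dir_derive_cvg.
by exists l.
Qed.

Lemma diff_quotient_near (f g : E -> F) x y : (\forall z \near x, f z = g z) ->
  \forall t \near 0^', diff_quotient f x y t = diff_quotient g x y t.
Proof.
move=> fg; have [e e0 he] := segments_near y 0 fg; apply/near_dnbhs0.
exists e => // t /andP[_ te]; rewrite /diff_quotient (nbhs_singleton fg).
by have := he t 0; rewrite scaler0 !addr0 normr0 => ->.
Qed.

Lemma dir_derive_eq (f g : E -> F) x y : (\forall z \near x, f z = g z) ->
  dir_derive y f x = dir_derive y g x.
Proof.
move=> fg; rewrite /dir_derive; congr (xget 0 _).
have h (f1 g1 : E -> F) (l : F) : (\forall z \near x, f1 z = g1 z) ->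
    diff_quotient f1 x y t @[t --> 0^'] --> l ->
    diff_quotient g1 x y t @[t --> 0^'] --> l.
  move=> /(diff_quotient_near y) fg1 fl.
  exact: cvg_trans (near_eq_cvg fg1) fl.
apply/seteqP; split=> l /=; apply: h => //.
by apply: filterS fg => z ->.
Qed.

Lemma iter_dir_derive_rcons (f : E -> F) us u :
  iter_dir_derive f (rcons us u) = dir_derive u (iter_dir_derive f us).
Proof. by rewrite /iter_dir_derive foldl_rcons. Qed.

Lemma iter_dir_derive_cat (f : E -> F) us vs :
  iter_dir_derive f (us ++ vs) = iter_dir_derive (iter_dir_derive f us) vs.
Proof. by rewrite /iter_dir_derive foldl_cat. Qed.

Lemma iter_dir_derive_eq (f g : E -> F) (U : set E) us : open U ->
  (forall x, U x -> f x = g x) ->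
  forall x, U x -> iter_dir_derive f us x = iter_dir_derive g us x.
Proof.
move=> oU fg; elim/last_ind: us => [|us u IH] x Ux; first exact: fg.
rewrite !iter_dir_derive_rcons; apply: dir_derive_eq.
by apply: (filterS _ (open_nbhs_nbhs (conj oU Ux))) => z; exact: IH.
Qed.

End punctured_limits.

(** * Absolutely convex neighbourhoods of 0 *)

Section absolutely_convex_neighbourhoods.
Context {K : numFieldType} {E : tvsType K}.

(** The balanced core of a convex neighbourhood [C]. The phases of the coefficients a and b are
    absorbed into x and y, which leaves the weights |a| / s and |b| / s, with s = |a| + |b|, for the
    convexity of [C]. *)
Lemma absconvex_nbhs (V : set E) : nbhs 0 V ->
  exists W : set E, [/\ nbhs 0 W, absolutely_convex W & W `<=` V].
Proof.
move=> /tvs_convex_nbhs[C [oC cC C0 CV]]; move/convex_setE in cC.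
exists [set x | forall c : K, `|c| <= 1 -> C (c *: x)]; split.
- have := @scale_continuous K E (0, 0) C; rewrite /= scaler0.
  move=> /(_ (open_nbhs_nbhs (conj oC C0)))[[/= P Q] [P0 Q0] PQ].
  move/(@nbhs_ballP _ K^o) : P0 => [e /= e0 eP].
  have e20 : e / 2 != 0 by rewrite gt_eqF// divr_gt0.
  have := nbhs0Z e20 Q0; apply: filterS => _ [y Qy <-] c c1.
  rewrite scalerA; apply: (PQ (c * (e / 2), y)); split => //=.
  apply: eP; rewrite -ball_normE/= sub0r normrN normrM.
  rewrite (@gtr0_norm _ (e / 2)) ?divr_gt0//.
  apply: (@le_lt_trans _ _ (1 * (e / 2))); first by rewrite ler_wpM2r// ltW// divr_gt0.
  by rewrite mul1r ltr_pdivrMr// mulrDr mulr1 ltrDl.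
- move=> a b x y ab hx hy c c1 /=.
  (* A vanishing coefficient has no phase and is treated apart. *)
  have [a0|a0] := eqVneq a 0.
    rewrite a0 scale0r add0r scalerA; apply: hy.
    rewrite normrM -[leRHS]mulr1 ler_pM//.
    by apply: le_trans ab; rewrite lerDr.
  have [b0|b0] := eqVneq b 0.
    rewrite b0 scale0r addr0 scalerA; apply: hx.
    rewrite normrM -[leRHS]mulr1 ler_pM//.
    by apply: le_trans ab; rewrite lerDl.
  set s := `|a| + `|b| in ab.
  have na0 : `|a| != 0 by rewrite normr_eq0.
  have nb0 : `|b| != 0 by rewrite normr_eq0.
  have s0 : 0 < s by rewrite addr_gt0 ?normr_gt0.
  have p0 : 0 <= `|a| / s by rewrite divr_ge0// ltW.
  have p1 : `|a| / s <= 1 by rewrite ler_pdivrMr// mul1r lerDl.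
  have nrm (d : K) : d != 0 -> `|c * (s * d / `|d|)| <= 1.
    move=> d0; rewrite !normrM normfV normr_id -mulrA divff ?normr_eq0// mulr1.
    by rewrite (@gtr0_norm _ s)// -[leRHS]mulr1 ler_pM// ltW.
  have := cC _ _ (Itv01 p0 p1) (hx _ (nrm a a0)) (hy _ (nrm b b0)).
  congr C; rewrite /= scalerDr !scalerA; congr (_ *: _ + _ *: _).
    by field; rewrite na0 gt_eqF.
  have -> : 1 - `|a| / s = `|b| / s.
    by rewrite -[X in X - _](divff (lt0r_neq0 s0)) -mulrBl /s addrC addKr.
  by field; rewrite nb0 gt_eqF.
- by move=> x /(_ 1); rewrite normr1 scale1r => /(_ (lexx _)) /CV.
Qed.

Lemma absconvex_half (V : set E) : nbhs 0 V -> exists W : set E,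
  [/\ nbhs 0 W, absolutely_convex W & forall u v, W u -> W v -> V (u + v)].
Proof.
move=> /tvs_nbhs0_half[V' V0 h]; have [W [W0 cW WV]] := absconvex_nbhs V0.
by exists W; split=> // u v /WV ? /WV ?; exact: h.
Qed.

Lemma absconvexZ (W : set E) (a : K) x : absolutely_convex W -> `|a| <= 1 ->
  W x -> W (a *: x).
Proof.
move=> cW a1 Wx; have := cW a 0 x x; rewrite scale0r addr0 normr0 addr0.
exact.
Qed.

Lemma absconvex_sum (W : set E) (n : nat) (c : 'I_n -> K) (x : 'I_n -> E) :
  absolutely_convex W -> W 0 -> (forall i, W (x i)) ->
  \sum_(i < n) `|c i| <= 1 -> W (\sum_(i < n) c i *: x i).
Proof.
move=> cW W0 Wx.
(* Factoring out the total weight makes the claim inductive: the tail is its weight times a single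
   element of [W], to which one new term is added. *)
suff [w Ww ->] : exists2 w, W w &
    \sum_(i < n) c i *: x i = (\sum_(i < n) `|c i|) *: w.
  by move=> c1; apply: absconvexZ => //; rewrite ger0_norm// sumr_ge0.
elim: (index_enum _) => [|i r [w Ww IH]].
  by exists 0 => //; rewrite !big_nil scaler0.
rewrite !big_cons IH; set t := \sum_(j <- r) _.
have t0 : 0 <= t by rewrite sumr_ge0.
have [s0|s0] := eqVneq (`|c i| + t) 0.
  move/eqP : (s0); rewrite paddr_eq0// normr_eq0 => /andP[/eqP ci0 /eqP ->].
  by exists 0; rewrite // ci0 !scale0r scaler0 addr0.
exists ((c i / (`|c i| + t)) *: x i + (t / (`|c i| + t)) *: w).
  apply: cW => //; rewrite !normrM normfV (@ger0_norm _ (`|c i| + t)) ?addr_ge0//.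
  by rewrite (@ger0_norm _ t)// -mulrDl divff.
rewrite scalerDr !scalerA; congr (_ *: _ + _ *: _).
  by rewrite mulrCA divff// mulr1.
by rewrite mulrCA divff// mulr1.
Qed.

Lemma cvg_absconvexP (T : Type) (Flt : set_system T) {FF : Filter Flt}
    (f : T -> E) (l : E) :
  (forall W, nbhs 0 W -> absolutely_convex W -> \forall t \near Flt, W (f t - l)) ->
  f @ Flt --> l.
Proof.
move=> h A /cvg_add0/absconvex_nbhs[W [W0 cW WA]].
have := h W W0 cW; rewrite /nbhs/=; apply: filterS => t /WA /=.
by rewrite subrKC.
Qed.

Lemma nbhs_sub (l : E) W : nbhs 0 W -> nbhs l [set z | W (z - l)].
Proof.
move=> W0; apply/cvg_add0; apply: filterS W0 => v /=.
by rewrite addrAC subrr add0r.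
Qed.

Lemma cvg_sub_near (T : Type) (Flt : set_system T) {FF : Filter Flt}
    (f : T -> E) (l : E) W : f @ Flt --> l -> nbhs 0 W -> \forall t \near Flt, W (f t - l).
Proof.
by move=> fl W0; exact: (fl _ (nbhs_sub l W0)).
Qed.

Lemma cvg_dnbhs0_absconvexP (f : K -> E) (l : E) :
  (forall W, nbhs 0 W -> absolutely_convex W ->
    exists2 e : K, 0 < e & forall t, 0 < `|t| < e -> W (f t - l)) ->
  f t @[t --> 0^'] --> l.
Proof.
move=> h A /cvg_add0/absconvex_nbhs[W [W0 cW WA]].
apply/near_dnbhs0; have [e e0 he] := h W W0 cW; exists e => // t /he/WA /=.
by rewrite subrKC.
Qed.

End absolutely_convex_neighbourhoods.

Section real_scalars.
Context {R : realType} {Kg : ground}.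
Local Notation K := (fld R Kg).

(** Real parameters of segments in a K-linear space, for both grounds at once. *)
Definition rho (x : R) : K := emb (SubReals Kg) (x : fld R Reals).

Lemma rhoD x y : rho (x + y) = rho x + rho y. Proof. exact: embD. Qed.
Lemma rhoM x y : rho (x * y) = rho x * rho y. Proof. exact: embM. Qed.
Lemma rho1 : rho 1 = 1. Proof. exact: emb1. Qed.
Lemma rho0 : rho 0 = 0.
Proof. by apply: (addrI (rho 0)); rewrite -rhoD !addr0. Qed.
Lemma rho_norm x : `|rho x| = rho `|x|. Proof. exact: emb_norm. Qed.
Lemma rho_lt x y : (rho x < rho y) = (x < y). Proof. exact: emb_lt. Qed.
Lemma rho_le x y : (rho x <= rho y) = (x <= y). Proof. exact: emb_le. Qed.

Lemma rho_eq0 x : (rho x == 0) = (x == 0).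
Proof.
rewrite -normr_eq0 -[in RHS]normr_eq0 rho_norm !eq_le.
by rewrite -(rho_le `|x| 0) -(rho_le 0 `|x|) rho0.
Qed.

Lemma rhoV x : rho x^-1 = (rho x)^-1.
Proof.
have [->|x0] := eqVneq x 0; first by rewrite invr0 rho0 invr0.
have r0 : rho x != 0 by rewrite rho_eq0.
by apply: (mulfI r0); rewrite -rhoM !divff// rho1.
Qed.

Lemma rho_dnbhs0 : rho @ 0^' --> (0 : K)^'.
Proof.
move=> A /near_dnbhs0[e e0 he].
have [d d0 de] := emb_small (SubReals Kg) e0.
apply/(@near_dnbhs0 R); exists d => //= t /andP[t0 td]; apply: he.
by rewrite rho_norm -rho0 rho_lt t0/= -de rho_lt.
Qed.

Lemma rho_unit_norm (t : R) : 0 <= t <= 1 -> `|rho t| <= 1.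
Proof. by move=> /andP[t0 t1]; rewrite rho_norm ger0_norm// -rho1 rho_le. Qed.

End real_scalars.

(** * Mean value estimates in a direction, additivity of derivatives, Schwarz's theorem *)

Section mean_value_direction.
Context {R : realType} {Kg : ground}.
Local Notation K := (fld R Kg).
Context {E F : tvsType K}.

(** This is [mean_value_convex] for [F] as a real space and the set of all z with [W (z - w)]. The
    smaller [V] enters because the derivatives have to lie in the interior of that set. *)
Lemma mean_value_dir (f g : E -> F) (x y : E) (w : F) (W V : set F) :
  absolutely_convex W -> nbhs 0 V -> (forall u v, V u -> V v -> W (u + v)) ->
  (forall t : R, 0 <= t <= 1 ->
    diff_quotient f (x + rho t *: y) y e @[e --> 0^'] --> g (x + rho t *: y)) ->
  (forall t : R, 0 <= t <= 1 -> V (g (x + rho t *: y) - w)) ->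
  W (f (x + y) - f x - w).
Proof.
move=> cW V0 VW fg gV.
have convW (a b : F) (p : R) : 0 <= p <= 1 -> W (a - w) -> W (b - w) ->
    W (rho p *: a + rho (1 - p) *: b - w).
  move=> p01 Wa Wb.
  rewrite (_ : _ - w = rho p *: (a - w) + rho (1 - p) *: (b - w)).
    apply: cW => //; rewrite !rho_norm -rhoD -rho1 rho_le.
    by case/andP: p01 => p0 p1; rewrite !ger0_norm ?subr_ge0// subrKC.
  by rewrite !scalerBr addrACA -opprD -scalerDl -rhoD subrKC rho1 scale1r.
have := @mean_value_convex R (restr (SubReals Kg) F : tvsType (fld R Reals)) [set z : F | W (z - w)]
  (fun t => f (x + rho t *: y)) (fun t => g (x + rho t *: y)).
rewrite /= rho1 rho0 scale1r scale0r addr0; apply.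
- exact: convW.
- move=> t t01; apply/(@cvg_add0 _ F); apply: filterS V0 => v Vv /=.
  by rewrite addrAC; apply: VW => //; exact: gV.
- move=> t t01.
  apply: cvg_eqfun (cvg_comp _ _ rho_dnbhs0 (fg t t01)) => e /=.
  rewrite /diff_quotient -addrA -scalerDl -rhoD.
  by rewrite -[RHS]/(rho (e^-1) *: (_ : F)) rhoV.
Qed.

Lemma segment_near (x u v : E) (N : set E) : nbhs x N ->
  exists2 e : K, 0 < e & forall t, 0 < `|t| < e ->
    forall a b : R, 0 <= a <= 1 -> 0 <= b <= 1 ->
    N (x + (t * rho a) *: u + (t * rho b) *: v).
Proof.
move=> /(segments_near u v)[e e0 he]; exists e => //.
move=> t /andP[_ te] a b a01 b01.
have h c : 0 <= c <= 1 -> `|t * rho c| < e.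
  move=> c01; rewrite normrM; apply: le_lt_trans te.
  by rewrite -[leRHS]mulr1 ler_pM// rho_unit_norm.
by apply: he; exact: h.
Qed.

(** Turns the difference quotient of [f] over a step t into a plain increment, along [t *: y], of
    the function scaled by the inverse of t: the form to which [mean_value_dir] applies. *)
Lemma diff_quotient_rescale (f : E -> F) (z y : E) (l : F) (t : K) : t != 0 ->
  diff_quotient f z y e @[e --> 0^'] --> l ->
  diff_quotient (fun z => t^-1 *: f z) z (t *: y) e @[e --> 0^'] --> l.
Proof.
move=> t0 /(diff_quotientZ (a := t)) fl.
have h : t^-1 *: diff_quotient f z (t *: y) e @[e --> 0^'] --> t^-1 *: (t *: l).
  exact: tvs_cvgZr.
rewrite scalerA mulVf// scale1r in h.
apply: cvg_eqfun h => e.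
by rewrite /diff_quotient -scalerBr !scalerA mulrC.
Qed.

(** The increment is split at x + t u. The first leg is the quotient in the direction u; the second
    is compared with [fv x] by the mean value estimate, through the continuity of [fv] at x. *)
Lemma diff_quotientD (f fv : E -> F) (x u v : E) (l : F) :
  (\forall z \near x, diff_quotient f z v t @[t --> 0^'] --> fv z) ->
  fv @ x --> fv x ->
  diff_quotient f x u t @[t --> 0^'] --> l ->
  diff_quotient f x (u + v) t @[t --> 0^'] --> l + fv x.
Proof.
move=> fvn fvc fu.
suff h : (fun t => t^-1 *: (f (x + t *: u + t *: v) - f (x + t *: u))) @ 0^' --> fv x.
  apply: cvg_eqfun (tvs_cvgD fu h) => t.
  rewrite /diff_quotient (scalerDr t u v) addrA -scalerDr; congr (_ *: _).
  by rewrite [LHS]addrC subrKA.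
apply: cvg_dnbhs0_absconvexP => W W0 cW; have [V [V0 cV VW]] := absconvex_half W0.
have N : \forall z \near x, diff_quotient f z v t @[t --> 0^'] --> fv z /\
    V (fv z - fv x) by exact: (filterI fvn (cvg_sub_near fvc V0)).
have [e e0 he] := segment_near u v N; exists e => // t te.
have ht := he t te; have tn0 : t != 0 by rewrite -normr_gt0; case/andP: te.
rewrite scalerBr.
apply: (@mean_value_dir (fun z => t^-1 *: f z) fv (x + t *: u) (t *: v) (fv x) W V) => // s s01.
  apply: diff_quotient_rescale => //.
  have [] := ht 1 s; rewrite ?lexx ?ler01//.
  by rewrite rho1 mulr1 scalerA mulrC.
have [] := ht 1 s; rewrite ?lexx ?ler01//.
by rewrite rho1 mulr1 scalerA mulrC.
Qed.

(** Two nested mean value estimates, in the direction u and then in v, compare the second difference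
    with [fuv x]. That difference is symmetric in u and v, so uniqueness of limits yields
    [schwarz]. *)
Lemma schwarz_limit (f fu fuv : E -> F) (x u v : E) :
  (\forall z \near x, diff_quotient f z u t @[t --> 0^'] --> fu z) ->
  (\forall z \near x, diff_quotient fu z v t @[t --> 0^'] --> fuv z) ->
  fuv @ x --> fuv x ->
  (fun t => (t * t)^-1 *:
    (f (x + t *: u + t *: v) - f (x + t *: u) - f (x + t *: v) + f x))
    @ 0^' --> fuv x.
Proof.
move=> fun_ fuvn fuvc.
apply: cvg_dnbhs0_absconvexP => W W0 cW; have [V [V0 cV VW]] := absconvex_half W0.
have [V' [V'0 cV' V'V]] := absconvex_half V0.
have N : \forall z \near x, diff_quotient f z u t @[t --> 0^'] --> fu z /\
    (diff_quotient fu z v t @[t --> 0^'] --> fuv z /\ V' (fuv z - fuv x)).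
  exact: (filterI fun_ (filterI fuvn (cvg_sub_near fuvc V'0))).
have [e e0 he] := segment_near u v N; exists e => // t te.
have ht := he t te; have tn0 : t != 0 by rewrite -normr_gt0; case/andP: te.
pose h z := t^-1 *: (f (z + t *: v) - f z).
rewrite (_ : _ *: _ = t^-1 *: h (x + t *: u) - t^-1 *: h x); last first.
  rewrite -scalerBr /h -scalerBr scalerA -invfM; congr (_ *: _).
  by rewrite opprB [X in _ = _ + X]addrC addrA.
(* The derivative of [h] in the direction u, itself a difference quotient of [fu] in the direction
   v. *)
pose g z := t^-1 *: (fu (z + t *: v) - fu z).
have I0 : (0 : R) <= (0 : R) <= 1 by rewrite lexx ler01.
have I1 : (0 : R) <= (1 : R) <= 1 by rewrite lexx ler01.
apply: (@mean_value_dir (fun z => t^-1 *: h z) g x (t *: u) (fuv x) W V) => // s s01.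
  apply: diff_quotient_rescale => //.
  have [d1 _] := ht s 1 s01 I1; have [d0 _] := ht s 0 s01 I0.
  rewrite rho1 mulr1 -scalerA in d1; rewrite rho0 mulr0 scale0r addr0 -scalerA in d0.
  rewrite scalerA [rho s * t]mulrC -scalerA.
  apply: cvg_eqfun (tvs_cvgZr (c := t^-1) (tvs_cvgB d1 d0)) => c.
  rewrite /diff_quotient /h -!scalerBr !scalerA [t^-1 * _]mulrC; congr (_ *: _).
  set z := x + _ *: u; rewrite (addrAC z (t *: v)) !opprB addrACA [RHS]addrACA.
  by congr (_ + _); rewrite [LHS]addrC.
rewrite /g scalerBr.
apply: (@mean_value_dir (fun z => t^-1 *: fu z) fuv (x + rho s *: (t *: u))
  (t *: v) (fuv x) V V') => // s' s'01.
  apply: diff_quotient_rescale => //.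
  have [_ []] := ht s s' s01 s'01.
  by rewrite !scalerA [rho s * t]mulrC [rho s' * t]mulrC.
have [_ []] := ht s s' s01 s'01.
by rewrite !scalerA [rho s * t]mulrC [rho s' * t]mulrC.
Qed.

Lemma schwarz (f fu fv fuv fvu : E -> F) (x u v : E) : hausdorff_space F ->
  (\forall z \near x, diff_quotient f z u t @[t --> 0^'] --> fu z) ->
  (\forall z \near x, diff_quotient fu z v t @[t --> 0^'] --> fuv z) ->
  fuv @ x --> fuv x ->
  (\forall z \near x, diff_quotient f z v t @[t --> 0^'] --> fv z) ->
  (\forall z \near x, diff_quotient fv z u t @[t --> 0^'] --> fvu z) ->
  fvu @ x --> fvu x ->
  fuv x = fvu x.
Proof.
move=> hF h1 h2 h3 h4 h5 h6; have l1 := schwarz_limit h1 h2 h3.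
have l2 := schwarz_limit h4 h5 h6.
apply: (cvg_unique hF) l1 _.
apply: cvg_eqfun l2 => t /=; congr (_ *: _).
by rewrite (addrAC x (t *: v)); congr (_ + _); rewrite [LHS]addrAC.
Qed.

End mean_value_direction.

Lemma map_nth_enum_ord (T : Type) (x0 : T) (s : seq T) n : size s = n ->
  [seq nth x0 s (val i) | i <- enum 'I_n] = s.
Proof.
by move=> <-; rewrite (map_comp (nth x0 s) val) val_enum_ord map_nth_iota0// take_size.
Qed.

Lemma open_setXT (S T : topologicalType) (U : set S) :
  open U -> open (U `*` [set: T]).
Proof.
move=> oU; rewrite (_ : _ `*` _ = fst @^-1` U); last first.
  by apply/seteqP; split=> [p []//|p]; split.
by apply: open_comp => // p _; exact: cvg_fst.
Qed.

(** * Symmetry of iterated derivatives *)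

Section iterated_derivatives.
Context {R : realType} {Kg : ground}.
Local Notation K := (fld R Kg).
Context {E F : tvsType K}.
Variables (leq_r : nat -> Prop) (U : set E) (f : E -> F).
Hypothesis hF : hausdorff_space F.
Hypothesis oU : open U.
Hypothesis leq_rS : forall j, leq_r j.+1 -> leq_r j.
Hypothesis fC : C_upto leq_r U f.

Lemma leq_r_le i j : (i <= j)%N -> leq_r j -> leq_r i.
Proof.
move=> /subnK <-; elim: (_ - _)%N => // n IH /leq_rS; exact: IH.
Qed.

Lemma dn_cvg j (x : E) (y : lcprod (fun _ : 'I_j => E)) : leq_r j -> U x ->
  dn f (j := j) @ (x, y) --> dn f (x, y).
Proof.
case: j y => [|j] y lj Ux.
  have [/(within_openP f oU) fc _] := fC.
  have e0 p : dn f (j := 0) p = f p.1.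
    by rewrite /dn (_ : enum 'I_0 = [::])//; apply/nilP; rewrite /nilp size_enum_ord.
  rewrite e0; apply: (cvg_eqfun (f := fun p => f p.1)) => //.
  by apply: cvg_comp (fc x Ux); exact: cvg_fst.
have [_ /(_ j lj)[_ /within_openP h]] := fC.
by apply: h => //; exact: open_setXT.
Qed.

Lemma iter_dir_derive_cvg us (x : E) : leq_r (size us) -> U x ->
  iter_dir_derive f us @ x --> iter_dir_derive f us x.
Proof.
move=> ls Ux; pose y : lcprod (fun _ : 'I_(size us) => E) := fun i => nth 0 us i.
have yE z : dn f (z, y) = iter_dir_derive f us z by rewrite /dn map_nth_enum_ord.
rewrite -yE; apply: (cvg_eqfun yE).
exact: (cvg_then (cvg_prod cvg_id (cvg_cst y)) (dn_cvg (y := y) ls Ux)).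
Qed.

Lemma iter_dir_derive_diff us (x y : E) : leq_r (size us).+1 -> U x ->
  diff_quotient (iter_dir_derive f us) x y t @[t --> 0^'] -->
  iter_dir_derive f (rcons us y) x.
Proof.
move=> ls Ux; rewrite iter_dir_derive_rcons; apply: dir_derive_cvg.
by have [_ /(_ _ ls)[h _]] := fC; exact: h.
Qed.

Lemma iter_dir_derive_swap us (u v x : E) : leq_r (size us).+2 -> U x ->
  iter_dir_derive f (us ++ [:: u; v]) x = iter_dir_derive f (us ++ [:: v; u]) x.
Proof.
move=> ls Ux; have Un := open_nbhs_nbhs (conj oU Ux).
have rr (a b : E) : us ++ [:: a; b] = rcons (rcons us a) b by rewrite -!cats1 -catA.
have near_diff ws a : leq_r (size ws).+1 -> \forall z \near x,
    diff_quotient (iter_dir_derive f ws) z a t @[t --> 0^'] -->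
    iter_dir_derive f (rcons ws a) z.
  by move=> lw; apply: filterS Un => z Uz; exact: iter_dir_derive_diff.
have ls1 := leq_rS ls.
rewrite !rr; apply: (schwarz hF (near_diff us u ls1) _ _ (near_diff us v ls1)).
- by apply: near_diff; rewrite size_rcons.
- by apply: iter_dir_derive_cvg; rewrite ?size_rcons.
- by apply: near_diff; rewrite size_rcons.
- by apply: iter_dir_derive_cvg; rewrite ?size_rcons.
Qed.

(** Adjacent swaps carry one direction to the end of the list. The last direction belongs to the
    outermost derivative, the one for which additivity and homogeneity are available. *)
Lemma iter_dir_derive_last us u ws (x : E) : leq_r (size (us ++ u :: ws)) -> U x ->
  iter_dir_derive f (us ++ u :: ws) x = iter_dir_derive f (us ++ ws ++ [:: u]) x.
Proof.
elim: ws us x => [//|w ws IH] us x ls Ux.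
have -> : us ++ [:: u, w & ws] = (us ++ [:: u; w]) ++ ws by rewrite -catA.
rewrite iter_dir_derive_cat.
rewrite (iter_dir_derive_eq (g := iter_dir_derive f (us ++ [:: w; u])) ws oU)//; last first.
  move=> z Uz; apply: iter_dir_derive_swap => //; apply: leq_r_le ls.
  by rewrite size_cat /= !addnS !ltnS leq_addr.
rewrite -iter_dir_derive_cat (_ : _ ++ ws = (rcons us w) ++ u :: ws); last first.
  by rewrite -cats1 -!catA.
rewrite IH//; first by rewrite -cats1 -!catA.
by move: ls; rewrite !size_cat size_rcons /= addSnnS.
Qed.

Lemma iter_dir_derive_perm us vs (x : E) : perm_eq us vs -> leq_r (size us) ->
  U x -> iter_dir_derive f us x = iter_dir_derive f vs x.
Proof.
elim/last_ind: us vs x => [|us u IH] vs x.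
  by rewrite perm_sym => /perm_nilP ->.
move=> p ls Ux; have /path.splitPr uv : u \in vs.
  by rewrite -(perm_mem p) mem_rcons mem_head.
case: uv p => a b p.
rewrite iter_dir_derive_last -?(perm_size p)//.
rewrite catA cats1 !iter_dir_derive_rcons.
have p' : perm_eq us (a ++ b).
  by move: p; rewrite perm_sym -cat1s perm_catCA perm_sym perm_rcons /= perm_cons.
apply: dir_derive_eq; apply: (filterS _ (open_nbhs_nbhs (conj oU Ux))) => z Uz.
by apply: IH => //; apply: leq_r_le ls; rewrite size_rcons.
Qed.

Lemma iter_dir_deriveD us (u v x : E) : leq_r (size us).+1 -> U x ->
  iter_dir_derive f (rcons us (u + v)) x =
  iter_dir_derive f (rcons us u) x + iter_dir_derive f (rcons us v) x.
Proof.
move=> ls Ux; rewrite iter_dir_derive_rcons; apply: dir_deriveE => //.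
apply: diff_quotientD.
- apply: (filterS _ (open_nbhs_nbhs (conj oU Ux))) => z Uz.
  exact: iter_dir_derive_diff.
- by apply: iter_dir_derive_cvg; rewrite ?size_rcons.
- exact: iter_dir_derive_diff.
Qed.

Lemma iter_dir_deriveZ us (a : K) (u x : E) : leq_r (size us).+1 -> U x ->
  iter_dir_derive f (rcons us (a *: u)) x = a *: iter_dir_derive f (rcons us u) x.
Proof.
move=> ls Ux; rewrite iter_dir_derive_rcons; apply: dir_deriveE => //.
by apply: diff_quotientZ; exact: iter_dir_derive_diff.
Qed.

Lemma dn_multilinear j (x : E) : leq_r j -> U x ->
  multilinear (fun y : lcprod (fun _ : 'I_j => E) => dn f (x, y)).
Proof.
move=> lj Ux i y a u v; rewrite /dn /=.
have /path.splitPr : i \in enum 'I_j by rewrite mem_enum.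
have := enum_uniq 'I_j; have := size_enum_ord j.
move: (enum _) => s + + ss; case: ss => s1 s2 sz us.
have mE w : [seq dfwith y i w l | l <- s1 ++ i :: s2] =
    [seq y l | l <- s1] ++ w :: [seq y l | l <- s2].
  rewrite map_cat /= dfw_in; move: us; rewrite cat_uniq /= => /and3P[_ iN /andP[is2 _]].
  congr (_ ++ _ :: _); apply/eq_in_map => l ls; rewrite dfw_out//.
    by apply: contraNneq iN => <-; rewrite ls.
  by apply: contraNneq is2 => <-.
have sE w : size ([seq y l | l <- s1] ++ w :: [seq y l | l <- s2]) = j.
  by move: sz; rewrite !size_cat /= !size_map.
rewrite !mE !iter_dir_derive_last ?sE// !catA !cats1.
have sE' : (size ([seq y l | l <- s1] ++ [seq y l | l <- s2])).+1 = j.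
  by rewrite -[RHS](sE 0) !size_cat /= addnS.
by rewrite iter_dir_deriveD ?sE'// iter_dir_deriveZ ?sE'.
Qed.

Lemma dn_symmetric j (x : E) (y : lcprod (fun _ : 'I_j => E)) (s : 'S_j) :
  leq_r j -> U x -> dn f (x, (fun i => y (s i)) : lcprod (fun _ : 'I_j => E)) = dn f (x, y).
Proof.
move=> lj Ux; rewrite /dn /=; apply: iter_dir_derive_perm => //; last first.
  by rewrite size_map size_enum_ord.
rewrite (map_comp y s); apply: perm_map; apply: uniq_perm.
- by rewrite map_inj_uniq ?enum_uniq//; exact: perm_inj.
- exact: enum_uniq.
- move=> i; rewrite mem_enum; apply/mapP; exists ((s^-1)%g i); first by rewrite mem_enum.
  by rewrite permKV.
Qed.

Lemma dn_polarization j (x : E) (y : lcprod (fun _ : 'I_j => E)) :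
  leq_r j -> U x -> dn f (x, y) = (j`!)%:R^-1 *: \sum_(S : {set 'I_j})
    (-1) ^+ #|~: S| *:
      dn f (x, (fun=> \sum_(i in S) y i) : lcprod (fun _ : 'I_j => E)).
Proof.
move=> lj Ux.
rewrite (polarization y (dn_multilinear lj Ux)).
under eq_bigr do rewrite dn_symmetric//.
have j0 : (j`!)%:R != 0 :> K by rewrite pnatr_eq0 -lt0n fact_gt0.
by rewrite sumr_const card_Sn -[X in _ *: X]scaler_nat scalerA mulVf// scale1r.
Qed.

End iterated_derivatives.

(** * Derivatives of evaluated maps *)

Section evaluation.
Context {R : realType} {Kg : ground}.
Local Notation K := (fld R Kg).
Context {k : nat} {X M F : tvsType K} {E : 'I_k -> tvsType K}.
Variable ev : M -> lcprod E -> F.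
Hypothesis ev_linear : forall y, linear (ev^~ y).
Hypothesis ev_multilinear : forall m, multilinear (ev m).
Hypothesis ev_continuous : forall y, continuous (ev^~ y).

Lemma evB m m' y : ev (m - m') y = ev m y - ev m' y.
Proof.
have := ev_linear y (-1) m' m; rewrite !scaleN1r => h.
by rewrite addrC h addrC.
Qed.

Lemma evZ a m y : ev (a *: m) y = a *: ev m y.
Proof.
have ev0 : ev 0 y = 0 by rewrite -(subrr 0) evB subrr.
by have := ev_linear y a m 0; rewrite addr0 ev0 addr0.
Qed.

Lemma evD m m' y : ev (m + m') y = ev m y + ev m' y.
Proof. by have := ev_linear y 1 m m'; rewrite !scale1r. Qed.

Lemma ev_sum (I : Type) (r : seq I) (P : pred I) (m : I -> M) y :
  ev (\sum_(i <- r | P i) m i) y = \sum_(i <- r | P i) ev (m i) y.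
Proof.
elim: r => [|i r IH]; first by rewrite !big_nil -(subrr 0) evB subrr.
by rewrite !big_cons; case: ifP => // _; rewrite evD IH.
Qed.

Lemma sum_card1 (V : nmodType) (f : {set 'I_k} -> V) :
  \sum_(A : {set 'I_k} | #|A| == 1%N) f A = \sum_(i < k) f [set i]%SET.
Proof.
rewrite -[RHS](big_imset f (h := fun i => [set i]%SET) (A := predT))//=; last first.
  by move=> i j _ _; exact: finset.set1_inj.
apply: eq_bigl => A; apply/cards1P/imsetP => [[i ->]|[i _ ->]]; by exists i.
Qed.

(** Expand [w + t *: v] over the sets A of slots filled from v. The term of a nonempty A carries t
    to the power #|A| - 1, so that only singletons survive; the empty A contributes the difference
    quotient of [g]. Of the continuity of [ev], only that in the first argument enters. *)
Lemma ev_line_diff (g : X -> M) (x u : X) (m : M) (w v : lcprod E) :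
  diff_quotient g x u t @[t --> 0^'] --> m ->
  t^-1 *: (ev (g (x + t *: u)) (w + t *: v) - ev (g x) w) @[t --> 0^'] -->
  ev m w + \sum_(i < k) ev (g x) (dfwith w i (v i)).
Proof.
move=> gm; have gc := diff_quotient_cvg gm.
have evg y : ev (g (x + t *: u)) y @[t --> 0^'] --> ev (g x) y.
  exact: (cvg_then gc (@ev_continuous y (g x))).
pose T (A : {set 'I_k}) (t : K) := if #|A| == 0%N then ev (diff_quotient g x u t) w
  else t ^+ #|A|.-1 *: ev (g (x + t *: u)) (mix A v w).
pose L (A : {set 'I_k}) := if #|A| == 0%N then ev m w else
  if #|A| == 1%N then ev (g x) (mix A v w) else 0.
have TL : (fun t => \sum_(A : {set 'I_k}) T A t) @ 0^' --> \sum_(A : {set 'I_k}) L A.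
  apply: tvs_cvg_sum => A _; rewrite /T /L; have [A0|A0] := eqVneq #|A| 0%N.
    exact: (cvg_then gm (@ev_continuous w m)).
  have [A1|A1] := eqVneq #|A| 1%N.
    by apply: cvg_eqfun (evg (mix A v w)) => t; rewrite A1 expr0 scale1r.
  have [n ->] : exists n, #|A|.-1 = n.+1.
    by exists #|A|.-2; case: #|A| A0 A1 => [|[|]].
  elim: n => [|n IH].
    by apply: cvg_eqfun (cvg_dnbhs0Z (evg (mix A v w))) => t; rewrite expr1.
  by apply: cvg_eqfun (cvg_dnbhs0Z IH) => t; rewrite scalerA -exprS.
have -> : ev m w + \sum_(i < k) ev (g x) (dfwith w i (v i)) = \sum_(A : {set 'I_k}) L A.
  rewrite (bigD1 finset.set0)//= {1}/L cards0 eqxx; congr (_ + _).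
  rewrite (eq_bigr (fun A : {set 'I_k} => if #|A| == 1%N then ev (g x) (mix A v w) else 0));
    last first.
    by move=> A A0; rewrite /L cards_eq0 (negbTE A0).
  rewrite -big_mkcondr /= (eq_bigl (fun A : {set 'I_k} => #|A| == 1%N)); last first.
    move=> A; rewrite -cards_eq0; by case: #|A| => [|[|]].
  rewrite sum_card1; apply: eq_bigr => i _; congr ev; apply: lcprod_ext => j.
  rewrite /mix finset.inE; have [->|ji] := eqVneq j i; first by rewrite dfw_in.
  by rewrite dfw_out.
apply: cvg_trans TL; apply: near_eq_cvg; apply/near_dnbhs0; exists 1 => // t /andP[t0 _].
have {}t0 : t != 0 by rewrite -normr_gt0.
rewrite (multilinear_addE (@ev_multilinear _)) /=.
rewrite (bigD1 finset.set0)//= [in RHS](bigD1 finset.set0)//=.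
rewrite {1}/T cards0 eqxx.
have -> : mix finset.set0 (t *: v) w = w.
  by apply: lcprod_ext => i; rewrite /mix finset.inE.
rewrite addrAC scalerDr /diff_quotient evZ evB; congr (_ + _).
rewrite scaler_sumr; apply: eq_bigr => A A0.
rewrite /T cards_eq0 (negbTE A0) (multilinear_mixZ (@ev_multilinear _)) scalerA.
congr (_ *: _); rewrite -cards_eq0 in A0; case: #|A| A0 => // n _.
by rewrite exprS mulrA mulVf// mul1r.
Qed.

(** * Derivatives of the evaluated map as finite sums *)

Section derivative_terms.
Variables (leq_r : nat -> Prop) (U : set X) (f : X -> M).
Hypothesis hF : hausdorff_space F.
Hypothesis oU : open U.
Hypothesis leq_rS : forall j, leq_r j.+1 -> leq_r j.
Hypothesis fC : C_upto leq_r U f.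

Local Notation fv := (fun p : X * lcprod E => ev (f p.1) p.2).

(* [(m, d)] stands for one summand of the j-th derivative in the directions
   q_0, ..., q_(j-1): the mask m selects the directions in which f is
   differentiated, and [d i = Some l] if q_l has replaced the i-th argument *)
Definition dterm : Type := (bitseq * {ffun 'I_k -> option nat})%type.

Definition slots (d : {ffun 'I_k -> option nat}) (qs : seq (X * lcprod E))
    (y : lcprod E) : lcprod E :=
  fun i => if d i is Some l then (nth 0 qs l).2 i else y i.

Definition dterm_val (qs : seq (X * lcprod E)) (t : dterm) (p : X * lcprod E) : F :=
  ev (iter_dir_derive f (mask t.1 [seq q.1 | q <- qs]) p.1) (slots t.2 qs p.2).

(** The product rule: a new direction either differentiates [f] once more or replaces an argument
    that still comes from the base point. Arguments replaced before are constant by now, and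
    linearity in each slot excludes further terms. *)
Definition dterm_next (j : nat) (t : dterm) : seq dterm :=
  (rcons t.1 true, t.2) ::
  [seq (rcons t.1 false, [ffun l => if l == i then Some j else t.2 l])
  | i <- enum 'I_k & t.2 i == None].

Fixpoint dterms (j : nat) : seq dterm :=
  if j is j'.+1 then flatten [seq dterm_next j' t | t <- dterms j']
  else [:: ([::], [ffun=> None])].

Lemma dterms_wf j t : t \in dterms j ->
  size t.1 = j /\ forall i l, t.2 i = Some l -> (l < j)%N.
Proof.
elim: j t => [|j IH] t /=.
  by rewrite mem_seq1 => /eqP -> /=; split=> // i l; rewrite ffunE.
move=> /flatten_mapP[[m d] /IH[/= mj dj]]; rewrite inE => /orP[/eqP -> /=|].
  by rewrite size_rcons mj; split=> // i l /dj /ltnW.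
move=> /mapP[i _ -> /=]; rewrite size_rcons mj; split=> // i' l.
by rewrite ffunE; case: ifP => [_ [<-]//|_ /dj /ltnW].
Qed.

Lemma dterm_val_diff j qs q t x y : leq_r j.+1 -> size qs = j -> t \in dterms j ->
  U x -> diff_quotient (dterm_val qs t) (x, y) q e @[e --> 0^'] -->
    \sum_(t' <- dterm_next j t) dterm_val (rcons qs q) t' (x, y).
Proof.
case: t => m d lj sq /dterms_wf[/= mj dj] Ux.
pose g := iter_dir_derive f (mask m [seq q.1 | q <- qs]).
(* Slots already filled do not move with the base point, hence the 0. *)
pose v : lcprod E := fun i => if d i is Some l then 0 else q.2 i.
have sm : size m = size [seq q.1 | q <- qs] by rewrite size_map sq.
have lm : leq_r (size (mask m [seq q.1 | q <- qs])).+1.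
  apply: (leq_r_le leq_rS) lj; rewrite ltnS size_mask//.
  by apply: leq_trans (count_size _ _) _; rewrite mj.
have h := ev_line_diff (w := slots d qs y) (v := v) (iter_dir_derive_diff (y := q.1) fC lm Ux).
have slots_rcons e : slots d (rcons qs q) e = slots d qs e.
  apply: lcprod_ext => i; rewrite /slots; case di: (d i) => [l|//].
  by rewrite nth_rcons sq (dj _ _ di).
move: h; rewrite big_cons {2}/dterm_val /= slots_rcons map_rcons mask_rcons// cats1.
rewrite big_map big_filter big_enum_cond /=.
rewrite (bigID (fun i => d i == None)) /= [X in _ + (_ + X)]big1 ?addr0; last first.
  by move=> i; rewrite /v; case: (d i) => // l _; rewrite multilinear0.
rewrite (eq_bigr (fun i => dterm_val (rcons qs q)
  (rcons m false, [ffun l => if l == i then Some j else d l]) (x, y))); last first.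
  move=> i /eqP di; rewrite /dterm_val /= map_rcons mask_rcons// cats0.
  congr ev; apply: lcprod_ext => i'; rewrite /slots ffunE.
  have [->|ii'] := eqVneq i' i.
    by rewrite dfw_in /v di nth_rcons sq ltnn eqxx.
  rewrite dfw_out//; case di': (d i') => [l|//].
  by rewrite nth_rcons sq (dj _ _ di').
move=> h; apply: cvg_eqfun h => e; rewrite /diff_quotient /dterm_val /=; congr (_ *: (ev _ _ - _)).
apply: lcprod_ext => i.
rewrite -[LHS]/(slots d qs y i + e *: v i) /slots /v -[(_ + _ : lcprod E)]/(y + e *: q.2).
by case: (d i) => [l|//]; rewrite scaler0 addr0.
Qed.

Lemma dterms_sum_diff qs q x y : leq_r (size qs).+1 -> U x ->
  diff_quotient (fun p => \sum_(t <- dterms (size qs)) dterm_val qs t p) (x, y) q e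
    @[e --> 0^'] -->
  \sum_(t <- dterms (size qs)) \sum_(t' <- dterm_next (size qs) t)
    dterm_val (rcons qs q) t' (x, y).
Proof.
move=> ls Ux.
have h : (fun e => \sum_(t <- dterms (size qs)) diff_quotient (dterm_val qs t) (x, y) q e)
    @ 0^' --> \sum_(t <- dterms (size qs)) \sum_(t' <- dterm_next (size qs) t)
      dterm_val (rcons qs q) t' (x, y).
  by apply: tvs_cvg_sum_seq => t tj; exact: dterm_val_diff.
apply: cvg_eqfun h => e; rewrite /diff_quotient -scaler_sumr; congr (_ *: _).
by rewrite big_split /= sumrN.
Qed.

Lemma iter_dir_derive_dterms qs x y : leq_r (size qs) -> U x ->
  iter_dir_derive fv qs (x, y) = \sum_(t <- dterms (size qs)) dterm_val qs t (x, y).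
Proof.
elim/last_ind: qs x y => [|qs q IH] x y ls Ux.
  rewrite /= big_seq1 /dterm_val /=; congr ev; apply: lcprod_ext => i.
  by rewrite /slots ffunE.
rewrite size_rcons in ls *.
rewrite iter_dir_derive_rcons.
rewrite (dir_derive_eq (g := fun p => \sum_(t <- dterms (size qs)) dterm_val qs t p)); last first.
  apply: (filterS _ (open_nbhs_nbhs (conj (open_setXT (T := lcprod E) oU)
    (conj Ux I : (U `*` setT) (x, y))))).
  by move=> -[x' y'] [/= Ux' _]; apply: IH => //; exact: leq_rS.
apply: dir_deriveE => //=; rewrite big_flatten /= big_map.
exact: dterms_sum_diff.
Qed.

Lemma iter_dir_derive_diff_dterms qs q x y : leq_r (size qs).+1 -> U x ->
  diff_quotient (iter_dir_derive fv qs) (x, y) q e @[e --> 0^'] -->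
  \sum_(t <- dterms (size qs)) \sum_(t' <- dterm_next (size qs) t)
    dterm_val (rcons qs q) t' (x, y).
Proof.
move=> ls Ux; apply: cvg_trans (dterms_sum_diff (q := q) (y := y) ls Ux).
apply: near_eq_cvg; apply: diff_quotient_near.
apply: (filterS _ (open_nbhs_nbhs (conj (open_setXT (T := lcprod E) oU)
  (conj Ux I : (U `*` setT) (x, y))))).
by move=> -[x' y'] [/= Ux' _]; rewrite iter_dir_derive_dterms//; exact: leq_rS.
Qed.

Lemma nth_map_mask (T : Type) (x0 : T) j (m : bitseq) (g : 'I_j -> T)
    (l : 'I_(size (mask m (enum 'I_j)))) :
  nth x0 (mask m [seq g i | i <- enum 'I_j]) l =
  g (tnth (in_tuple (mask m (enum 'I_j))) l).
Proof.
have i0 := tnth (in_tuple (mask m (enum 'I_j))) l.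
by rewrite -map_mask (nth_map i0)// (tnth_nth i0).
Qed.

Lemma dterm_val_cvg j t (x : X) (y : lcprod E) (qs : lcprod (fun _ : 'I_j => X * lcprod E)%type) :
  leq_r j -> t \in dterms j -> U x ->
  (forall j, leq_r j -> forall x (us : lcprod (fun _ : 'I_j => X)) (w : lcprod E), U x ->
    (fun p : (X * lcprod (fun _ : 'I_j => X)) * lcprod E => ev (dn f p.1) p.2)
      @ ((x, us), w) --> ev (dn f (x, us)) w) ->
  (fun p : (X * lcprod E) * lcprod (fun _ : 'I_j => X * lcprod E)%type =>
    dterm_val [seq p.2 i | i <- enum 'I_j] t p.1) @ ((x, y), qs) -->
  dterm_val [seq qs i | i <- enum 'I_j] t (x, y).
Proof.
case: t => m d lj /dterms_wf[/= mj dj] Ux Phi.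
pose n := size (mask m (enum 'I_j)).
(* The mask selects n directions, n at most j; the term becomes [ev] of the n-th derivative of [f],
   and [Phi] applies at order n. *)
pose us (qs : lcprod (fun _ : 'I_j => X * lcprod E)%type) : lcprod (fun _ : 'I_n => X) :=
  fun l => (qs (tnth (in_tuple (mask m (enum 'I_j))) l)).1.
have valE p (ys : lcprod (fun _ : 'I_j => X * lcprod E)%type) :
    dterm_val [seq ys i | i <- enum 'I_j] (m, d) p =
    ev (dn f (p.1, us ys)) (slots d [seq ys i | i <- enum 'I_j] p.2).
  rewrite /dterm_val /=; congr ev; rewrite /dn /= -map_comp; congr iter_dir_derive.
  rewrite -[LHS](@map_nth_enum_ord _ 0 _ n); last by rewrite -map_mask size_map.
  by apply: eq_map => l; rewrite nth_map_mask.
rewrite valE.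
apply: (cvg_eqfun (f := fun p : (X * lcprod E) * lcprod (fun _ : 'I_j => X * lcprod E)%type =>
  ev (dn f (p.1.1, us p.2)) (slots d [seq p.2 i | i <- enum 'I_j] p.1.2))).
  by move=> p; rewrite valE.
have ln : leq_r n.
  apply: (leq_r_le leq_rS) lj; rewrite /n size_mask ?size_enum_ord//.
  by apply: leq_trans (count_size _ _) _; rewrite mj.
apply: (cvg_then (h := fun p : (X * lcprod E) * lcprod (fun _ : 'I_j => X * lcprod E)%type =>
  ((p.1.1, us p.2), slots d [seq p.2 i | i <- enum 'I_j] p.1.2)) _ (Phi n ln _ _ _ Ux)).
have c1 : (fun p : (X * lcprod E) * lcprod (fun _ : 'I_j => X * lcprod E)%type => p.1)
  @ ((x, y), qs) --> (x, y) by exact: cvg_fst.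
have c2 : (fun p : (X * lcprod E) * lcprod (fun _ : 'I_j => X * lcprod E)%type => p.2)
  @ ((x, y), qs) --> qs by exact: cvg_snd.
apply: cvg_prod; first apply: cvg_prod; first exact: (cvg_fst_comp c1).
  apply: lcprod_map_cvg => l; apply: (cvg_fst_comp (a := qs _)).
  exact: (cvg_proj c2).
apply: lcprod_map_cvg => i; rewrite /slots; case di: (d i) => [l|]; last first.
  exact: (cvg_proj (cvg_snd_comp c1)).
have nthE (g : lcprod (fun _ : 'I_j => X * lcprod E)%type) :
    nth 0 [seq g i | i <- enum 'I_j] l = g (Ordinal (dj _ _ di)).
  rewrite (nth_map (Ordinal (dj _ _ di))) ?size_enum_ord ?(dj _ _ di)//.
  by congr (g _); rewrite -[X in nth _ _ X]/(val (Ordinal (dj _ _ di))) nth_ord_enum.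
rewrite nthE; apply: cvg_eqfun (cvg_proj (i := i) (cvg_snd_comp
  (cvg_proj (i := Ordinal (dj _ _ di)) c2))) => p.
by rewrite nthE.
Qed.

(** Existence of the derivatives follows from the finite sums alone. Their continuity is reduced to
    that of [ev (dn f p.1) p.2] in all variables, the task left to the exponential laws. *)
Theorem evaluation_C_upto : leq_r 0 ->
  (forall j, leq_r j -> forall x (us : lcprod (fun _ : 'I_j => X)) (w : lcprod E), U x ->
    (fun p : (X * lcprod (fun _ : 'I_j => X)) * lcprod E => ev (dn f p.1) p.2)
      @ ((x, us), w) --> ev (dn f (x, us)) w) ->
  C_upto leq_r (U `*` setT) fv.
Proof.
move=> leq0 Phi; have oUT := open_setXT (T := lcprod E) oU; split.
  apply/within_openP => // -[x y] [/= Ux _].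
  pose z : lcprod (fun _ : 'I_0 => X) := 0.
  have dn0 x' : dn f (x', z) = f x'.
    by rewrite /dn (_ : enum 'I_0 = [::])//; apply/nilP; rewrite /nilp size_enum_ord.
  rewrite -dn0; apply: (cvg_eqfun (f := fun p : X * lcprod E => ev (dn f (p.1, z)) p.2)).
    by move=> p; rewrite dn0.
  apply: (cvg_then (h := fun p : X * lcprod E => ((p.1, z), p.2)) _ (Phi 0%N leq0 x z y Ux)).
  apply: cvg_prod; last exact: cvg_snd.
  by apply: cvg_prod; [exact: cvg_fst|exact: cvg_cst].
move=> j lj; split.
  move=> [x y] qs q [/= Ux _] sq.
  exists (\sum_(t <- dterms (size qs)) \sum_(t' <- dterm_next (size qs) t)
      dterm_val (rcons qs q) t' (x, y)).
  by apply: iter_dir_derive_diff_dterms => //; rewrite sq.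
apply/within_openP; first exact: open_setXT.
move=> [[x y] qs] [[/= Ux _] _].
pose S (p : (X * lcprod E) * lcprod (fun _ : 'I_j.+1 => X * lcprod E)%type) :=
  \sum_(t <- dterms j.+1) dterm_val [seq p.2 i | i <- enum 'I_j.+1] t p.1.
have sz (p : lcprod (fun _ : 'I_j.+1 => X * lcprod E)%type) :
  size [seq p i | i <- enum 'I_j.+1] = j.+1 by rewrite size_map size_enum_ord.
have SE p : U p.1.1 -> dn fv p = S p.
  case: p => -[x' y'] qs' /= Ux'; rewrite /dn iter_dir_derive_dterms ?sz//.
rewrite SE//.
have Sc : S @ ((x, y), qs) --> S ((x, y), qs).
  by apply: tvs_cvg_sum_seq => t tj; exact: dterm_val_cvg.
apply: cvg_trans Sc; apply: near_eq_cvg.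
apply: (filterS _ (open_nbhs_nbhs (conj (open_setXT (T :=
  lcprod (fun _ : 'I_j.+1 => X * lcprod E)%type) oUT)
    (conj (conj Ux I) I : ((U `*` setT) `*` setT) ((x, y), qs))))).
by move=> p [[Up _] _]; rewrite SE.
Qed.

End derivative_terms.
End evaluation.

(** * The exponential law and its consequences *)

(** Quantified over all [O] and [g], because it is applied to derivatives of [f], to the homogeneous
    terms of its expansions and to the components of its complex extension. *)
Definition exp_law (Z M G F : topologicalType) (ev : M -> G -> F) : Prop :=
  forall (O : set Z) (g : Z -> M), open O -> (forall z, O z -> g @ z --> g z) ->
  forall z y, O z -> (fun p : Z * G => ev (g p.1) p.2) @ (z, y) --> ev (g z) y.

Section exp_law_C_upto.
Context {R : realType} {Kg : ground}.
Local Notation K := (fld R Kg).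
Context {k : nat} {X M F : tvsType K} {E : 'I_k -> tvsType K}.
Variable ev : M -> lcprod E -> F.
Hypothesis ev_linear : forall y, linear (ev^~ y).
Hypothesis ev_multilinear : forall m, multilinear (ev m).
Hypothesis ev_continuous : forall y, continuous (ev^~ y).
Variables (leq_r : nat -> Prop) (U : set X) (f : X -> M).
Hypothesis hM : hausdorff_space M.
Hypothesis hF : hausdorff_space F.
Hypothesis oU : open U.
Hypothesis leq_rS : forall j, leq_r j.+1 -> leq_r j.
Hypothesis leq0 : leq_r 0.
Hypothesis fC : C_upto leq_r U f.

Lemma dn0E (x : X) (us : lcprod (fun _ : 'I_0 => X)) : dn f (x, us) = f x.
Proof. by rewrite /dn (_ : enum 'I_0 = [::])//; apply/nilP; rewrite /nilp size_enum_ord. Qed.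

Lemma exp_law_dn0 : exp_law X ev ->
  forall x (us : lcprod (fun _ : 'I_0 => X)) (w : lcprod E), U x ->
    (fun p : (X * lcprod (fun _ : 'I_0 => X)) * lcprod E => ev (dn f p.1) p.2)
      @ ((x, us), w) --> ev (dn f (x, us)) w.
Proof.
move=> eX x us w Ux; rewrite dn0E.
have fc x' : U x' -> f @ x' --> f x' by move=> Ux'; case: fC => /(within_openP f oU) + _; apply.
apply: (cvg_eqfun (f := fun p : (X * lcprod (fun _ : 'I_0 => X)) * lcprod E =>
  ev (f p.1.1) p.2)) => [[[x' us'] w']|]; first by rewrite /= dn0E.
apply: (cvg_then (h := fun p : (X * lcprod (fun _ : 'I_0 => X)) * lcprod E => (p.1.1, p.2))
  _ (eX U f oU fc x w Ux)).
apply: cvg_prod; last exact: cvg_snd.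
by apply: (@cvg_fst_comp _ _ _ _ _ fst (x, us)); exact: cvg_fst.
Qed.

Lemma exp_law_dn : exp_law (X * X)%type ev ->
  forall j, leq_r j -> forall x (us : lcprod (fun _ : 'I_j => X)) (w : lcprod E), U x ->
    (fun p : (X * lcprod (fun _ : 'I_j => X)) * lcprod E => ev (dn f p.1) p.2)
      @ ((x, us), w) --> ev (dn f (x, us)) w.
Proof.
move=> eXX j lj x us w Ux.
pose T := ((X * lcprod (fun _ : 'I_j => X)) * lcprod E)%type.
pose c (u : X) : lcprod (fun _ : 'I_j => X) := fun=> u.
have gc (p : X * X) : (U `*` setT) p ->
    (fun p : X * X => dn f (p.1, c p.2)) @ p --> dn f (p.1, c p.2).
  case: p => x' u' [/= Ux' _].
  apply: (cvg_then (h := fun p : X * X => (p.1, c p.2)) _ (dn_cvg oU fC (y := c u') lj Ux')).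
  apply: cvg_prod; first exact: cvg_fst.
  by apply: lcprod_map_cvg => i; exact: cvg_snd.
pose Q (p : T) := (j`!)%:R^-1 *: \sum_(S : {set 'I_j}) (-1) ^+ #|~: S| *:
  ev (dn f (p.1.1, c (\sum_(i in S) p.1.2 i))) p.2.
have QE (p : T) : U p.1.1 -> ev (dn f p.1) p.2 = Q p.
  case: p => -[x' us'] w' /= Ux'.
  rewrite (dn_polarization hM oU leq_rS fC us' lj Ux') (evZ ev_linear) (ev_sum ev_linear).
  by congr (_ *: _); apply: eq_bigr => S _; rewrite (evZ ev_linear).
have Qc : Q @ ((x, us), w) --> Q ((x, us), w).
  apply: tvs_cvgZr; apply: tvs_cvg_sum => S _; apply: tvs_cvgZr.
  have h := eXX _ _ (open_setXT (T := X) oU) gc (x, \sum_(i in S) us i) w (conj Ux I).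
  apply: (cvg_then (h := fun p : T => ((p.1.1, \sum_(i in S) p.1.2 i), p.2)) _ h).
  have c1 : (fun p : T => p.1) @ ((x, us), w) --> (x, us) by exact: cvg_fst.
  apply: cvg_prod; last exact: cvg_snd.
  apply: cvg_prod; first exact: (cvg_fst_comp c1).
  by apply: tvs_cvg_sum => i _; exact: (cvg_proj (cvg_snd_comp c1)).
rewrite (QE ((x, us), w))//; apply: cvg_trans Qc; apply: near_eq_cvg.
have oW := open_setXT (T := lcprod E) (open_setXT (T := lcprod (fun _ : 'I_j => X)) oU).
apply: (filterS _ (open_nbhs_nbhs (conj oW
  (conj (conj Ux I) I : ((U `*` setT) `*` setT) ((x, us), w))))).
by move=> p [[Up _] _]; rewrite QE.
Qed.

Theorem exp_law_C_upto : exp_law (X * X)%type ev ->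
  C_upto leq_r (U `*` setT) (fun p : X * lcprod E => ev (f p.1) p.2).
Proof.
move=> eXX.
apply: (evaluation_C_upto ev_linear ev_multilinear ev_continuous hF oU leq_rS fC leq0).
exact: exp_law_dn.
Qed.

Theorem exp_law_C0 : exp_law X ev -> (forall j, leq_r j -> j = 0%N) ->
  C_upto leq_r (U `*` setT) (fun p : X * lcprod E => ev (f p.1) p.2).
Proof.
move=> eX l0.
apply: (evaluation_C_upto ev_linear ev_multilinear ev_continuous hF oU leq_rS fC leq0).
move=> j /l0 ->.
exact: exp_law_dn0.
Qed.

End exp_law_C_upto.

(** * Cauchy estimate *)

(** The tube lemma, source of the uniform estimates over discs, annuli and compact parameter
    sets. *)
Lemma compact_nbhs_prod (S T : topologicalType) (t0 : T) (A : set S) (P : set (T * S)) :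
  compact A -> (forall z, A z -> nbhs (t0, z) P) ->
  \forall t \near t0, forall z, A z -> P (t, z).
Proof.
move=> /compact_near_coveringP cA AP.
have h z : A z -> \forall z' \near z & t \near t0, P (t, z').
  move=> /AP[[/= Q1 Q2] [q1 q2] Q12]; exists (Q2, Q1) => //= -[z' t] /= [].
  by move=> Q2z Q1t; apply: (Q12 (t, z')).
exact: (cA T (nbhs t0) (fun t z => P (t, z)) (nbhs_filter t0) h).
Qed.

Section unit_disc.
Context {R : realType}.

Lemma unit_interval_compact : compact ([set c : R | `|c| <= 1] : set R^o).
Proof.
rewrite (_ : [set _ | _] = `[(-1 : R), 1]%classic); first exact: segment_compact.
by apply/seteqP; split=> c /=; rewrite in_itv /= ler_norml.
Qed.

Lemma unit_disc_compact (Kg : ground) :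
  compact ([set c : fld R Kg | `|c| <= 1] : set (fld R Kg)^o).
Proof.
case: Kg; first exact: unit_interval_compact.
pose S := [set c : R | `|c| <= 1].
pose CC := (fld R Complexes)^o.
pose h (p : R^o * R^o) : CC := (p.1 +i* p.2)%C.
have hc : continuous h.
  pose rc : R^o -> CC := real_complex R.
  have rcc : continuous rc.
    exact: (@emb_continuous R Reals Complexes (SubReals Complexes)).
  have hE p : h p = rc p.1 + ('i%C : R[i]) *: rc p.2 by rewrite /h [LHS]complexE.
  move=> p; rewrite /continuous_at hE; apply: (cvg_eqfun (fun p => esym (hE p))).
  apply: (@tvs_cvgD _ _ _ _ CC); first exact: (cvg_then cvg_fst (rcc p.1)).
  by apply: (@tvs_cvgZr _ _ _ _ CC); exact: (cvg_then cvg_snd (rcc p.2)).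
have cS : compact (h @` ((S : set R^o) `*` (S : set R^o))).
  apply: continuous_compact; first exact: continuous_subspaceT.
  by apply: compact_setX; exact: unit_interval_compact.
apply: (subclosed_compact _ cS); last first.
  move=> [a b] /= c1; exists (a, b) => //; split => /=.
    have := le_trans (normc_ge_Re (a +i* b)%C) c1.
    by rewrite -(rmorph1 (real_complex R)) lecR.
  have h1 : (`|b|%:C%C : R[i]) <= `|(a +i* b)%C|.
    by rewrite normc_def lecR/= -sqrtr_sqr ler_wsqrtr// lerDr sqr_ge0.
  have := le_trans h1 c1.
  by rewrite -(rmorph1 (real_complex R)) lecR.
rewrite -[X in closed X]setCK; apply: open_closedC.
rewrite openE => z /= /negP; rewrite -real_ltNge ?normr_real ?real1// => z1.
apply/(@nbhs_ballP _ CC); exists (`|z : R[i]| - 1); first by rewrite /= subr_gt0.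
move=> y; rewrite -ball_normE /= => zy; apply/negP.
rewrite -real_ltNge ?normr_real ?real1//.
have := lerB_dist (z : R[i]) ((z : R[i]) - y); rewrite subKr.
by apply: lt_le_trans; rewrite ltrBrDr -ltrBrDl.
Qed.

End unit_disc.

(** * Roots of unity close to 1 *)

Section roots_of_unity.
Context {R : realType}.

(** Take the square root s of w that is closer to 1. As |s - 1|^2 + |s + 1|^2 = 4, it has |s + 1|^2
    >= 2, and w - 1 = (s - 1)(s + 1) yields the factor 1/2. *)
Lemma unit_sqrt_near1 (w : R[i]) : `|w| = 1 -> w != 1 -> exists s : R[i],
  [/\ s ^+ 2 = w, `|s| = 1, s != 1 & `|s - 1| ^+ 2 <= `|w - 1| ^+ 2 / 2].
Proof.
move=> w1 wn1.
have key (s : R[i]) : s ^+ 2 = w -> `|s - 1| <= `|s + 1| ->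
    [/\ s ^+ 2 = w, `|s| = 1, s != 1 & `|s - 1| ^+ 2 <= `|w - 1| ^+ 2 / 2].
  move=> sw ss; have s1 : `|s| = 1.
    by apply/eqP; rewrite -(@eqrXn2 _ 2)// ?expr1n -?normrX ?sw ?w1.
  split=> //; first by apply: contra_neq wn1 => se; rewrite -sw se expr1n.
  have par : `|s - 1| ^+ 2 + `|s + 1| ^+ 2 = 4.
    have ssC : s * s^* = 1 by rewrite -normCK s1 expr1n.
    rewrite !normCK rmorphB rmorphD rmorph1 /=.
    rewrite (_ : 4 = (s * s^* + 1) *+ 2); first by ring.
    by rewrite ssC; ring.
  have s2 : 2 <= `|s + 1| ^+ 2.
    have h : `|s - 1| ^+ 2 <= `|s + 1| ^+ 2 by rewrite lerXn2r ?nnegrE.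
    have : 2 * 2 <= 2 * `|s + 1| ^+ 2.
      by rewrite -natrM (_ : (2 * 2)%:R = 4)// -par mulr_natl mulr2n lerD2r.
    by rewrite ler_pM2l.
  rewrite -sw (_ : s ^+ 2 - 1 = (s - 1) * (s + 1)); last by ring.
  rewrite normrM exprMn ler_pdivlMr// ler_wpM2l// exprn_ge0//.
have sw : sqrtC w ^+ 2 = w by rewrite sqrtCK.
have [h|h] := real_leP (normr_real (sqrtC w - 1)) (normr_real (sqrtC w + 1)).
  by exists (sqrtC w); exact: key.
exists (- sqrtC w); apply: key; first by rewrite sqrrN.
have -> : - sqrtC w - 1 = - (sqrtC w + 1) by rewrite opprD.
have -> : - sqrtC w + 1 = - (sqrtC w - 1) by rewrite opprB addrC.
by rewrite !normrN ltW.
Qed.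

(* iterated square roots of -1; this avoids trigonometry *)
Lemma root_of_unity_near1 (e : R[i]) : 0 < e ->
  exists (N : nat) (w : R[i]), [/\ (0 < N)%N, w ^+ N = 1, `|w| = 1, w != 1 & `|w - 1| < e].
Proof.
move=> e0.
(* The start w = -1 has |w - 1|^2 = 4; each square root at least halves this quantity and doubles
   the exponent. *)
have seq (n : nat) : exists w : R[i],
    [/\ w ^+ (2 ^ n.+1) = 1, `|w| = 1, w != 1 & `|w - 1| ^+ 2 <= 4 / (2 ^+ n)].
  elim: n => [|n [w [wN w1 wn1 wle]]].
    exists (-1); rewrite expn1 sqrrN expr1n normrN normr1; split=> //.
      by rewrite eq_sym -subr_eq0 opprK (_ : 1 + 1 = 2%:R)// pnatr_eq0.
    rewrite -opprD normrN expr0 divr1 (_ : 1 + 1 = 2%:R :> R[i])// normr_nat.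
    by rewrite -natrX.
  have [s [sw s1 sn1 sle]] := unit_sqrt_near1 w1 wn1; exists s; split=> //.
    by rewrite expnS exprM sw.
  apply: le_trans sle _; rewrite (exprSr 2 n) invfM mulrA ler_wpM2r// invr_ge0//.
have [d d0 de] := @emb_small R Reals Complexes (SubReals Complexes) e e0.
pose n := Num.bound (4 / d ^+ 2).
have [w [wN w1 wn1 wle]] := seq n; exists (2 ^ n.+1)%N, w; split=> //.
  by rewrite expn_gt0.
rewrite -(@ltr_pXn2r _ 2)// ?nnegrE ?(ltW e0)//.
apply: le_lt_trans wle _; rewrite -de.
have -> : (emb (SubReals Complexes) d ^+ 2 : R[i]) = (d ^+ 2)%:C%C.
  by rewrite rmorphXn.
have -> : 4 / 2 ^+ n = (4 / 2 ^+ n)%:C%C :> R[i].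
  by rewrite fmorph_div rmorphXn /= !rmorph_nat.
rewrite ltcR ltr_pdivrMr ?exprn_gt0// mulrC -ltr_pdivrMr ?exprn_gt0//.
apply: lt_trans (archi_boundP _) _; first by rewrite divr_ge0// exprn_ge0// ltW.
by rewrite -/n -natrX ltr_nat ltn_expl.
Qed.

End roots_of_unity.

(** * A discrete Cauchy estimate *)

Section cauchy.
Context {R : realType} {F : tvsType (fld R Complexes)}.
Local Notation C := (fld R Complexes).

Lemma absconvex_average (W : set F) (n : nat) (c : 'I_n -> C) (x : 'I_n -> F) :
  absolutely_convex W -> W 0 -> (0 < n)%N -> (forall j, `|c j| <= 1) ->
  (forall j, W (x j)) -> W (n%:R^-1 *: \sum_(j < n) c j *: x j).
Proof.
move=> cW W0 n0 c1 Wx; rewrite scaler_sumr; under eq_bigr do rewrite scalerA.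
apply: absconvex_sum => //; have n0' : 0 < n%:R :> C by rewrite ltr0n.
apply: (@le_trans _ _ (\sum_(j < n) n%:R^-1)).
  apply: ler_sum => j _; rewrite normrM normfV normr_nat -[leRHS]mulr1.
  by rewrite ler_wpM2l// invr_ge0 ltW.
by rewrite sumr_const card_ord -[X in X <= _]mulr_natl divff// gt_eqF.
Qed.

(** The chord from 1 to w stays in the closed disc by convexity and, as |w - 1| < 1, avoids 0, where
    the quotient [q] of the estimate is singular. *)
Lemma unit_chord (t : R) (w : C) : 0 <= t <= 1 -> `|w| = 1 -> `|w - 1| < 1 ->
  1 + (rho t : C) * (w - 1) != 0 /\ `|1 + (rho t : C) * (w - 1)| <= 1.
Proof.
move=> t01 w1 wd; split.
  apply: contraTneq wd => /eqP; rewrite addrC addr_eq0 => /eqP tw.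
  have : `|(rho t : C) * (w - 1)| = 1 by rewrite tw normrN normr1.
  rewrite normrM => tw1; rewrite -real_leNgt ?normr_real ?real1//.
  by rewrite -[leLHS]tw1 -[leRHS]mul1r ler_wpM2r// rho_unit_norm.
have -> : 1 + (rho t : C) * (w - 1) = (rho (1 - t) : C) + (rho t : C) * w.
  have := rhoD (Kg := Complexes) (1 - t) t; rewrite subrK rho1 => ->; ring.
apply: le_trans (ler_normD _ _) _; rewrite normrM w1 mulr1 !rho_norm -rhoD -rho1 rho_le.
by case/andP: t01 => t0 t1; rewrite !ger0_norm ?subr_ge0// subrK.
Qed.

Section estimate.
Variables (h h' : C^o -> F) (W : set F).
Hypothesis cW : absolutely_convex W.
Hypothesis W0 : nbhs 0 W.
Hypothesis hd : forall z : C^o, `|z : C| <= 1 ->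
  diff_quotient h z (1 : C^o) t @[t --> 0^'] --> h' z.
Hypothesis hc : forall z : C^o, `|z : C| <= 1 -> h @ z --> h z.
Hypothesis h'c : forall z : C^o, `|z : C| <= 1 -> h' @ z --> h' z.
Hypothesis h0 : h 0 = 0.
Hypothesis hW : forall z : C^o, `|z : C| <= 1 -> W (h z).

(** Cauchy's formula presents [h' 0] as the mean of h(z) / z over a circle around 0; [q] is this
    integrand and [q'] its derivative by the quotient rule. As [h 0 = 0], [q] tends to [h' 0] at
    0. *)
Let q (z : C^o) : F := (z : C)^-1 *: h z.
Let q' (z : C^o) : F := (z : C)^-1 *: h' z - ((z : C)^-1 * (z : C)^-1) *: h z.

Let inv_cvg (z : C) : z != 0 -> (fun t : C^o => t^-1 : C^o) @ (z : C^o) --> (z^-1 : C^o).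
Proof. exact: (@inv_continuous C z). Qed.

Let line_cvg (z : C^o) : z + t *: (1 : C^o) @[t --> (0 : C)^'] --> z.
Proof.
rewrite -[X in _ --> X]addr0; apply: tvs_cvgD; first exact: cvg_cst.
exact: (cvg_dnbhs0Z (@cvg_cst _ (1 : C^o) _ _ _)).
Qed.

Let q_diff (z : C^o) : z != 0 -> `|z : C| <= 1 ->
  diff_quotient q z (1 : C^o) t @[t --> 0^'] --> q' z.
Proof.
move=> z0 z1.
have iz : (z + t *: (1 : C^o))^-1 @[t --> (0 : C)^'] --> ((z : C)^-1 : C^o).
  exact: (cvg_then (line_cvg (z := z)) (inv_cvg z0)).
have l1 : (z + t *: (1 : C^o))^-1 *: diff_quotient h z (1 : C^o) t @[t --> (0 : C)^'] -->
    (z : C)^-1 *: h' z by apply: tvs_cvgZ iz (hd z1).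
have l2 : ((z : C)^-1 * (z + t *: (1 : C^o))^-1) *: h z @[t --> (0 : C)^'] -->
    ((z : C)^-1 * (z : C)^-1) *: h z.
  apply: tvs_cvgZ; last exact: cvg_cst.
  exact: (@tvs_cvgZr _ _ _ _ C^o (z : C)^-1 _ _ iz).
have l : ((z + t *: (1 : C^o))^-1 *: diff_quotient h z (1 : C^o) t -
    ((z : C)^-1 * (z + t *: (1 : C^o))^-1) *: h z) @[t --> (0 : C)^'] --> q' z.
  exact: tvs_cvgB l1 l2.
apply: cvg_trans l; apply: near_eq_cvg; apply/near_dnbhs0; exists `|z : C|.
  by rewrite normr_gt0.
move=> t /andP[t0 tz]; have {}t0 : t != 0 by rewrite -normr_gt0.
have zt : (z : C) + t != 0.
  by apply: contraTneq tz => /eqP; rewrite addrC addr_eq0 => /eqP ->; rewrite normrN ltxx.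
rewrite /diff_quotient /q -[t *: (1 : C^o)]/(t * 1) mulr1.
rewrite !scalerBr !scalerA -addrA -opprD -scalerDl; congr (_ *: _ - _ *: _).
  by rewrite mulrC.
by field; rewrite zt t0 z0.
Qed.

Let q_diff_dir (z y : C^o) : z != 0 -> `|z : C| <= 1 -> (y : C) != 0 ->
  diff_quotient (fun z => (y : C)^-1 *: q z) z y t @[t --> 0^'] --> q' z.
Proof.
move=> z0 z1 y0; have qy := diff_quotient_rescale y0 (q_diff z0 z1).
have y1 : (y : C) *: (1 : C^o) = y := mulr1 (y : C).
by rewrite y1 in qy.
Qed.

Let q'_cvg (z : C^o) : z != 0 -> `|z : C| <= 1 -> q' @ z --> q' z.
Proof.
move=> z0 z1.
have i2 : (fun t : C^o => (t : C)^-1 * (t : C)^-1 : C^o) @ z -->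
    ((z : C)^-1 * (z : C)^-1 : C^o).
  exact: (@tvs_cvgZ _ _ _ _ C^o (fun t => t^-1) (fun t => t^-1) _ _ (inv_cvg z0) (inv_cvg z0)).
exact: (tvs_cvgB (tvs_cvgZ (inv_cvg z0) (h'c z1)) (tvs_cvgZ i2 (hc z1))).
Qed.

(** Uniform continuity on a compact annulus, in multiplicative form because the points of a chord
    starting at z are z (1 + t (w - 1)). *)
Let q'_unif (e : C) (V : set F) : 0 < e -> nbhs 0 V ->
  exists2 d : C, 0 < d & forall z t : C, e <= `|z| <= 1 -> `|t| < d ->
    V (q' (z * (1 + t)) - q' z).
Proof.
move=> e0 V0; pose A := [set z : C^o | e <= `|z : C| <= 1].
have cA : compact A.
  apply: (subclosed_compact _ (@unit_disc_compact R Complexes)); last by move=> z /andP[].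
  rewrite (_ : A = [set z : C^o | e <= `|z : C|] `&` [set z : C^o | `|z : C| <= 1]); last first.
    by apply/seteqP; split=> z /=; [move/andP|move=> [? ?]; apply/andP].
  apply: closedI; last first.
    exact: compact_closed (@norm_hausdorff _ C^o) (@unit_disc_compact R Complexes).
  rewrite -[X in closed X]setCK; apply: open_closedC.
  rewrite openE => z /= /negP; rewrite -real_ltNge ?normr_real ?gtr0_real// => ze.
  apply/(@nbhs_ballP _ C^o); exists (e - `|z : C|); first by rewrite /= subr_gt0.
  move=> y; rewrite -ball_normE /= => zy; apply/negP.
  rewrite -real_ltNge ?normr_real ?gtr0_real//.
  rewrite -(subrK (z : C) y); apply: le_lt_trans (ler_normD _ _) _.
  by rewrite -ltrBrDr distrC.
have key (z : C^o) : A z -> nbhs ((0 : C^o), z)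
    [set p : C^o * C^o | V (q' ((p.2 : C) * (1 + p.1)) - q' p.2)].
  move=> /andP[ez z1]; have z0 : z != 0 by rewrite -normr_gt0 (lt_le_trans e0 ez).
  have c2 : (fun p : C^o * C^o => q' p.2) @ ((0 : C^o), z) --> q' z.
    by apply: (cvg_then (h := fun p : C^o * C^o => p.2) _ (q'_cvg z0 z1)); exact: cvg_snd.
  have c1 : (fun p : C^o * C^o => q' ((p.2 : C) * (1 + p.1))) @ ((0 : C^o), z) --> q' z.
    apply: (cvg_then (h := fun p : C^o * C^o => (p.2 : C) * (1 + p.1) : C^o) _ (q'_cvg z0 z1)).
    have h1 : (fun p : C^o * C^o => (1 + p.1 : C^o)) @ ((0 : C^o), z) --> (1 + 0 : C^o).
      by apply: tvs_cvgD; [exact: cvg_cst|exact: cvg_fst].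
    have h2 : (fun p : C^o * C^o => (p.2 : C^o)) @ ((0 : C^o), z) --> z by exact: cvg_snd.
    have h3 : (fun p : C^o * C^o => (p.2 : C) * (1 + p.1) : C^o) @ ((0 : C^o), z)
      --> ((z : C) * (1 + 0) : C^o) by exact: (@tvs_cvgZ _ _ _ _ C^o _ _ _ _ h2 h1).
    by rewrite addr0 mulr1 in h3.
  have c3 : (fun p : C^o * C^o => q' ((p.2 : C) * (1 + p.1)) - q' p.2) @ ((0 : C^o), z)
    --> q' z - q' z by exact: tvs_cvgB c1 c2.
  by rewrite subrr in c3; exact: (c3 _ V0).
have /(@nbhs_ballP _ C^o)[d /= d0 dA] := compact_nbhs_prod cA key.
exists d => // z t zA td; apply: (dA t _ z zA).
by rewrite -ball_normE /= sub0r normrN.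
Qed.

(* A discrete Cauchy integral.  Let [A z] be the average of [q (z * w ^+ j)],
   j < N, over the powers of an N-th root of unity [w] close to 1.  Each
   [q' (z * w ^+ j)] is close to a difference quotient along the chord from
   [z * w ^+ j] to [z * w ^+ j.+1]; the increments of [q] telescope to 0, so the
   derivative of [A] is small on the annulus [eps <= `|z| <= 1].  Hence [A 1],
   which lies in [W], is close to [A eps], which is close to [h' 0]. *)
Lemma cauchy_estimate : exists a b c, [/\ W a, W b, W c & h' 0 = a + b + c].
Proof.
have [V [V0 cV VW]] := absconvex_half W0.
have [V1 [V10 cV1 V1V]] := absconvex_half V0.
have [e e0 he] : exists2 e : C, 0 < e & forall z : C^o, 0 < `|z : C| < e -> W (q z - h' 0).
  have /near_dnbhs0[e e0 he] : \forall t \near (0 : C)^', W (diff_quotient h 0 (1 : C^o) t - h' 0).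
    have := hd (z := 0); rewrite normr0 => /(_ ler01) hd0.
    exact: (hd0 _ (nbhs_sub (h' 0) W0)).
  exists e => // z /he; rewrite /diff_quotient h0 subr0 add0r.
  by rewrite -[z *: _]/(z * 1) mulr1.
have e1 : 0 < 1 + e by rewrite addr_gt0.
(* Below both [e] and 1; the bound [d / (1 + d)] for the root of unity is formed in the same way. *)
pose eps := e / (1 + e).
have eps0 : 0 < eps by rewrite divr_gt0.
have eps_e : eps < e by rewrite ltr_pdivrMr// ltr_pMr// ltrDl.
have eps1 : eps < 1 by rewrite ltr_pdivrMr// mul1r ltrDr.
have [d d0 q'V1] := q'_unif eps0 V10.
have d1 : 0 < 1 + d by rewrite addr_gt0.
have [N [w [N0 wN w1 wn1 wd]]] : exists (N : nat) (w : C),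
    [/\ (0 < N)%N, w ^+ N = 1, `|w| = 1, w != 1 & `|w - 1| < d / (1 + d)].
  exact: root_of_unity_near1 (divr_gt0 d0 d1).
have wd1 : `|w - 1| < 1 by apply: lt_trans wd _; rewrite ltr_pdivrMr// mul1r ltrDr.
have wdd : `|w - 1| < d by apply: lt_trans wd _; rewrite ltr_pdivrMr// ltr_pMr// ltrDl.
have wj j : `|w ^+ j| = 1 by rewrite normrX w1 expr1n.
have wj0 j : w ^+ j != 0 by rewrite -normr_eq0 wj oner_eq0.
pose A (z : C^o) : F := N%:R^-1 *: \sum_(j < N) q ((z : C) * w ^+ j).
pose A' (z : C^o) : F := N%:R^-1 *: \sum_(j < N) w ^+ j *: q' ((z : C) * w ^+ j).
have znorm (z : C) j : `|z * w ^+ j| = `|z| by rewrite normrM wj mulr1.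
have A_diff (z : C^o) : z != 0 -> `|z : C| <= 1 ->
    diff_quotient A z (1 : C^o) t @[t --> 0^'] --> A' z.
  move=> z0 z1.
  have l : (fun t => N%:R^-1 *: \sum_(j < N)
      diff_quotient q ((z : C) * w ^+ j) (w ^+ j *: (1 : C^o)) t) @ 0^' --> A' z.
    apply: tvs_cvgZr; apply: tvs_cvg_sum => j _; apply: diff_quotientZ.
    by apply: q_diff; rewrite ?znorm// mulf_neq0.
  apply: cvg_eqfun l => t; rewrite /diff_quotient /A -scaler_sumr -scalerBr !scalerA.
  rewrite mulrC -sumrB; congr (_ *: _); apply: eq_bigr => j _; congr (q _ - _).
  rewrite -[t *: (w ^+ j *: _)]/(t * (w ^+ j * 1)) -[t *: (1 : C^o)]/(t * 1) !mulr1.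
  by rewrite [RHS]mulrDl.
have A'V (z : C) : eps <= `|z| <= 1 -> V (A' z).
  move=> zA; have z0 : z != 0.
    by rewrite -normr_gt0; case/andP: zA => + _; exact: lt_le_trans.
  have wz0 : z * (w - 1) != 0 by rewrite mulf_neq0// subr_eq0.
  pose err j : F := (z * w ^+ j * (w - 1))^-1 *:
    (q (z * w ^+ j.+1) - q (z * w ^+ j)) - q' (z * w ^+ j).
  have errV j : V (err j).
    pose zj := z * w ^+ j; pose y := zj * (w - 1).
    have zj0 : zj != 0 by rewrite mulf_neq0.
    have y0 : y != 0 by rewrite mulf_neq0// subr_eq0.
    have zy : zj + y = z * w ^+ j.+1 by rewrite /y /zj exprSr; ring.
    have pt (t : R) : zj + (rho t : C) * y = zj * (1 + (rho t : C) * (w - 1)).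
      by rewrite /y; ring.
    rewrite /err -/zj -/y -zy scalerBr.
    apply: (@mean_value_dir R Complexes C^o F (fun z => y^-1 *: q z) q' zj y
      (q' zj) V V1) => // t t01.
      have zE : zj + rho t *: (y : C^o) = zj * (1 + (rho t : C) * (w - 1)) := pt t.
      rewrite zE; have [c0 c1] := unit_chord t01 w1 wd1.
      apply: q_diff_dir => //; first by rewrite mulf_neq0.
      rewrite normrM /zj znorm -[leRHS]mulr1 ler_pM//.
      by case/andP: zA.
    rewrite -[zj + _]/(zj + (rho t : C) * y) pt; apply: q'V1; first by rewrite /zj znorm.
    apply: le_lt_trans wdd; rewrite normrM -[leRHS]mul1r ler_wpM2r//.
    exact: rho_unit_norm.
  have sum0 : \sum_(j < N) w ^+ j *: (err j + q' (z * w ^+ j)) = 0.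
    transitivity ((z * (w - 1))^-1 *: \sum_(j < N) (q (z * w ^+ j.+1) - q (z * w ^+ j))).
      rewrite scaler_sumr; apply: eq_bigr => j _; rewrite /err subrK scalerA.
      have w10 : w - 1 != 0 by rewrite subr_eq0.
      by congr (_ *: _); rewrite mulrAC invfM mulrCA divff// mulr1.
    rewrite -(big_mkord predT (fun j => q (z * w ^+ j.+1) - q (z * w ^+ j))).
    by rewrite telescope_sumr// wN expr0 subrr scaler0.
  (* Subtracting the telescoping sum, which is 0 as w^N = 1, leaves an average of errors, each of
     which lies in [V]. *)
  have -> : A' z = N%:R^-1 *: \sum_(j < N) (- w ^+ j) *: err j.
    rewrite /A'; congr (_ *: _); rewrite -[RHS]add0r -[X in _ = X + _]sum0. rewrite -big_split /=.
    by apply: eq_bigr => j _; rewrite (scalerDr _ (err j)) scaleNr [RHS]addrC addKr.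
  apply: absconvex_average => //; first exact: nbhs_singleton.
  by move=> j; rewrite normrN wj.
have h1 : W (A 1 - A eps).
  (* On the real segment from [eps] to 1 the argument stays in the annulus, where [A'] takes values
     in [V]. *)
  have := @mean_value_dir R Complexes C^o F A (fun z => (1 - eps) *: A' z) eps (1 - eps) 0 W V.
  have pE (t : R) : 0 <= t <= 1 -> eps <= `|eps + (rho t : C) * (1 - eps)| <= 1.
    move=> /andP[t0 t1]; have t0' : 0 <= (rho t : C) by rewrite -rho0 rho_le.
    have t1' : (rho t : C) <= 1 by rewrite -rho1 rho_le.
    have m0 : 0 <= (rho t : C) * (1 - eps) by rewrite mulr_ge0// subr_ge0 ltW.
    rewrite ger0_norm ?addr_ge0 ?(ltW eps0)// lerDl m0 /=.
    rewrite -lerBrDl -[leRHS]mul1r ler_wpM2r// subr_ge0 ltW//.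
  have eE : eps + (1 - eps) = 1 by rewrite addrC subrK.
  rewrite -[(eps : C^o) + _]/(eps + (1 - eps)) eE subr0; apply => // t t01.
    have /andP[p1 p2] := pE t t01.
    have pd := diff_quotientZ (a := 1 - eps) (A_diff (eps + (rho t : C) * (1 - eps)) _ p2).
    have e1E : (1 - eps) *: (1 : C^o) = (1 - eps : C^o) := mulr1 _.
    by rewrite e1E in pd; apply: pd; rewrite -normr_gt0; exact: lt_le_trans p1.
  rewrite subr0; apply: absconvexZ => //; last by apply: A'V; exact: pE.
  by rewrite ger0_norm ?subr_ge0 ?(ltW eps1)// gerBl ltW.
have h2 : W (A eps - h' 0).
  have Nn : N%:R != 0 :> C by rewrite pnatr_eq0 -lt0n.
  have -> : A eps - h' 0 = N%:R^-1 *: \sum_(j < N) 1 *: (q (eps * w ^+ j) - h' 0).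
    under eq_bigr do rewrite scale1r.
    rewrite sumrB scalerBr sumr_const card_ord -(scaler_nat N (h' 0)).
    by rewrite scalerA mulVf// scale1r.
  apply: absconvex_average => //; first exact: nbhs_singleton.
    by move=> j; rewrite normr1.
  by move=> j; apply: he; rewrite znorm gtr0_norm// eps0.
have h3 : W (A 1).
  have -> : A 1 = N%:R^-1 *: \sum_(j < N) (w ^+ j)^-1 *: h (w ^+ j).
    by rewrite /A; congr (_ *: _); apply: eq_bigr => j _; rewrite mul1r.
  apply: absconvex_average => //; first exact: nbhs_singleton.
    by move=> j; rewrite normfV wj invr1.
  by move=> j; apply: hW; rewrite wj.
have WN a : W a -> W (- a).
  by move=> Wa; rewrite -scaleN1r; apply: absconvexZ => //; rewrite normrN normr1.
exists (- (A eps - h' 0)), (- (A 1 - A eps)), (A 1); split; [exact: WN|exact: WN|by []|].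
by rewrite -opprD addrC [A eps - _ + _]addrC subrKA opprB subrKC.
Qed.
End estimate.
End cauchy.

Section cauchy_continuity.
Context {R : realType} {F : tvsType (fld R Complexes)}.
Local Notation C := (fld R Complexes).

(** By compactness [g t - g t0] is uniformly small on the unit disc for t near t0, and the estimate
    makes its derivative at 0 small. In this way joint continuity of [g] passes to [g'] at 0. *)
Lemma cauchy_cvg (T : topologicalType) (g g' : T -> C^o -> F) (t0 : T) :
  (\forall t \near t0, forall z : C^o, `|z : C| <= 1 ->
    [/\ diff_quotient (g t) z (1 : C^o) e @[e --> 0^'] --> g' t z,
        g t @ z --> g t z & g' t @ z --> g' t z]) ->
  (forall z : C^o, `|z : C| <= 1 ->
    (fun p : T * C^o => g p.1 p.2) @ (t0, z) --> g t0 z) ->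
  (fun t => g' t 0) @ t0 --> g' t0 0.
Proof.
move=> gd gc; apply: cvg_absconvexP => V V0 cV.
have [W1 [W10 cW1 W1V]] := absconvex_half V0.
have [W [W0 cW WW1]] := absconvex_half W10.
have [W3 [W30 cW3 W3W]] := absconvex_half W0.
have gd0 := nbhs_singleton gd.
have near_small : \forall t \near t0, forall z : C^o, `|z : C| <= 1 -> W3 (g t z - g t0 z).
  apply: (@compact_nbhs_prod C^o T t0 [set z : C^o | `|z : C| <= 1]
    [set p : T * C^o | W3 (g p.1 p.2 - g t0 p.2)]); first exact: unit_disc_compact.
  move=> z z1; have [_ g0c _] := gd0 z z1.
  have c : (fun p : T * C^o => g p.1 p.2 - g t0 p.2) @ (t0, z) --> g t0 z - g t0 z.
    apply: tvs_cvgB; first exact: gc.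
    by apply: (cvg_then (h := fun p : T * C^o => p.2) _ g0c); exact: cvg_snd.
  by rewrite subrr in c; exact: (c _ W30).
apply: filterS (filterI gd near_small) => t [gt gs].
(* Subtracting the value at 0 provides [h 0 = 0]; the extra term is the reason for passing from [W]
   to [W3]. *)
pose h (z : C^o) := (g t z - g t0 z) - (g t 0 - g t0 0).
pose h' (z : C^o) := g' t z - g' t0 z.
have norm0 : `|0 : C| <= 1 by rewrite normr0 ler01.
have [a [b [c [Wa Wb Wc E0]]]] : exists a b c, [/\ W a, W b, W c & h' 0 = a + b + c].
  apply: (cauchy_estimate (h := h) cW W0).
  - move=> z z1; have [d1 _ _] := gt z z1; have [d2 _ _] := gd0 z z1.
    have d : (fun e => diff_quotient (g t) z (1 : C^o) e -
        diff_quotient (g t0) z (1 : C^o) e) @ (0 : C)^' --> h' z by exact: tvs_cvgB.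
    apply: cvg_eqfun d => e; rewrite /diff_quotient /h -scalerBr; congr (_ *: _).
    have alg (a1 a2 a3 a4 a5 : F) : (a1 - a2) - (a3 - a4) = (a1 - a3 - a5) - (a2 - a4 - a5).
      by rewrite [- (a2 - a4 - a5)]opprB subrKA !opprB addrACA [RHS]addrACA; congr (_ + _); rewrite addrC.
    exact: alg.
  - move=> z z1; have [_ c1 _] := gt z z1; have [_ c2 _] := gd0 z z1.
    exact: (tvs_cvgB (tvs_cvgB c1 c2) (cvg_cst _)).
  - move=> z z1; have [_ _ c1] := gt z z1; have [_ _ c2] := gd0 z z1.
    exact: (tvs_cvgB c1 c2).
  - by rewrite /h subrr.
  - move=> z z1; apply: W3W; first exact: gs.
    rewrite -scaleN1r; apply: absconvexZ => //; last exact: gs.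
    by rewrite normrN normr1.
rewrite -/(h' 0) E0; apply: W1V; first exact: WW1.
by rewrite -[c]addr0; apply: WW1 => //; exact: nbhs_singleton.
Qed.

Context {k : nat} {X M : tvsType C} {E : 'I_k -> tvsType C}.
Variable ev : M -> lcprod E -> F.
Hypothesis ev_linear : forall y, linear (ev^~ y).
Hypothesis ev_multilinear : forall m, multilinear (ev m).
Hypothesis ev_continuous : forall y, continuous (ev^~ y).
Variables (leq_r : nat -> Prop) (U : set X) (f : X -> M).
Hypothesis hF : hausdorff_space F.
Hypothesis oU : open U.
Hypothesis leq_rS : forall j, leq_r j.+1 -> leq_r j.
Hypothesis leq0 : leq_r 0.
Hypothesis fC : C_upto leq_r U f.

Lemma dn_rcons j (x : X) (us : lcprod (fun _ : 'I_j.+1 => X)) :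
  dn f (x, us) = iter_dir_derive f (rcons
    [seq us (widen_ord (leqnSn j) i) | i <- enum 'I_j] (us ord_max)) x.
Proof. by rewrite /dn enum_ordSr map_rcons -map_comp. Qed.

Lemma exp_law_complex_dn : exp_law X ev ->
  forall j, leq_r j -> forall x (us : lcprod (fun _ : 'I_j => X)) (w : lcprod E), U x ->
    (fun p : (X * lcprod (fun _ : 'I_j => X)) * lcprod E => ev (dn f p.1) p.2)
      @ ((x, us), w) --> ev (dn f (x, us)) w.
Proof.
move=> eX; elim=> [|j IH] lj x us w Ux.
  exact: (exp_law_dn0 oU fC eX).
pose T := ((X * lcprod (fun _ : 'I_j.+1 => X)) * lcprod E)%type.
pose t0 : T := ((x, us), w).
pose init (us : lcprod (fun _ : 'I_j.+1 => X)) : lcprod (fun _ : 'I_j => X) :=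
  fun i => us (widen_ord (leqnSn j) i).
have cx : (fun t : T => t.1.1) @ t0 --> x.
  by apply: (@cvg_fst_comp _ _ _ _ _ (fun t : T => t.1) (x, us)); exact: cvg_fst.
have cus : (fun t : T => t.1.2) @ t0 --> us.
  by apply: (@cvg_snd_comp _ _ _ _ _ (fun t : T => t.1) (x, us)); exact: cvg_fst.
have cinit : (fun t : T => init t.1.2) @ t0 --> init us.
  by apply: lcprod_map_cvg => i; exact: (cvg_proj cus).
have cu : (fun t : T => t.1.2 ord_max) @ t0 --> us ord_max by exact: (cvg_proj cus).
(* One scale [s] serves all parameters near [t0]: the discs of all x + s z u with |z| <= 1 stay in
   [U]. *)
have [s s0 sU] : exists2 s : C, s != 0 & \forall t \near t0,
    forall z : C, `|z| <= 1 -> U (t.1.1 + (s * z) *: t.1.2 ord_max).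
  have c : (fun p : C^o * T => p.2.1.1 + (p.1 : C) *: p.2.1.2 ord_max) @ ((0 : C^o), t0)
      --> x + 0 *: us ord_max.
    apply: tvs_cvgD; first exact: (cvg_then cvg_snd cx).
    by apply: tvs_cvgZ; [exact: cvg_fst|exact: (cvg_then cvg_snd cu)].
  rewrite scale0r addr0 in c.
  have [[/= P Q] [P0 Q0] PQ] := c _ (open_nbhs_nbhs (conj oU Ux)).
  move/(@nbhs_ballP _ C^o) : P0 => [e /= e0 eP].
  exists (e / 2); first by rewrite gt_eqF// divr_gt0.
  apply: filterS Q0 => t Qt z z1; apply: (PQ (e / 2 * z, t)); split => //=.
  apply: eP; rewrite -ball_normE /= sub0r normrN normrM gtr0_norm ?divr_gt0//.
  apply: (@le_lt_trans _ _ (e / 2)); first by rewrite -[leRHS]mulr1 ler_wpM2l// ltW// divr_gt0.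
  by rewrite ltr_pdivrMr// mulrDr mulr1 ltrDl.
pose pt (t : T) (z : C^o) := t.1.1 + (s * (z : C)) *: t.1.2 ord_max.
(* The factor 1/s cancels the s produced by the chain rule, so that [g' t 0] is the derivative of
   order j + 1. Joint continuity of [g] is the induction hypothesis. *)
pose g (t : T) (z : C^o) := s^-1 *: ev (dn f (pt t z, init t.1.2)) t.2.
pose g' (t : T) (z : C^o) := ev (iter_dir_derive f
  (rcons [seq init t.1.2 i | i <- enum 'I_j] (t.1.2 ord_max)) (pt t z)) t.2.
have sz (t : T) : size [seq init t.1.2 i | i <- enum 'I_j] = j by rewrite size_map size_enum_ord.
have g'E t : g' t 0 = ev (dn f t.1) t.2.
  case: t => -[x' us'] w'; rewrite /g' /pt /= mulr0 scale0r addr0.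
  by rewrite (dn_rcons x' us').
rewrite -(g'E t0); apply: (cvg_eqfun g'E).
have ptc (t : T) (z : C^o) : (fun z : C^o => pt t z) @ z --> pt t z.
  have c : (fun z : C^o => s * (z : C) : C^o) @ z --> (s * (z : C) : C^o).
    have c0 : (fun z : C^o => z) @ z --> z by exact: cvg_id.
    exact: (@tvs_cvgZr _ _ _ _ C^o s _ z c0).
  exact: (tvs_cvgD (cvg_cst _) (tvs_cvgZ c (cvg_cst _))).
apply: (@cauchy_cvg T g g' t0).
- apply: filterS sU => t tU z z1; have Ut := tU z z1; split.
  + have d : diff_quotient (iter_dir_derive f [seq init t.1.2 i | i <- enum 'I_j])
        (pt t z) (t.1.2 ord_max) e @[e --> 0^'] -->
        iter_dir_derive f (rcons [seq init t.1.2 i | i <- enum 'I_j] (t.1.2 ord_max)) (pt t z).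
      by apply: (iter_dir_derive_diff fC) => //; rewrite sz.
    have d2 := diff_quotientZ (a := s) d.
    have d3 : ev (s^-1 *: diff_quotient (iter_dir_derive f [seq init t.1.2 i | i <- enum 'I_j])
        (pt t z) (s *: t.1.2 ord_max) e) t.2 @[e --> (0 : C)^'] --> g' t z.
      rewrite /g' -[X in ev X _](scale1r) -(mulVf s0) -scalerA.
      exact: (cvg_then (tvs_cvgZr d2) (@ev_continuous t.2 _)).
    apply: cvg_eqfun d3 => e; rewrite /diff_quotient /g (evZ ev_linear) (evZ ev_linear).
    rewrite (evB ev_linear) -scalerBr scalerA [RHS]scalerA mulrC.
    congr (_ *: (ev _ _ - _)).
    congr (iter_dir_derive _ _ _).
    rewrite /pt -[e *: (1 : C^o)]/(e * 1) mulr1 mulrDr scalerDl addrA scalerA.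
    by rewrite [e * s]mulrC.
  + have c : iter_dir_derive f [seq init t.1.2 i | i <- enum 'I_j] @ pt t z -->
        iter_dir_derive f [seq init t.1.2 i | i <- enum 'I_j] (pt t z).
      by apply: (iter_dir_derive_cvg oU fC) => //; rewrite sz; exact: leq_rS.
    exact: (tvs_cvgZr (cvg_then (g := ev^~ t.2) (cvg_then (@ptc t z) c)
      (@ev_continuous t.2 _))).
  + have c : iter_dir_derive f (rcons [seq init t.1.2 i | i <- enum 'I_j] (t.1.2 ord_max))
          @ pt t z -->
        iter_dir_derive f (rcons [seq init t.1.2 i | i <- enum 'I_j] (t.1.2 ord_max)) (pt t z).
      by apply: (iter_dir_derive_cvg oU fC) => //; rewrite size_rcons sz.
    exact: (cvg_then (g := ev^~ t.2) (cvg_then (@ptc t z) c) (@ev_continuous t.2 _)).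
- move=> z z1; apply: tvs_cvgZr.
  have Uz := nbhs_singleton sU z z1.
  apply: (cvg_then (h := fun p : T * C^o => ((pt p.1 p.2, init p.1.1.2), p.1.2)) _
    (IH (leq_rS lj) (pt t0 z) (init us) w Uz)).
  have c1 : (fun p : T * C^o => p.1) @ (t0, z) --> t0 by exact: cvg_fst.
  have c2 : (fun p : T * C^o => p.2) @ (t0, z) --> z by exact: cvg_snd.
  apply: cvg_prod; last exact: (cvg_snd_comp c1).
  apply: cvg_prod; last exact: (cvg_then c1 cinit).
  have c3 : (fun p : T * C^o => s * (p.2 : C) : C^o) @ (t0, z) --> (s * (z : C) : C^o).
    exact: (@tvs_cvgZr _ _ _ _ C^o s (fun p : T * C^o => p.2) z c2).
  exact: (tvs_cvgD (cvg_then c1 cx) (tvs_cvgZ c3 (cvg_then c1 cu))).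
Qed.

Theorem exp_law_complex_C_upto : exp_law X ev ->
  C_upto leq_r (U `*` setT) (fun p : X * lcprod E => ev (f p.1) p.2).
Proof.
move=> eX; apply: (evaluation_C_upto ev_linear ev_multilinear ev_continuous hF oU leq_rS fC leq0).
exact: exp_law_complex_dn.
Qed.

End cauchy_continuity.

(** * Analytic maps *)

Section homogeneous_polynomials.
Context {K : numFieldType} {k : nat} {X M F : tvsType K} {E : 'I_k -> tvsType K}.

Lemma homogeneous_poly_sum (V W : tvsType K) n (I : Type) (r : seq I) (P : pred I)
    (p : I -> V -> W) : (forall i, P i -> homogeneous_poly n (p i)) ->
  homogeneous_poly n (fun v => \sum_(i <- r | P i) p i v).
Proof.
move=> pn; elim: r => [|i r [b bm pb]].
  exists (fun=> 0); first by move=> i x a u v; rewrite scaler0 addr0.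
  by move=> v; rewrite big_nil.
have [Pi|Pi] := boolP (P i); last first.
  by exists b => // v; rewrite big_cons (negbTE Pi) pb.
have [c cm pc] := pn i Pi; exists (fun y => c y + b y).
  by move=> j x a u v /=; rewrite cm bm scalerDr addrACA.
by move=> v; rewrite big_cons Pi pc pb.
Qed.

Variable ev : M -> lcprod E -> F.
Hypothesis ev_linear : forall y, linear (ev^~ y).
Hypothesis ev_multilinear : forall m, multilinear (ev m).

(** In the multilinear form, the first n arguments enter [b] through their X-components, and the
    other #|A| fill the slots of A in the order of [enum A]. *)
Lemma homogeneous_poly_ev n (p : X -> M) (A : {set 'I_k}) (y0 : lcprod E) :
  homogeneous_poly n p ->
  homogeneous_poly (n + #|A|) (fun q : X * lcprod E => ev (p q.1) (mix A q.2 y0)).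
Proof.
move=> [b bm pb].
pose P := lcprod (fun _ : 'I_(n + #|A|) => X * lcprod E)%type.
pose rank (i : 'I_k) : option 'I_#|A| := insub (index i (enum A)).
pose sl (q : P) : lcprod E :=
  fun i => if rank i is Some r then (q (rshift n r)).2 i else y0 i.
pose pr (q : P) : lcprod (fun _ : 'I_n => X) := fun l => (q (lshift #|A| l)).1.
exists (fun q => ev (b (pr q)) (sl q)); last first.
  move=> q; rewrite pb; congr ev; apply: lcprod_ext => i; rewrite /sl /mix /rank.
  case: insubP => [r + _|]; first by rewrite cardE index_mem mem_enum => ->.
  by rewrite cardE index_mem mem_enum => /negbTE ->.
move=> i q a u v; case: (split_ordP i) => [l ->|r ->].
  have slE w : sl (dfwith q (lshift #|A| l) w) = sl q.
    apply: lcprod_ext => i'; rewrite /sl; case: (rank i') => // r.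
    by rewrite dfw_out// eq_rlshift.
  have prE w : pr (dfwith q (lshift #|A| l) w) = dfwith (pr q) l w.1.
    apply: lcprod_ext => l'; rewrite /pr.
    have [->|ll'] := eqVneq l' l; first by rewrite !dfw_in.
    by rewrite !dfw_out// eq_lshift.
  by rewrite /= !slE !prE -[(a *: u + v).1]/(a *: u.1 + v.1) bm ev_linear.
pose i0 : 'I_k := tnth (in_tuple (enum A)) (cast_ord (cardE A) r).
have rank0 : rank i0 = Some r.
  rewrite /rank /i0 (tnth_nth i0) /= index_uniq ?enum_uniq -?cardE//.
  by rewrite valK.
have rankN i' : i' != i0 -> rank i' != Some r.
  rewrite /rank; case: insubP => // r' _ r'E; apply: contra => /eqP [rr'].
  rewrite /i0 (tnth_nth i') /= -rr' r'E nth_index//.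
  by rewrite -index_mem -r'E -cardE; exact: ltn_ord.
have prE w : pr (dfwith q (rshift n r) w) = pr q.
  by apply: lcprod_ext => l; rewrite /pr dfw_out// eq_lrshift.
have slE w : sl (dfwith q (rshift n r) w) = dfwith (sl q) i0 (w.2 i0).
  apply: lcprod_ext => i'; rewrite /sl.
  have [->|ii'] := eqVneq i' i0; first by rewrite rank0 !dfw_in.
  rewrite dfw_out//; have := rankN i' ii'; case: (rank i') => // r' rr'.
  by rewrite dfw_out// eq_rshift; apply: contra rr' => /eqP ->.
rewrite /= !prE !slE -[(a *: u + v).2 i0]/(a *: (u.2 i0) + v.2 i0).
exact: ev_multilinear.
Qed.

End homogeneous_polynomials.

Section complex_analytic_evaluation.
Context {R : realType}.
Local Notation C := (fld R Complexes).
Context {k : nat} {X M F : tvsType C} {E : 'I_k -> tvsType C}.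
Variable ev : M -> lcprod E -> F.
Hypothesis ev_linear : forall y, linear (ev^~ y).
Hypothesis ev_multilinear : forall m, multilinear (ev m).
Hypothesis ev_continuous : forall y, continuous (ev^~ y).

(** In the expansion of the evaluated map, filling #|A| slots raises the degree by #|A|; the
    condition a <= m guards the truncated subtraction. *)
Lemma shifted_series_cvg (c : nat -> F) (l : F) (a : nat) :
  series c @ \oo --> l ->
  (fun N => \sum_(0 <= m < N | (a <= m)%N) c (m - a)%N) @ \oo --> l.
Proof.
pose u N := \sum_(0 <= m < N | (a <= m)%N) c (m - a)%N.
suff uE N : series c N = u (N + a)%N.
  move=> cl A /cl[N0 _ h]; exists (N0 + a)%N => // n /= Nn.
  have an : (a <= n)%N by apply: leq_trans Nn; rewrite leq_addl.
  by have := h (n - a)%N; rewrite /= leq_subRL// addnC => /(_ Nn); rewrite uE subnK.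
rewrite /series /u /=; elim: N => [|N IH].
  rewrite big_geq// add0n big_nat_cond big1// => m /andP[/andP[_ ma] am].
  by rewrite ltnNge am in ma.
by rewrite big_nat_recr//= IH addSn [RHS]big_mkcond big_nat_recr//= leq_addl addnK -big_mkcond.
Qed.

Lemma mix_cvg (T : topologicalType) (t : T) (A : {set 'I_k}) (v w : T -> lcprod E)
    (v0 w0 : lcprod E) :
  v @ t --> v0 -> w @ t --> w0 -> (fun t => mix A (v t) (w t)) @ t --> mix A v0 w0.
Proof.
move=> vc wc; apply: lcprod_map_cvg => i; rewrite /mix; case: ifP => _; exact: cvg_proj.
Qed.

Theorem complex_analytic_ev (U : set X) (f : X -> M) : open U -> exp_law X ev ->
  complex_analytic U f ->
  complex_analytic (U `*` setT) (fun p : X * lcprod E => ev (f p.1) p.2).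
Proof.
move=> oU eX [/(within_openP f oU) fc fa]; split.
  apply/within_openP; first exact: open_setXT.
  by move=> -[x y] [/= Ux _]; exact: (eX U f oU fc x y Ux).
move=> [x0 y0] [/= Ux _]; have [Y [Y0 YU [beta [betaP betaS]]]] := fa x0 Ux.
exists (Y `*` setT); split.
- by exists (Y, setT) => //=; split=> //; exact: filterT.
- by move=> [u v] [/= Yu _]; split => //=; exact: YU.
(* Terms are sorted by total degree: filling the slots of A contributes degree #|A|, so [beta]
   enters with degree m - #|A|. There are finitely many A, so the expansion holds for every
   increment of y. *)
pose gam m (q : X * lcprod E) := \sum_(A : {set 'I_k} | (#|A| <= m)%N)
  ev (beta (m - #|A|)%N q.1) (mix A q.2 y0).
exists gam; split.
  move=> m; split.
    apply: homogeneous_poly_sum => A Am.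
    have [bh _] := betaP (m - #|A|)%N.
    by have := homogeneous_poly_ev ev_linear ev_multilinear A y0 bh; rewrite subnK.
  move=> q; apply: tvs_cvg_sum => A Am.
  have [_ bc] := betaP (m - #|A|)%N.
  have h := eX setT (beta (m - #|A|)%N) openT (fun z _ => bc z) q.1 (mix A q.2 y0) I.
  apply: (cvg_then (h := fun q : X * lcprod E => (q.1, mix A q.2 y0)) _ h).
  apply: cvg_prod; first exact: cvg_fst.
  by apply: mix_cvg; [exact: cvg_snd|exact: cvg_cst].
move=> [u v] [/= Yu _]; rewrite (multilinear_addE (ev_multilinear _)) /=.
have h : (fun N => \sum_(A : {set 'I_k}) \sum_(0 <= m < N | (#|A| <= m)%N)
    ev (beta (m - #|A|)%N u) (mix A v y0)) @ \oo -->
    \sum_(A : {set 'I_k}) ev (f (x0 + u)) (mix A v y0).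
  apply: tvs_cvg_sum => A _.
  apply: (shifted_series_cvg (c := fun n => ev (beta n u) (mix A v y0))).
  have bs := betaS u Yu.
  apply: cvg_eqfun (cvg_then bs (@ev_continuous (mix A v y0) _)) => N.
  by rewrite /series /= (ev_sum ev_linear).
apply: cvg_eqfun h => N; rewrite /series /= /gam /=.
by rewrite (exchange_big_dep predT).
Qed.

End complex_analytic_evaluation.

Section complex_analytic_linear.
Context {R : realType}.
Local Notation C := (fld R Complexes).
Context {V W F : tvsType C}.

Lemma complex_analytic_linear (J : V -> W) (O : set W) (f : W -> F) :
  linear J -> continuous J -> open O -> complex_analytic O f ->
  complex_analytic (J @^-1` O) (f \o J).
Proof.
move=> lJ cJ oO [/(within_openP f oO) fc fa]; have oJ : open (J @^-1` O).
  by apply: open_comp => // x _; exact: cJ.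
have JD x y : J (x + y) = J x + J y by have := lJ 1 x y; rewrite !scale1r.
have J0 : J 0 = 0 by apply: (addrI (J 0)); rewrite -JD !addr0.
split; first by apply/within_openP => // x Ox; exact: (cvg_then (cJ x) (fc _ Ox)).
move=> x Ox; have [Y [Y0 YO [beta [betaP betaS]]]] := fa _ Ox.
exists (J @^-1` Y); split.
- by apply: cJ; rewrite J0.
- by move=> y /= Yy; rewrite JD; exact: YO.
exists (fun n => beta n \o J); split.
  move=> n; have [[b bm bE] bc] := betaP n; split.
    exists (fun y : lcprod (fun _ : 'I_n => V) =>
        b ((fun i => J (y i)) : lcprod (fun _ : 'I_n => W))); last first.
      by move=> y /=; rewrite bE.
    move=> i y a u v /=.
    have E w : (fun j => J (dfwith y i w j)) =
        dfwith ((fun j => J (y j)) : lcprod (fun _ : 'I_n => W)) i (J w).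
      apply: lcprod_ext => j; have [->|ji] := eqVneq j i; first by rewrite !dfw_in.
      by rewrite !dfw_out.
    by rewrite !E lJ bm.
  by move=> y; exact: (cvg_then (cJ y) (bc _)).
by move=> y /= Yy; rewrite JD; exact: betaS.
Qed.

End complex_analytic_linear.

(** * Complexification of the evaluation map *)

Section real_analytic_evaluation.
Context {R : realType}.
Local Notation RR := (fld R Reals).
Local Notation CC := (fld R Complexes).
Context {k : nat} {X M F : tvsType RR} {E : 'I_k -> tvsType RR}.
Variable ev : M -> lcprod E -> F.
Hypothesis ev_linear : forall y, linear (ev^~ y).
Hypothesis ev_multilinear : forall m, multilinear (ev m).
Hypothesis ev_continuous : forall y, continuous (ev^~ y).

Local Notation EC := (fun i => cplx (E i) : tvsType CC).
Local Notation II := ('i%C : CC).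

Lemma cplx_scaleE (V : tvsType RR) (c : CC) (z : cplx V) :
  c *: z = (complex.Re c *: z.1 - complex.Im c *: z.2,
            complex.Re c *: z.2 + complex.Im c *: z.1) :> cplx V.
Proof. by []. Qed.

Lemma cplx_addE (V : tvsType RR) (z w : cplx V) : z + w = (z.1 + w.1, z.2 + w.2) :> cplx V.
Proof. by []. Qed.

Lemma cplx_realZ (V : tvsType RR) (a : R) (z : cplx V) :
  (a%:C%C : CC) *: z = ((a : RR) *: z.1, (a : RR) *: z.2) :> cplx V.
Proof. by rewrite cplx_scaleE /= !scale0r subr0 addr0. Qed.

Definition reim_mix (A : {set 'I_k}) (z : lcprod EC) : lcprod E :=
  fun i => if i \in A then (z i).2 else (z i).1.

(* the complex multilinear extension: [z_i = Re z_i + i Im z_i] is expanded in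
   each argument *)
Definition complexified_ev (m : cplx M) (z : lcprod EC) : cplx F :=
  \sum_(A : {set 'I_k}) (II ^+ #|A|) *:
    ((ev m.1 (reim_mix A z), ev m.2 (reim_mix A z)) : cplx F).

Lemma complexified_ev_linear z : linear (complexified_ev^~ z).
Proof.
move=> c m m'; rewrite /complexified_ev scaler_sumr -big_split /=.
apply: eq_bigr => A _; rewrite scalerA [c * _]mulrC -scalerA -scalerDr; congr (_ *: _).
rewrite cplx_scaleE cplx_addE /= -[- (_ *: m.2)]scaleNr.
by rewrite !(evD ev_linear) !(evZ ev_linear) scaleNr.
Qed.

Lemma complexified_ev_multilinear m : multilinear (complexified_ev m).
Proof.
move=> i z c u v.
pose P (A : {set 'I_k}) (e : E i) : cplx F :=
  (ev m.1 (dfwith (reim_mix A z) i e), ev m.2 (dfwith (reim_mix A z) i e)).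
have PD A e e' : P A (e + e') = P A e + P A e'.
  by rewrite /P !(multilinearD (ev_multilinear _)).
have PZ A (a : R) e : P A ((a : RR) *: e) = (a%:C%C : CC) *: P A e.
  by rewrite cplx_realZ /P /= !(multilinearZ (ev_multilinear _)).
(* Pairing A with [i |: A] isolates the i-th argument; complex linearity in it then follows from the
   real linearity of [P A]. *)
have evCE w : complexified_ev m (dfwith z i w) = \sum_(A : {set 'I_k} | i \notin A)
    II ^+ #|A| *: (P A w.1 + II *: P A w.2).
  rewrite /complexified_ev (sum_subsets_split i); apply: eq_bigr => A iA.
  have mix1 : reim_mix A (dfwith z i w) = dfwith (reim_mix A z) i w.1.
    apply: lcprod_ext => j; rewrite /reim_mix.
    by have [->|ji] := eqVneq j i; [rewrite (negbTE iA) !dfw_in|rewrite !dfw_out].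
  have mix2 : reim_mix (i |: A) (dfwith z i w) = dfwith (reim_mix A z) i w.2.
    apply: lcprod_ext => j; rewrite /reim_mix finset.in_setU1.
    by have [->|ji] := eqVneq j i; [rewrite !dfw_in|rewrite !dfw_out].
  by rewrite mix1 mix2 cardsU1 iA exprS mulrC -scalerA -scalerDr.
rewrite !evCE scaler_sumr -big_split /=; apply: eq_bigr => A _.
rewrite scalerA [c * _]mulrC -scalerA -scalerDr; congr (_ *: _).
rewrite -[LHS]/(P A (complex.Re c *: u.1 - complex.Im c *: u.2 + v.1) +
  II *: P A (complex.Re c *: u.2 + complex.Im c *: u.1 + v.2)).
rewrite !PD -scaleNr !PZ !scalerDr addrACA; congr (_ + _).
rewrite [X in _ + X = _]addrC addrACA !scalerA -!scalerDl [in RHS](complexE c) /=.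
congr (_ *: _ + _ *: _).
rewrite [RHS]mulrDl [RHS]addrC rmorphN /=; congr (_ + _); last by rewrite mulrC.
by rewrite mulrAC -expr2 sqr_i mulN1r.
Qed.

Lemma complexified_ev_continuous z : continuous (complexified_ev^~ z).
Proof.
move=> m; apply: tvs_cvg_sum => A _; apply: tvs_cvgZr.
apply: cvg_prod.
  exact: (cvg_then (h := fun m : cplx M => m.1) cvg_fst (@ev_continuous _ _)).
exact: (cvg_then (h := fun m : cplx M => m.2) cvg_snd (@ev_continuous _ _)).
Qed.

(** [cplx X] carries the topology of [X * X], and both components of [g] are maps from there to
    [M]. *)
Lemma complexified_exp_law : exp_law (X * X)%type ev -> exp_law (cplx X) complexified_ev.
Proof.
move=> eXX O g oO gc z y Oz; apply: tvs_cvg_sum => A _; apply: tvs_cvgZr.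
have mixc : (fun p : cplx X * lcprod EC => reim_mix A p.2) @ (z, y) --> reim_mix A y.
  apply: lcprod_map_cvg => i; rewrite /reim_mix.
  have c : (fun p : cplx X * lcprod EC => p.2 i) @ (z, y) --> y i.
    by apply: cvg_proj; exact: cvg_snd.
  case: ifP => _; first exact: (@cvg_snd_comp _ _ _ _ _ (fun p : cplx X * lcprod EC => p.2 i) (y i) c).
  exact: (@cvg_fst_comp _ _ _ _ _ (fun p : cplx X * lcprod EC => p.2 i) (y i) c).
have key (g1 : X * X -> M) : (forall z, O z -> g1 @ z --> g1 z) ->
    (fun p : cplx X * lcprod EC => ev (g1 p.1) (reim_mix A p.2)) @ (z, y) -->
    ev (g1 z) (reim_mix A y).
  move=> g1c.
  apply: (cvg_then (h := fun p : cplx X * lcprod EC => (p.1 : X * X, reim_mix A p.2)) _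
    (eXX O g1 oO g1c z (reim_mix A y) Oz)).
  by apply: cvg_prod => //; exact: cvg_fst.
apply: cvg_prod.
  by apply: (key (fun z => (g z).1)) => z' /gc gz'; exact: (cvg_fst_comp gz').
by apply: (key (fun z => (g z).2)) => z' /gc gz'; exact: (cvg_snd_comp gz').
Qed.

Lemma complexified_ev_real (m : M) (y : lcprod E) :
  complexified_ev (m, 0) (fun i => (y i, 0)) = (ev m y, 0).
Proof.
rewrite /complexified_ev (bigD1 finset.set0)//= cards0 expr0 scale1r.
have ev0 w : ev 0 w = 0 by rewrite -(subrr (0 : M)) (evB ev_linear) subrr.
have -> : reim_mix finset.set0 (fun i => (y i, 0)) = y.
  by apply: lcprod_ext => i; rewrite /reim_mix finset.inE.
rewrite big1 ?addr0 ?ev0// => A /set0Pn[i iA].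
have z0 n : ev n (reim_mix A (fun i => (y i, 0))) = 0.
  by apply: (multilinear_eq0 (ev_multilinear n) (i := i)); rewrite /reim_mix iA.
by rewrite !z0; exact: scaler0.
Qed.

(** The complexification of a product is the product of the complexifications; composing with this
    map moves the extension to the space on which [real_analytic] expects it. *)
Definition cplx_split (p : cplx (X * lcprod E)%type) : cplx X * lcprod EC :=
  ((p.1.1, p.2.1), fun i => (p.1.2 i, p.2.2 i)).

Theorem real_analytic_ev (U : set X) (f : X -> M) : exp_law (X * X)%type ev ->
  real_analytic U f ->
  real_analytic (U `*` setT) (fun p : X * lcprod E => ev (f p.1) p.2).
Proof.
move=> eXX [W [g [oW ga gf]]].
have oWT := open_setXT (T := lcprod EC) oW.
have lJ : linear cplx_split by move=> c u v.
have cJ : continuous cplx_split.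
  move=> p; have c1 : (fun p : cplx (X * lcprod E)%type => p.1) @ p --> p.1 by exact: cvg_fst.
  have c2 : (fun p : cplx (X * lcprod E)%type => p.2) @ p --> p.2 by exact: cvg_snd.
  apply: cvg_prod.
    by apply: cvg_prod; [exact: (cvg_fst_comp c1)|exact: (cvg_fst_comp c2)].
  apply: lcprod_map_cvg => i; apply: cvg_prod.
    exact: (cvg_proj (cvg_snd_comp c1)).
  exact: (cvg_proj (cvg_snd_comp c2)).
exists (cplx_split @^-1` (W `*` setT)),
  ((fun p : cplx X * lcprod EC => complexified_ev (g p.1) p.2) \o cplx_split); split.
- by apply: open_comp => // x _; exact: cJ.
- apply: complex_analytic_linear => //.
  apply: (complex_analytic_ev complexified_ev_linear complexified_ev_multilinear
    complexified_ev_continuous oW _ ga).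
  exact: complexified_exp_law.
- move=> [x y] [/= Ux _]; have [Wx gx] := gf x Ux; split => //.
  by rewrite gx complexified_ev_real.
Qed.

End real_analytic_evaluation.

(** * Sufficient conditions for the exponential law *)

Section kR_spaces.
Context {R : realType}.

Lemma cutoff (T : uniformType) (x : T) (N : set T) : nbhs x N ->
  exists phi : T -> R, [/\ continuous phi, forall t, 0 <= phi t <= 1, phi x = 0 &
    forall t, ~ N t -> phi t = 1].
Proof.
move=> xN; have nx : ~ (~` N^°) x by move=> /(_ xN).
have := @uniform_completely_regular R T x (~` N^°) (open_closedC (@open_interior _ N)) nx.
move=> /(@uniform_separatorP T R)[phi [cphi phi01 phix phiN]].
exists phi; split => //.
- by move=> t; have := phi01 (phi t) (imageT _ t); rewrite /= in_itv.
- by apply: phix; exists x.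
- move=> t Nt; apply: phiN; exists t => //= ti; apply: Nt.
  exact: interior_subset ti.
Qed.

(** [p] carries compact sets to compact sets, so [g \o p] is continuous on compact sets, hence
    continuous, and composing it with [i] gives [g] back. *)
Lemma kR_retract (Y A : topologicalType) (p : Y -> A) (i : A -> Y) :
  continuous p -> continuous i -> cancel i p -> kR_space R Y -> kR_space R A.
Proof.
move=> cp ci ip [hY kY]; split.
  move=> a b ab; apply: (can_inj ip); apply: hY => U V aU bV.
  have [c [Uc Vc]] := ab _ _ (ci a _ aU) (ci b _ bV).
  by exists (i c).
move=> g gc; have gpc : continuous (g \o p).
  apply: kY => C cC; apply/subspace_continuousP => y Cy W /=.
  have cpC : compact (p @` C) by apply: continuous_compact => //; exact: continuous_subspaceT.
  have /subspace_continuousP/(_ (p y) (imageP _ Cy)) := gc _ cpC.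
  move=> /(_ W) /[apply] h0.
  have h : nbhs (p y) [set a | (p @` C) a -> W (g a)] by exact: h0.
  suff : nbhs y [set y' | C y' -> W (g (p y'))] by [].
  have h2 : nbhs y [set y' | (p @` C) (p y') -> W (g (p y'))] := cp y _ h.
  by apply: filterS h2 => y' /= h' Cy'; apply: h'; exists y'.
move=> a; have := gpc (i a); rewrite /continuous_at /= ip => h.
by apply: cvg_eqfun (cvg_then (ci a) h) => a' /=; rewrite ip.
Qed.

Lemma kR_square (X G : topologicalType) : kR_space R ((X * G) * (X * G))%type ->
  kR_space R (X * G)%type /\ kR_space R ((X * X) * G)%type.
Proof.
move=> h; split.
  apply: (kR_retract (p := fst) (i := fun y => (y, y)) _ _ _ h) => //.
    by move=> p; exact: cvg_fst.
  by move=> y; apply: cvg_prod; exact: cvg_id.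
(* The section repeats the [G]-component in both factors. *)
apply: (kR_retract (p := fun q : (X * G) * (X * G) => ((q.1.1, q.2.1), q.1.2))
  (i := fun q : (X * X) * G => ((q.1.1, q.2), (q.1.2, q.2))) _ _ _ h).
- move=> q.
  have c1 : (fun q : (X * G) * (X * G) => q.1) @ q --> q.1 by exact: cvg_fst.
  have c2 : (fun q : (X * G) * (X * G) => q.2) @ q --> q.2 by exact: cvg_snd.
  exact: (cvg_prod (cvg_prod (cvg_fst_comp c1) (cvg_fst_comp c2)) (cvg_snd_comp c1)).
- move=> q.
  have c1 : (fun q : (X * X) * G => q.1) @ q --> q.1 by exact: cvg_fst.
  have c2 : (fun q : (X * X) * G => q.2) @ q --> q.2 by exact: cvg_snd.
  exact: (cvg_prod (cvg_prod (cvg_fst_comp c1) c2) (cvg_prod (cvg_snd_comp c1) c2)).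
- by move=> [[x x'] g].
Qed.

Theorem exp_law_kR (K : numFieldType) (Z : uniformType) (M G : topologicalType)
    (F : tvsType K) (ev : M -> G -> F) :
  kR_space R (Z * G)%type -> (forall m, continuous (ev m)) ->
  (forall m B V, compact B -> nbhs (0 : F) V ->
    nbhs m [set m' | forall y, B y -> V (ev m' y - ev m y)]) ->
  exp_law Z ev.
Proof.
move=> [_ kZG] evc evu O g oO gc z0 y0 Oz0 A A0.
pose Phi (p : Z * G) := ev (g p.1) p.2.
have [chi [chic chi01 chi0 chiN]] := cutoff (open_nbhs_nbhs (conj oO Oz0)).
have [phi [phic phi01 phi0 phiN]] := @cutoff F (ev (g z0) y0) A A0.
(* The kR property speaks of real functions on all of [Z * G]. The cutoff [phi] makes the
   vector-valued [Phi] real and [chi] hides the points off [O]; [Psi] is 1 at (z0, y0) and 0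
   wherever [Phi] leaves [A]. *)
pose Psi (p : Z * G) : R := (1 - chi p.1) * (1 - phi (Phi p)).
(* The second coordinates of the points of [C] form a compact set, on which maps near [g z] in [M]
   are uniformly close to it. *)
have Phi_within C z y : compact C -> C (z, y) -> O z ->
    Phi @ within C (nbhs (z, y)) --> Phi (z, y).
  move=> cC Czy Oz; apply: cvg_absconvexP => V V0 _.
  have [W [W0 _ WV]] := absconvex_half V0.
  have cB : compact (snd @` C).
    by apply: continuous_compact => //; apply: continuous_subspaceT => q; exact: cvg_snd.
  have n1 : nbhs (z, y) [set q : Z * G | forall y', (snd @` C) y' ->
      W (ev (g q.1) y' - ev (g z) y')].
    have c : (fun q : Z * G => g q.1) @ (z, y) --> g z.
      by apply: (cvg_then (h := fun q : Z * G => q.1) cvg_fst); exact: gc.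
    exact: (c _ (evu (g z) _ W cB W0)).
  have n2 : nbhs (z, y) [set q : Z * G | W (ev (g z) q.2 - ev (g z) y)].
    have c : (fun q : Z * G => ev (g z) q.2) @ (z, y) --> ev (g z) y.
      by apply: (cvg_then (h := fun q : Z * G => q.2) cvg_snd); exact: evc.
    exact: (c _ (nbhs_sub _ W0)).
  suff : nbhs (z, y) [set q | C q -> V (Phi q - Phi (z, y))] by [].
  apply: (filterS _ (filterI n1 n2)) => q [q1 q2] Cq.
  rewrite -(subrKA (ev (g z) q.2)); apply: WV => //.
  by apply: q1; exists q.
have Psic : continuous Psi.
  apply: kZG => C cC; apply/subspace_continuousP => -[z y] Czy.
  have chi_within : (fun q : Z * G => chi q.1) @ within C (nbhs (z, y)) --> chi z.
    apply: cvg_within_filter.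
    by apply: (cvg_then (h := fun q : Z * G => q.1) cvg_fst); exact: chic.
  have c1 : (fun q : Z * G => 1 - chi q.1) @ within C (nbhs (z, y)) --> 1 - chi z.
    by apply: cvgB => //; exact: cvg_cst.
  have [Oz|Oz] := pselect (O z).
    apply: cvgM => //; apply: cvgB; first exact: cvg_cst.
    by apply: (cvg_then (Phi_within C z y cC Czy Oz)); exact: phic.
  (* Off [O] nothing is known about [Phi], but [Psi] is squeezed between 0 and 1 - chi, which tends
     to 0 here. *)
  have Psi0 : Psi (z, y) = 0 by rewrite /Psi /= (chiN z Oz) subrr mul0r.
  rewrite (chiN z Oz) subrr in c1.
  suff h : Psi @ within C (nbhs (z, y)) --> (0 : R) by rewrite -[X in _ --> X]Psi0 in h; exact: h.
  apply: (@squeeze_cvgr _ _ _ _ (fun=> 0) (fun q : Z * G => 1 - chi q.1)) => //; last first.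
    exact: cvg_cst.
  apply: nearW => q; rewrite /Psi; have /andP[a0 a1] := chi01 q.1.
  have /andP[b0 b1] := phi01 (Phi q).
  rewrite mulr_ge0 ?subr_ge0//= -[leRHS]mulr1 ler_wpM2l ?subr_ge0//.
  by rewrite lerBlDr lerDl.
have Psi0 : Psi (z0, y0) = 1 by rewrite /Psi /= chi0 /Phi /= phi0 subr0 mulr1.
have /= h := Psic (z0, y0) [set r | 0 < r]; rewrite Psi0 in h.
have h2 : nbhs (z0, y0) [set p | 0 < Psi p] := h (lt_nbhsr ltr01).
apply: (filterS _ h2) => -[z y] /= Pzy; apply: contrapT => NA; move: Pzy.
by rewrite /Psi /Phi /= (phiN _ NA) subrr mulr0 ltxx.
Qed.

End kR_spaces.

Theorem exp_law_local (K : numFieldType) (Z M G : topologicalType)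
    (F : tvsType K) (ev : M -> G -> F) :
  (forall m, continuous (ev m)) ->
  (forall y : G, exists2 B, nbhs y B & forall m V, nbhs (0 : F) V ->
    nbhs m [set m' | forall y, B y -> V (ev m' y - ev m y)]) ->
  exp_law Z ev.
Proof.
move=> evc evu O g oO gc z y Oz; apply: cvg_absconvexP => V V0 _.
have [W [W0 _ WV]] := absconvex_half V0; have [B yB Bu] := evu y.
have n1 : nbhs (z, y) [set q : Z * G | forall y', B y' -> W (ev (g q.1) y' - ev (g z) y')].
  have c : (fun q : Z * G => g q.1) @ (z, y) --> g z.
    by apply: (cvg_then (h := fun q : Z * G => q.1) cvg_fst); exact: gc.
  exact: (c _ (Bu (g z) W W0)).
have n2 : nbhs (z, y) [set q : Z * G | W (ev (g z) q.2 - ev (g z) y)].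
  have c : (fun q : Z * G => ev (g z) q.2) @ (z, y) --> ev (g z) y.
    by apply: (cvg_then (h := fun q : Z * G => q.2) cvg_snd); exact: evc.
  exact: (c _ (nbhs_sub _ W0)).
have n3 : nbhs (z, y) [set q : Z * G | B q.2] by apply: cvg_snd.
apply: (filterS _ (filterI n1 (filterI n2 n3))) => q [q1 [q2 Bq]].
by rewrite -(subrKA (ev (g z) q.2)); apply: WV => //; exact: q1.
Qed.

Definition locally_compact_nbhs (Z : topologicalType) : Prop :=
  forall (z : Z) (O : set Z), nbhs z O ->
  exists C, [/\ nbhs z C, compact C & C `<=` O].

Lemma locally_compact_nbhs_prod (Y Z : topologicalType) :
  locally_compact_nbhs Y -> locally_compact_nbhs Z ->
  locally_compact_nbhs (Y * Z)%type.
Proof.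
move=> lY lZ [y z] O [[/= P Q] [yP zQ] PQ].
have [C [yC cC CP]] := lY y P yP; have [D [zD cD DQ]] := lZ z Q zQ.
exists (C `*` D); split; [by exists (C, D)|exact: compact_setX|].
by move=> p [Cp Dp]; apply: PQ; split; [exact: CP|exact: DQ].
Qed.

Lemma nbhs_lcprod (K : numFieldType) (I : finType) (E : I -> tvsType K) (y : lcprod E)
    (A : forall i, set (E i)) : (forall i, nbhs (y i) (A i)) ->
  nbhs y [set f | forall i, A i (f i)].
Proof.
move=> yA; apply: (@filter_forall _ I (fun i f => A i (f i)) (nbhs y)) => i.
exact: (@lcprod_proj_continuous _ _ E i y _ (yA i)).
Qed.

(** * Local compactness of finite-dimensional Hausdorff spaces *)

Section finite_dimensional_spaces.
Context {R : realType} {Kg : ground}.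
Local Notation K := (fld R Kg).
Context {E : tvsType K}.
Hypothesis hE : hausdorff_space E.

(** A spanning family of minimal length is free, as a nontrivial relation would eliminate one of its
    members. *)
Lemma finite_dimensional_basis : finite_dimensional E ->
  exists (n : nat) (e : 'I_n -> E),
    (forall x, exists c : 'I_n -> K, x = \sum_(i < n) c i *: e i) /\
    (forall c : 'I_n -> K, \sum_(i < n) c i *: e i = 0 -> forall i, c i = 0).
Proof.
move=> [N [e0 e0P]].
pose P n := `[< exists e : 'I_n -> E, forall x, exists c : 'I_n -> K,
  x = \sum_(i < n) c i *: e i >].
have exP : exists n, P n by exists N; apply/asboolP; exists e0.
have [n /asboolP[e eP] nmin] := ex_minnP exP.
exists n, e; split=> // c c0 j; apply: contrapT => /eqP cj.
case: n e eP nmin c c0 j cj => [|n] e eP nmin c c0 j cj; first by case: j cj.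
suff : P n by move=> /nmin; rewrite ltnn.
apply/asboolP; exists (fun i => e (lift j i)) => x; have [d ->] := eP x.
exists (fun i => d (lift j i) - d j * (c j)^-1 * c (lift j i)).
rewrite (bigD1_ord j)//=; rewrite (bigD1_ord j)//= in c0.
have -> : e j = - \sum_(i < n) ((c j)^-1 * c (lift j i)) *: e (lift j i).
  under eq_bigr do rewrite -scalerA.
  rewrite -scaler_sumr; move/eqP: c0; rewrite addr_eq0 => /eqP c0.
  by rewrite -scalerN -c0 scalerA mulVf// scale1r.
rewrite scalerN scaler_sumr -sumrN -big_split /=; apply: eq_bigr => i _.
by rewrite scalerA mulrA scalerBl addrC.
Qed.

(** The order of the complex numbers is partial; through [rho] a coordinate of largest modulus can
    be chosen. *)
Lemma norm_real (c : K) : exists r : R, rho r = `|c|.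
Proof.
have [->|c0] := eqVneq c 0; first by exists 0; rewrite normr0 rho0.
have nc : 0 < `|c| by rewrite normr_gt0.
by have [d _ dE] := emb_small (SubReals Kg) nc; exists d.
Qed.

(** The image of the boundary of the unit cube is compact, hence closed, and misses 0 as the basis
    is free. An absolutely convex neighbourhood [V] missing it lies in the image of the cube:
    otherwise division by the largest coordinate would carry a point of [V] into the image of the
    boundary. *)
Lemma finite_dimensional_compact_nbhs0 : finite_dimensional E ->
  exists2 D : set E, nbhs 0 D & compact D.
Proof.
move=> /finite_dimensional_basis[n [e [eP eI]]].
pose Kn := lcprod (fun _ : 'I_n => K^o).
pose T (c : Kn) : E := \sum_(i < n) (c i : K) *: e i.
have cT : continuous T.
  move=> c.
  suff h : forall i, (fun c : Kn => (c i : K) *: e i) @ c --> (c i : K) *: e i.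
    exact: (tvs_cvg_sum (P := xpredT) (fun i _ => h i)).
  move=> i.
  have ci : (fun c : Kn => c i : K^o) @ c --> (c i : K^o).
    exact: (@lcprod_proj_continuous _ _ (fun _ : 'I_n => K^o) i c).
  exact: (tvs_cvgZ ci (cvg_cst _)).
pose B : set Kn := [set c | forall i, `|c i : K| <= 1].
have cB : compact B.
  exact: (@tychonoff 'I_n (fun=> K^o) (fun=> [set c : K^o | `|c : K| <= 1])
    (fun=> @unit_disc_compact R Kg)).
pose S := B `&` ~` [set c : Kn | forall i, `|c i : K| < 1].
have cS : compact S.
  apply: compact_closedI => //; apply: open_closedC; rewrite openE => c cP.
  apply: (@nbhs_lcprod K 'I_n (fun=> K^o) c (fun=> [set a | `|a : K| < 1])) => i.
  apply/(@nbhs_ballP _ K^o); exists (1 - `|c i : K|) => /=; first by rewrite subr_gt0; exact: cP.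
  move=> a; rewrite -ball_normE /= => ca; rewrite -(subrK (c i : K) a).
  by apply: le_lt_trans (ler_normD _ _) _; rewrite -ltrBrDr distrC.
have cTS : compact (T @` S).
  by apply: continuous_compact => //; exact: continuous_subspaceT.
have TS0 : nbhs (0 : E) (~` (T @` S)).
  apply: open_nbhs_nbhs; split; first by apply: closed_openC; exact: compact_closed.
  move=> [c [_ cN] c0]; apply: cN => i /=.
  by rewrite (eI _ c0) normr0 ltr01.
have [V [V0 cV VS]] := absconvex_nbhs TS0.
exists (T @` B); last by apply: continuous_compact => //; exact: continuous_subspaceT.
apply: filterS V0 => x Vx; have [c xE] := eP x; exists c => //.
apply: contrapT => cNB.
have [j cj] : exists j, 1 < `|c j|.
  apply: contrapT => h; apply: cNB => i; rewrite real_leNgt ?normr_real ?real1//.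
  by apply/negP => ci; apply: h; exists i.
have [r rE] := choice (fun i => norm_real (c i)).
pose m := [arg max_(i > j) r i]%O.
have mP i : `|c i| <= `|c m|.
  by rewrite -!rE rho_le /m; case: arg_maxP => // i' _ /(_ i isT).
have m1 : 1 < `|c m| by apply: lt_le_trans cj _; exact: mP.
have m0 : c m != 0 by rewrite -normr_gt0 (lt_trans ltr01).
have xm : V ((c m)^-1 *: x).
  apply: absconvexZ => //; rewrite normfV invf_le1 ?(ltW m1)//.
  exact: lt_trans m1.
apply: (VS _ xm); exists (fun i => (c m)^-1 * c i).
  split=> [i|/(_ m)] /=.
    rewrite normrM normfV mulrC ler_pdivrMr ?mul1r//.
    exact: lt_trans m1.
  by rewrite mulVf// normr1 ltxx.
rewrite /T xE scaler_sumr; apply: eq_bigr => i _.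
by rewrite scalerA.
Qed.

Lemma finite_dimensional_locally_compact : finite_dimensional E -> locally_compact_nbhs E.
Proof.
move=> /finite_dimensional_compact_nbhs0[D D0 cD] z O /cvg_add0 zO.
have key d : D d -> nbhs ((0 : K^o), d) [set p : K^o * E | O (z + (p.1 : K) *: p.2)].
  move=> Dd; have c : (fun p : K^o * E => (p.1 : K) *: p.2) @ ((0 : K^o), d) --> (0 : K) *: d.
    have c1 : (fun p : K^o * E => p.1 : K^o) @ ((0 : K^o), d) --> (0 : K^o) by exact: cvg_fst.
    have c2 : (fun p : K^o * E => p.2) @ ((0 : K^o), d) --> d by exact: cvg_snd.
    exact: (tvs_cvgZ c1 c2).
  by rewrite scale0r in c; exact: (c _ zO).
have /(@nbhs_ballP _ K^o)[e /= e0 eO] := compact_nbhs_prod cD key.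
have e2 : 0 < e / 2 by rewrite divr_gt0.
have e20 : e / 2 != 0 by rewrite gt_eqF.
exists ((fun d => z + (e / 2) *: d) @` D); split.
- apply/cvg_add0; apply: (filterS _ (nbhs0Z e20 D0)) => _ [d Dd <-] /=.
  by exists d.
- apply: continuous_compact => //; apply: continuous_subspaceT => d.
  have c1 : (fun d : E => (e / 2) *: d) @ d --> (e / 2) *: d by exact: (tvs_cvgZr cvg_id).
  exact: (tvs_cvgD (cvg_cst _) c1).
- move=> _ [d Dd <-]; apply: (eO (e / 2) _ d Dd).
  rewrite -ball_normE /= sub0r normrN gtr0_norm//.
  by rewrite ltr_pdivrMr// mulrDr mulr1 ltrDl.
Qed.

End finite_dimensional_spaces.

Section mlin_evaluation.
Context {K : numFieldType} {k : nat} {S : unif_kind} {E : 'I_k -> tvsType K} {F : tvsType K}.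
Local Notation M := (mlin S E F).

Lemma unif_sets_point (y : lcprod E) : unif_sets S [set y].
Proof.
have cy : compact [set y] by exact: compact_set1.
by rewrite /unif_sets; case: S => //; exact: compact_tvs_bounded.
Qed.

Lemma mlin_eval_continuous (y : lcprod E) : continuous (fun m : M => m y).
Proof.
move=> m A /cvg_add0 A0.
have := nbhs_mlin m (unif_sets_point y) A0.
by apply: filterS => m' /(_ y erefl) /=; rewrite subrKC.
Qed.

Lemma mlin_hausdorff : hausdorff_space F -> hausdorff_space M.
Proof.
move=> hF m m' mm'; apply: mlin_ext => y; apply: hF => A B mA mB.
have [n [An Bn]] := mm' _ _ (@mlin_eval_continuous y m A mA) (@mlin_eval_continuous y m' B mB).
by exists (n y).
Qed.

Lemma exp_law_unif_nbhs (Z : topologicalType) :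
  (forall y : lcprod E, exists2 B, nbhs y B & unif_sets S B) ->
  exp_law Z (fun (m : M) y => m y).
Proof.
move=> h; apply: exp_law_local; first exact: mlin_continuous.
move=> y; have [B yB SB] := h y; exists B => // m V V0.
exact: nbhs_mlin.
Qed.

End mlin_evaluation.

Lemma exp_law_mlin_kR (R : realType) (K : numFieldType) (k : nat) (E : 'I_k -> tvsType K)
    (F : tvsType K) (Z : uniformType) : kR_space R (Z * lcprod E)%type ->
  exp_law Z (fun (m : mlin OnCompacts E F) y => m y).
Proof.
move=> kZ; apply: (exp_law_kR kZ); first exact: mlin_continuous.
by move=> m B V cB V0; exact: nbhs_mlin.
Qed.

(** * Evaluation of the symmetrized map *)

Section symmetrized_evaluation.
Context {K : numFieldType} {k : nat} {E F : tvsType K}.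
Local Notation P := (lcprod (fun _ : 'I_k => E)).
Local Notation M := (mlin OnCompacts (fun _ : 'I_k => E) F).

(** The evaluation theorems ask for a map defined on a whole space [M] and linear there;
    symmetrizing the value provides this without passing to the subspace of symmetric maps. *)
Definition sym_ev (m : M) (y : P) : F :=
  (k`!)%:R^-1 *: \sum_(s : 'S_k) m (fun i => y (s i)).

Lemma sym_ev_symmetric (m : M) (y : P) : symmetric_map m -> sym_ev m y = m y.
Proof.
move=> sm; rewrite /sym_ev (eq_bigr (fun=> m y)) => [|s _]; last exact: sm.
have k0 : (k`!)%:R != 0 :> K by rewrite pnatr_eq0 -lt0n fact_gt0.
by rewrite sumr_const card_Sn -[X in _ *: X]scaler_nat scalerA mulVf// scale1r.
Qed.

Lemma sym_ev_linear (y : P) : linear (sym_ev^~ y).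
Proof.
move=> a m m'; rewrite /sym_ev scalerA [a * _]mulrC -scalerA -scalerDr.
by congr (_ *: _); rewrite scaler_sumr -big_split.
Qed.

Lemma sym_ev_multilinear (m : M) : multilinear (sym_ev m).
Proof.
move=> i y a u v; rewrite /sym_ev scalerA [a * _]mulrC -scalerA -scalerDr.
congr (_ *: _); rewrite scaler_sumr -big_split /=; apply: eq_bigr => s _.
have E0 w : (fun j => dfwith y i w (s j)) =
    dfwith ((fun j => y (s j)) : P) ((s^-1)%g i) w.
  apply: lcprod_ext => j; have [jE|ji] := eqVneq (s j) i.
    have -> : j = (s^-1)%g i by rewrite -jE permK.
    by rewrite permKV !dfw_in.
  rewrite !dfw_out//; apply: contra ji => /eqP ->.
  by rewrite permKV.
by rewrite !E0 mlin_multilinear.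
Qed.

Lemma sym_ev_continuous (y : P) : continuous (sym_ev^~ y).
Proof.
move=> m; have h s : (fun m : M => m (fun i => y (s i))) @ m --> m (fun i => y (s i)).
  exact: mlin_eval_continuous.
have FFm : Filter (nbhs m) := nbhs_filter m.
have hs := tvs_cvg_sum (FF := FFm) (r := index_enum 'S_k) (P := xpredT) (fun s _ => h s).
exact: (tvs_cvgZr (FF := FFm) hs).
Qed.

Lemma exp_law_sym_ev (R : realType) (Z : uniformType) :
  kR_space R (Z * E)%type -> exp_law Z sym_ev.
Proof.
move=> kZE.
have diagc : continuous (fun y : E => (fun=> y) : P).
  by move=> y; apply: lcprod_map_cvg => i; exact: cvg_id.
have h : exp_law Z (fun (m : M) (y : E) => m (fun=> y)).
  apply: (exp_law_kR kZE).
    by move=> m y; exact: (cvg_then (@diagc y) (@mlin_continuous _ _ _ _ _ m _)).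
  move=> m B V cB V0.
  have cB' : compact ((fun y : E => (fun=> y) : P) @` B).
    by apply: continuous_compact => //; exact: continuous_subspaceT.
  have := nbhs_mlin m (cB' : unif_sets OnCompacts _) V0.
  by apply: filterS => m' /= mV y By; apply: mV; exists y.
move=> O g oO gc z y Oz.
pose Q (p : Z * P) : F := (k`!)%:R^-1 *: \sum_(T : {set 'I_k}) (-1) ^+ #|~: T| *:
  g p.1 (fun=> \sum_(i in T) p.2 i).
have QE p : Q p = sym_ev (g p.1) p.2.
  by rewrite /Q /sym_ev (polarization p.2 (@mlin_multilinear _ _ _ _ _ (g p.1))).
apply: (cvg_eqfun QE); rewrite -(QE (z, y)); apply: tvs_cvgZr; apply: tvs_cvg_sum => T _.
apply: tvs_cvgZr.
apply: (cvg_then (h := fun p : Z * P => (p.1, \sum_(i in T) p.2 i)) _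
  (h O g oO gc z (\sum_(i in T) y i) Oz)).
apply: cvg_prod; first exact: cvg_fst.
apply: tvs_cvg_sum => i _; apply: cvg_proj.
exact: cvg_snd.
Qed.

End symmetrized_evaluation.

Section unif_neighbourhoods.

Lemma lcprod_compact_nbhs (K : numFieldType) (k : nat) (E : 'I_k -> tvsType K) :
  (forall i, locally_compact_nbhs (E i)) ->
  forall y : lcprod E, exists2 B, nbhs y B & compact B.
Proof.
move=> lE y; have h i : exists C, [/\ nbhs (y i) C, compact C & C `<=` setT].
  by apply: lE; exact: filterT.
pose C i := sval (cid (h i)); have CP i := svalP (cid (h i)).
exists [set f | forall i, C i (f i)]; last first.
  by apply: (@tychonoff 'I_k (fun i => E i) C) => i; have [] := CP i.
by apply: nbhs_lcprod => i; have [] := CP i.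
Qed.

Context {K : numFieldType} {k : nat} {E : 'I_k -> tvsType K}.

Lemma lcprod_bounded_nbhs : (forall i, normable (E i)) ->
  forall y : lcprod E, exists2 B, nbhs y B & tvs_bounded B.
Proof.
move=> nE y; pose p i := sval (cid (nE i)); have pP i := svalP (cid (nE i)).
exists [set f | forall i, p i (f i - y i) < 1].
  apply: (@nbhs_lcprod K 'I_k E y (fun i => [set e | p i (e - y i) < 1])) => i.
  by have [_ _ _ _ nb] := pP i; apply/nb; exists 1.
move=> V V0; apply: small_absorbs.
pose box (r : K) := [set f : lcprod E | forall i, p i (f i) < r].
have [r r0 boxV] : exists2 r : K, 0 < r & box r `<=` V.
  have FF : Filter (filter_from [set r : K | 0 < r] box).
    apply: filter_from_filter; first by exists 1 => /=.
    move=> r s /= r0 s0; have rs : 0 < r + s by rewrite addr_gt0.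
    exists (r * s / (r + s)); first by rewrite /= divr_gt0// mulr_gt0.
    move=> f fi; split=> i; apply: lt_trans (fi i) _; rewrite ltr_pdivrMr//.
      by rewrite ltr_pM2l// ltrDr.
    by rewrite mulrC ltr_pM2l// ltrDl.
  suff : filter_from [set r : K | 0 < r] box --> (0 : lcprod E).
    by move=> /(_ _ V0)[r r0 rV]; exists r.
  apply: lcprod_cvg => i A.
  have [_ _ _ _ nb] := pP i => /nb[r r0 rA].
  by exists r => // f /(_ i) fi; apply: rA => /=; rewrite subr0.
(* By the triangle inequality [B] bounds every [p i (x i)] on the chosen neighbourhood of y; the sum
   replaces a maximum. *)
pose B := 1 + \sum_i p i (y i).
have B0 : 0 < B.
  apply: ltr_pwDl; first exact: ltr01.
  by apply: sumr_ge0 => i _; have [p0 _ _ _ _] := pP i; exact: p0.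
apply/(@nbhs_ballP _ K^o); exists (r / B); first by rewrite /= divr_gt0.
move=> a; rewrite -ball_normE /= sub0r normrN => ar x xB; apply: boxV => i.
have [p0 _ pD pZ _] := pP i.
have -> : p i ((a *: x) i) = `|a| * p i (x i) := pZ a (x i).
have xi : p i (x i) <= B.
  rewrite -(subrK (y i) (x i)); apply: le_trans (pD _ _) _; apply: lerD.
    exact: ltW (xB i).
  rewrite (bigD1 i)//= lerDl; apply: sumr_ge0 => j _.
  by have [pj0 _ _ _ _] := pP j; exact: pj0.
apply: (@le_lt_trans _ _ (`|a| * B)); first by rewrite ler_wpM2l.
by rewrite -ltr_pdivlMr.
Qed.

End unif_neighbourhoods.

(** * Barrelled spaces and equicontinuity *)

Section barrelled_spaces.
Context {K : numFieldType} {E F : tvsType K}.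

Lemma closure_absconvex (D : set E) : absolutely_convex D -> absolutely_convex (closure D).
Proof.
move=> cD a b x y ab Dx Dy A xyA.
have c : (fun p : E * E => a *: p.1 + b *: p.2) @ (x, y) --> a *: x + b *: y.
  have c1 : (fun p : E * E => p.1) @ (x, y) --> x by exact: cvg_fst.
  have c2 : (fun p : E * E => p.2) @ (x, y) --> y by exact: cvg_snd.
  exact: (tvs_cvgD (tvs_cvgZr c1) (tvs_cvgZr c2)).
have [[/= P Q] [xP yQ] PQ] := c A xyA.
have [x' [Dx' Px']] := Dx P xP; have [y' [Dy' Qy']] := Dy Q yQ.
by exists (a *: x' + b *: y'); split; [exact: cD|exact: (PQ (x', y'))].
Qed.

Lemma absorbsW (V W B : set E) : V `<=` W -> absorbs V B -> absorbs W B.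
Proof.
move=> VW [r r0 h]; exists r => // a ra x Bx.
by have [v Vv <-] := h a ra x Bx; exists v => //; exact: VW.
Qed.

Local Notation M := (mlin OnCompacts (fun _ : 'I_1 => E) F).
Local Notation diag := (fun y : E => (fun=> y) : lcprod (fun _ : 'I_1 => E)).

Lemma mlin1_linear (m : M) : linear (fun y : E => m (diag y)).
Proof.
move=> a u v.
have dE (w : E) : diag w = dfwith (0 : lcprod (fun _ : 'I_1 => E)) ord0 w.
  by apply: lcprod_ext => i; rewrite (ord1 i) dfw_in.
by rewrite !dE mlin_multilinear.
Qed.

Lemma diag_continuous : continuous diag.
Proof. by move=> y; apply: lcprod_map_cvg => i; exact: cvg_id. Qed.

(* Banach--Steinhaus: on a compact neighbourhood C the family [g z] is pointwise
   bounded, hence equicontinuous *)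
Theorem exp_law_barrelled (Z : topologicalType) : barrelled E ->
  locally_compact_nbhs Z -> exp_law Z (fun (m : M) y => m y).
Proof.
move=> bE lZ O g oO gc z y Oz; apply: cvg_absconvexP => V V0 _.
have [W [W0 _ WV]] := absconvex_half V0.
have [W1 [W10 cW1 W1W]] := absconvex_half W0.
have [C [zC cC CO]] := lZ z O (open_nbhs_nbhs (conj oO Oz)).
(* The barrel is the closure of [D0]. As [W1] may fail to be closed, the closure costs a halving: on
   it the values lie in [W]. *)
pose D0 := [set u : E | forall z', C z' -> W1 (g z' (diag u))].
have mD (m : M) (a b : K) (u v : E) :
    m (diag (a *: u + b *: v)) = a *: m (diag u) + b *: m (diag v).
  have mZ w : m (diag (b *: w)) = b *: m (diag w).
    have m0 : m (diag 0) = 0.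
      have := mlin1_linear m (-1) (0 : E) 0.
      by rewrite scaler0 addr0 scaleN1r addNr.
    by have := mlin1_linear m b w 0; rewrite !addr0 m0 addr0.
  by rewrite mlin1_linear mZ.
have cD0 : absolutely_convex D0.
  move=> a b u v ab Du Dv z' Cz'; rewrite mD.
  by apply: cW1 => //; [exact: Du|exact: Dv].
have D00 : D0 0.
  move=> z' Cz'; have := mD (g z') 0 0 0 0; rewrite !scale0r addr0 => ->.
  by rewrite addr0; exact: nbhs_singleton.
have aD0 : absorbing D0.
  (* For fixed u the values of [g z'] at u depend continuously on z' in the compact [C], so that one
     scale absorbs them all. *)
  move=> u; apply: small_absorbs.
  have key z' : C z' -> nbhs ((0 : K^o), z')
      [set p : K^o * Z | W1 ((p.1 : K) *: g p.2 (diag u))].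
    move=> Cz'.
    have c1 : (fun p : K^o * Z => p.1) @ ((0 : K^o), z') --> (0 : K^o) by exact: cvg_fst.
    have c2 : (fun p : K^o * Z => g p.2) @ ((0 : K^o), z') --> g z'.
      by apply: (cvg_then (h := fun p : K^o * Z => p.2) cvg_snd); apply: gc; exact: CO.
    have c3 : (fun p : K^o * Z => (p.1 : K) *: g p.2 (diag u)) @ ((0 : K^o), z') -->
        (0 : K) *: g z' (diag u).
      exact: (tvs_cvgZ c1 (cvg_then c2 (@mlin_eval_continuous _ _ _ _ _ (diag u) (g z')))).
    by rewrite scale0r in c3; exact: (c3 _ W10).
  apply: (filterS _ (compact_nbhs_prod cC key)) => a aC _ -> z' Cz'.
  have := mD (g z') a 0 u 0; rewrite scaler0 addr0 => ->.
  by rewrite scale0r addr0; exact: aC.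
have D0E : nbhs (0 : E) (closure D0).
  apply: bE; [exact: closed_closure|exact: closure_absconvex|].
  by move=> u; apply: absorbsW (aD0 u); exact: subset_closure.
have clD u z' : closure D0 u -> C z' -> W (g z' (diag u)).
  move=> Du Cz'.
  have c : (fun v : E => g z' (diag u) - g z' (diag v)) @ u --> g z' (diag u) - g z' (diag u).
    exact: (tvs_cvgB (cvg_cst _)
      (cvg_then (@diag_continuous u) (@mlin_continuous _ _ _ _ _ (g z') _))).
  rewrite subrr in c; have [v [Dv Wv]] := Du _ (c _ W10).
  by rewrite -(subrK (g z' (diag v)) (g z' (diag u))); apply: W1W => //; exact: Dv.
have yE (y' : lcprod (fun _ : 'I_1 => E)) : y' = diag (y' ord0).
  by apply: lcprod_ext => i; rewrite (ord1 i).
have n1 : nbhs (z, y) [set p : Z * lcprod (fun _ : 'I_1 => E) | C p.1 /\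
    closure D0 (p.2 ord0 - y ord0)].
  apply: (filterI (F := nbhs (z, y))); first by apply: cvg_fst.
  have c : (fun p : Z * lcprod (fun _ : 'I_1 => E) => p.2 ord0) @ (z, y) --> y ord0.
    by apply: cvg_proj; exact: cvg_snd.
  exact: (c _ (nbhs_sub _ D0E)).
have n2 : nbhs (z, y) [set p : Z * lcprod (fun _ : 'I_1 => E) | W (g p.1 y - g z y)].
  have c : (fun p : Z * lcprod (fun _ : 'I_1 => E) => g p.1) @ (z, y) --> g z.
    by apply: (cvg_then (h := fun p : Z * _ => p.1) cvg_fst); exact: gc.
  have c2 : (fun p : Z * lcprod (fun _ : 'I_1 => E) => g p.1 y) @ (z, y) --> g z y.
    exact: (cvg_then c (@mlin_eval_continuous _ _ _ _ _ y (g z))).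
  exact: (c2 _ (nbhs_sub _ W0)).
apply: (filterS _ (filterI n1 n2)) => -[z' y'] /= [[Cz' Dy'] Wz'].
rewrite -(subrKA (g z' y)); apply: WV => //.
have := clD _ _ Dy' Cz'; congr (W _).
have := mD (g z') 1 (-1) (y' ord0) (y ord0).
by rewrite !scale1r !scaleN1r -!yE.
Qed.

End barrelled_spaces.

(** * Assembling the smoothness classes *)

Section C_upto_congruence.
Context {K : numFieldType} {V W F : tvsType K}.

Lemma C_upto_eq (leq_r : nat -> Prop) (U : set W) (f g : W -> F) : open U ->
  (forall x, U x -> f x = g x) -> C_upto leq_r U f -> C_upto leq_r U g.
Proof.
move=> oU fg [/(within_openP f oU) fc fC].
have nU x : U x -> nbhs x U by move=> Ux; exact: open_nbhs_nbhs.
split.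
  apply/within_openP => // x Ux; rewrite -fg//.
  apply: cvg_trans (fc x Ux); apply: near_eq_cvg.
  by apply: filterS (nU x Ux) => z Uz; rewrite fg.
move=> j lj; have [fd /within_openP fdc] := fC j lj; split.
  move=> x ys y Ux sy; have [l fl] := fd x ys y Ux sy; exists l.
  apply: cvg_trans fl; apply: near_eq_cvg; apply: diff_quotient_near.
  by apply: filterS (nU x Ux) => z Uz; exact: (iter_dir_derive_eq ys oU fg Uz).
have oUT := open_setXT (T := lcprod (fun _ : 'I_j.+1 => W)) oU.
apply/within_openP => // -[x y] [/= Ux _].
have dE p : U p.1 -> dn f (j := j.+1) p = dn g p.
  by move=> Up; exact: (iter_dir_derive_eq _ oU fg Up).
rewrite -dE//; apply: cvg_trans (fdc oUT (x, y) (conj Ux I)); apply: near_eq_cvg.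
apply: (filterS _ (open_nbhs_nbhs (conj oUT (conj Ux I : (U `*` setT) (x, y))))).
by move=> p [Up _]; exact: dE.
Qed.

(** An equality of functions everywhere: both sides choose from the same set of limits, also where
    that set is empty and the default 0 is taken. *)
Lemma iter_dir_derive_linear (J : V -> W) (f : W -> F) ys : linear J ->
  iter_dir_derive (f \o J) ys = iter_dir_derive f [seq J y | y <- ys] \o J.
Proof.
move=> lJ; have JE x t y : J (x + t *: y) = J x + t *: J y.
  by rewrite addrC lJ addrC.
elim/last_ind: ys => // ys y IH.
rewrite map_rcons !iter_dir_derive_rcons IH; apply/funext => x.
rewrite /dir_derive /=; congr (xget 0 _).
have dE t : diff_quotient (iter_dir_derive f [seq J y | y <- ys] \o J) x y t =
    diff_quotient (iter_dir_derive f [seq J y | y <- ys]) (J x) (J y) t.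
  by rewrite /diff_quotient /= JE.
by apply/seteqP; split=> l /=; apply: cvg_eqfun.
Qed.

Lemma C_upto_linear (leq_r : nat -> Prop) (J : V -> W) (O : set W) (f : W -> F) :
  linear J -> continuous J -> open O -> C_upto leq_r O f ->
  C_upto leq_r (J @^-1` O) (f \o J).
Proof.
move=> lJ cJ oO [/(within_openP f oO) fc fC].
have oJ : open (J @^-1` O) by apply: open_comp => // x _; exact: cJ.
split; first by apply/within_openP => // x Ox; exact: (cvg_then (cJ x) (fc _ Ox)).
move=> j lj; have [fd /within_openP fdc] := fC j lj; split.
  move=> x ys y Ox sy.
  have [|l fl] := fd (J x) [seq J y | y <- ys] (J y) Ox; first by rewrite size_map.
  exists l; rewrite iter_dir_derive_linear//; apply: cvg_eqfun fl => t.
  by rewrite /diff_quotient /= [x + _]addrC lJ [J x + _]addrC.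
apply/within_openP; first exact: open_setXT.
move=> [x y] [/= Ox _].
pose JJ (p : V * lcprod (fun _ : 'I_j.+1 => V)) : W * lcprod (fun _ : 'I_j.+1 => W) :=
  (J p.1, fun i => J (p.2 i)).
have dE p : dn (f \o J) p = dn f (JJ p).
  by rewrite /dn iter_dir_derive_linear//= -map_comp.
rewrite dE; apply: (cvg_eqfun (fun p => esym (dE p))).
apply: (cvg_then (h := JJ) _ (fdc (open_setXT oO) (JJ (x, y)) (conj Ox I))).
apply: cvg_prod; first exact: (cvg_then cvg_fst (cJ x)).
apply: lcprod_map_cvg => i.
have c : (fun p : V * lcprod (fun _ : 'I_j.+1 => V) => p.2 i) @ (x, y) --> y i.
  by apply: cvg_proj; exact: cvg_snd.
exact: (cvg_then c (cJ (y i))).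
Qed.

End C_upto_congruence.

Section Cr_congruence.
Context {R : realType}.

Lemma complex_analytic_eq (W F : tvsType (fld R Complexes)) (U : set W) (f g : W -> F) :
  open U -> (forall x, U x -> f x = g x) -> complex_analytic U f -> complex_analytic U g.
Proof.
move=> oU fg [/(within_openP f oU) fc fa]; split.
  apply/within_openP => // x Ux; rewrite -fg//.
  apply: cvg_trans (fc x Ux); apply: near_eq_cvg.
  by apply: (filterS _ (open_nbhs_nbhs (conj oU Ux))) => z Uz; rewrite fg.
move=> x Ux; have [Y [Y0 YU [beta [bP bS]]]] := fa x Ux.
exists Y; split => //; exists beta; split => // y Yy.
by rewrite -fg; [exact: bS|exact: YU].
Qed.

Lemma real_analytic_linear (V W F : tvsType (fld R Reals)) (J : V -> W) (O : set W)
    (f : W -> F) : linear J -> continuous J -> real_analytic O f ->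
  real_analytic (J @^-1` O) (f \o J).
Proof.
move=> lJ cJ [D [g [oD ga gf]]].
have J0 : J 0 = 0 by have := lJ (-1) 0 0; rewrite scaler0 addr0 scaleN1r addNr.
have JD x y : J (x + y) = J x + J y by have := lJ 1 x y; rewrite !scale1r.
have JZ a x : J (a *: x) = a *: J x by have := lJ a x 0; rewrite !addr0 J0 addr0.
have JN x : J (- x) = - J x by rewrite -scaleN1r JZ scaleN1r.
pose JC (p : cplx V) : cplx W := (J p.1, J p.2).
have lJC : linear JC.
  move=> c u v; apply: injective_projections => /=.
    by rewrite !(JD, JN, JZ).
  by rewrite !(JD, JN, JZ).
have cJC : continuous JC.
  move=> p; apply: cvg_prod.
    exact: (cvg_then (h := fun p : cplx V => p.1) cvg_fst (cJ _)).
  exact: (cvg_then (h := fun p : cplx V => p.2) cvg_snd (cJ _)).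
exists (JC @^-1` D), (g \o JC); split.
- by apply: open_comp => // x _; exact: cJC.
- exact: complex_analytic_linear.
- by move=> x Ox; have [Dx gx] := gf (J x) Ox; rewrite /JC /= J0.
Qed.

Lemma Cr_eq (Kg : ground) (W F : tvsType (fld R Kg)) (r : smoothness) (U : set W)
    (f g : W -> F) : open U -> (forall x, U x -> f x = g x) -> Cr r U f -> Cr r U g.
Proof.
case: Kg W F U f g => W F U f g oU fg; case: r => [n| |] /=; try exact: C_upto_eq.
  move=> [D [h [oD ha hf]]]; exists D, h; split => // x Ux.
  by rewrite -fg//; exact: hf.
exact: complex_analytic_eq.
Qed.

Lemma Cr_linear (Kg : ground) (V W F : tvsType (fld R Kg)) (r : smoothness)
    (J : V -> W) (O : set W) (f : W -> F) :
  linear J -> continuous J -> open O -> Cr r O f -> Cr r (J @^-1` O) (f \o J).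
Proof.
case: Kg V W F J O f => V W F J O f lJ cJ oO; case: r => [n| |] /=;
  try exact: C_upto_linear.
  exact: real_analytic_linear.
exact: complex_analytic_linear.
Qed.

(** The first alternative keeps both laws because complex analytic maps call for the one on [X], and
    all other classes for the one on [X * X]. *)
Theorem Cr_ev (Kg : ground) (k : nat) (X M F : tvsType (fld R Kg))
    (E : 'I_k -> tvsType (fld R Kg)) (ev : M -> lcprod E -> F) (r : smoothness)
    (U : set X) (f : X -> M) :
  (forall y, linear (ev^~ y)) -> (forall m, multilinear (ev m)) ->
  (forall y, continuous (ev^~ y)) ->
  hausdorff_space M -> hausdorff_space F -> open U ->
  [\/ exp_law X ev /\ exp_law (X * X)%type ev, r = Cfinite 0 /\ exp_law X ev |
      (r = Cinfty /\ Kg = Complexes) /\ exp_law X ev] ->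
  Cr r U f -> Cr r (U `*` setT) (fun p : X * lcprod E => ev (f p.1) p.2).
Proof.
move=> ev_lin ev_mul ev_cont hM hF oU.
have upto (leq_r : nat -> Prop) : leq_r 0 -> (forall j, leq_r j.+1 -> leq_r j) ->
    exp_law (X * X)%type ev -> C_upto leq_r U f ->
    C_upto leq_r (U `*` setT) (fun p : X * lcprod E => ev (f p.1) p.2).
  by move=> l0 lS e2 fC; exact: (exp_law_C_upto ev_lin ev_mul ev_cont hM hF oU lS l0 fC e2).
have zero : exp_law X ev -> C_upto (fun j => (j <= 0)%N) U f ->
    C_upto (fun j => (j <= 0)%N) (U `*` setT) (fun p : X * lcprod E => ev (f p.1) p.2).
  move=> e1 fC; apply: (exp_law_C0 ev_lin ev_mul ev_cont hF oU _ _ fC e1) => //.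
  by case.
case: Kg X M F E ev U f ev_lin ev_mul ev_cont hM hF oU upto zero
  => X M F E ev U f ev_lin ev_mul ev_cont hM hF oU upto zero [[e1 e2]|[-> e1]|[[-> //] _ e1]].
- case: r => [n| |] /=.
  + by apply: upto => //= j; exact: ltnW.
  + exact: upto.
  + exact: real_analytic_ev.
- exact: zero.
- case: r => [n| |] /=.
  + by apply: upto => //= j; exact: ltnW.
  + exact: upto.
  + exact: complex_analytic_ev.
- exact: zero.
- move=> fC; exact: (exp_law_complex_C_upto ev_lin ev_mul ev_cont hF oU _ _ fC e1).
Qed.

End Cr_congruence.

Theorem proposition4p1 (R : realType) (K L : ground) (s : subground K L)
  (r : smoothness) (k : nat) (k_gt0 : (0 < k)%N)
  (X : tvsType (fld R K)) (F : tvsType (fld R L))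
  (hX : hausdorff_space X) (hF : hausdorff_space F)
  (U : set X) (oU : open U) :
  [/\ forall E : 'I_k -> tvsType (fld R L),
      (forall i, hausdorff_space (E i)) ->
      [\/ kR_space R ((X * lcprod E) * (X * lcprod E))%type,
          r = Cfinite 0 /\ kR_space R (X * lcprod E)%type,
          (r = Cinfty /\ K = Complexes) /\ kR_space R (X * lcprod E)%type |
          forall i, finite_dimensional (E i)] ->
      forall f : X -> mlin OnCompacts E F,
      Cr r U (f : X -> restr s (mlin OnCompacts E F)) ->
      Cr r (U `*` setT)
        (fun p : X * lcprod (fun i => restr s (E i)) => f p.1 p.2 : restr s F),
      forall E : tvsType (fld R L), hausdorff_space E ->
      [\/ kR_space R ((X * E) * (X * E))%type,
          r = Cfinite 0 /\ kR_space R (X * E)%type |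
          (r = Cinfty /\ K = Complexes) /\ kR_space R (X * E)%type] ->
      forall f : X -> mlin OnCompacts (fun _ : 'I_k => E) F,
      Cr r U (f : X -> restr s (mlin OnCompacts (fun _ : 'I_k => E) F)) ->
      (forall x, U x -> symmetric_map (f x)) ->
      Cr r (U `*` setT)
        (fun p : X * lcprod (fun _ : 'I_k => restr s E) =>
           f p.1 p.2 : restr s F),
      forall E : tvsType (fld R L), hausdorff_space E ->
      finite_dimensional X -> barrelled E ->
      forall f : X -> mlin OnCompacts (fun _ : 'I_1 => E) F,
      Cr r U (f : X -> restr s (mlin OnCompacts (fun _ : 'I_1 => E) F)) ->
      Cr r (U `*` setT)
        (fun p : X * restr s E => f p.1 (fun=> p.2) : restr s F) &
      forall E : 'I_k -> tvsType (fld R L),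
      (forall i, hausdorff_space (E i)) ->
      (forall i, normable (E i)) ->
      forall f : X -> mlin OnBounded E F,
      Cr r U (f : X -> restr s (mlin OnBounded E F)) ->
      Cr r (U `*` setT)
        (fun p : X * lcprod (fun i => restr s (E i)) => f p.1 p.2 : restr s F)].
Proof.
have hM S n (E : 'I_n -> tvsType (fld R L)) : hausdorff_space (restr s (mlin S E F)).
  exact: mlin_hausdorff.
(* Restriction of scalars changes neither the points nor the topology, so the exponential laws carry
   over as they are; linearity over L gives linearity over K along [emb s]. *)
have CrE S n (E : 'I_n -> tvsType (fld R L)) (f : X -> mlin S E F) :
    [\/ exp_law X (fun (m : mlin S E F) y => m y) /\
        exp_law (X * X)%type (fun (m : mlin S E F) y => m y),
        r = Cfinite 0 /\ exp_law X (fun (m : mlin S E F) y => m y) |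
        (r = Cinfty /\ K = Complexes) /\ exp_law X (fun (m : mlin S E F) y => m y)] ->
    Cr r U (f : X -> restr s (mlin S E F)) ->
    Cr r (U `*` setT)
      (fun p : X * lcprod (fun i => restr s (E i)) => f p.1 p.2 : restr s F).
  apply: (@Cr_ev R K n X (restr s (mlin S E F)) (restr s F) (fun i => restr s (E i))
    (fun (m : mlin S E F) y => m y) r U f) => //.
  - by move=> m i x a; exact: (mlin_multilinear m).
  - by move=> y; exact: (@mlin_eval_continuous (fld R L) n S E F y).
  - exact: hM.
split.
- move=> E hE hyp f fC; apply: CrE fC.
  case: hyp => [k1|[r0 k1]|[rK k1]|fE].
  + have [k2 k3] := kR_square k1.
    by constructor 1; split; [exact: (exp_law_mlin_kR k2)|exact: (exp_law_mlin_kR k3)].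
  + by constructor 2; split => //; exact: (exp_law_mlin_kR k1).
  + by constructor 3; split => //; exact: (exp_law_mlin_kR k1).
  + have h := lcprod_compact_nbhs (fun i => finite_dimensional_locally_compact (hE i) (fE i)).
    by constructor 1; split; exact: exp_law_unif_nbhs.
- move=> E hE hyp f fC fs.
  have laws : [\/ exp_law X (@sym_ev _ k E F) /\ exp_law (X * X)%type (@sym_ev _ k E F),
      r = Cfinite 0 /\ exp_law X (@sym_ev _ k E F) |
      (r = Cinfty /\ K = Complexes) /\ exp_law X (@sym_ev _ k E F)].
    case: hyp => [k1|[r0 k1]|[rK k1]].
    + have [k2 k3] := kR_square k1.
      by constructor 1; split; [exact: (exp_law_sym_ev k2)|exact: (exp_law_sym_ev k3)].
    + by constructor 2; split => //; exact: (exp_law_sym_ev k1).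
    + by constructor 3; split => //; exact: (exp_law_sym_ev k1).
  (* Symmetry of [f x] is given for x in [U], and there the two evaluations agree. *)
  apply: (@Cr_eq R K (X * lcprod (fun _ : 'I_k => restr s E))%type (restr s F) r
    (U `*` setT) (fun p => sym_ev (f p.1) p.2)).
  + exact: open_setXT.
  + by move=> p [Up _]; exact: (@sym_ev_symmetric (fld R L) k E F (f p.1) p.2 (fs _ Up)).
  + apply: (@Cr_ev R K k X (restr s (mlin OnCompacts (fun _ : 'I_k => E) F)) (restr s F)
      (fun _ => restr s E) (@sym_ev _ k E F) r U f) => //.
    * by move=> y a; exact: (@sym_ev_linear (fld R L) k E F y (emb s a)).
    * by move=> m i x a; exact: (@sym_ev_multilinear (fld R L) k E F m i x (emb s a)).
    * by move=> y; exact: (@sym_ev_continuous (fld R L) k E F y).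
    * exact: hM.
- move=> E hE fX bE f fC.
  have lX := finite_dimensional_locally_compact hX fX.
  have lXX := locally_compact_nbhs_prod lX lX.
  (* [CrE] concerns one-fold products; the linear map [J] identifies E with such a product. *)
  pose J (p : X * restr s E) : X * lcprod (fun _ : 'I_1 => restr s E) := (p.1, fun=> p.2).
  have CrJ := CrE _ _ _ f (Or31 _ _ (conj (exp_law_barrelled (F := F) bE lX)
    (exp_law_barrelled (F := F) bE lXX))) fC.
  apply: (@Cr_linear R K _ _ _ r J _ _ _ _ _ CrJ) => //.
  + move=> p; apply: cvg_prod; first exact: cvg_fst.
    by apply: lcprod_map_cvg => i; exact: cvg_snd.
  + exact: open_setXT.
- move=> E hE nE f fC; apply: CrE fC.
  have h := lcprod_bounded_nbhs nE.
  by constructor 1; split; exact: exp_law_unif_nbhs.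
Qed.
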